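(* Let $k\ge 3$ be an integer and define the sequences $(a_i),(b_i),(C_i),(n_i)$, $i=1,\dots,\binom{k}{2}$, by $$a_1=\tfrac12,\quad b_1=\tfrac18,\quad C_1=1,\quad n_1=1,$$ and for $i=1,\dots,\binom k2-1$, $$a_{i+1}=\frac{a_i^{19k^4}}{2^{55k^6}},\quad b_{i+1}=\frac{a_i^{37k^2}}{2^{118k^4}}b_i^4,\quad C_{i+1}=\frac{2^{122k^4}}{b_i^{4}a_i^{37k^2}}C_i,\quad n_{i+1}=\frac{2^{14k^3}}{a_i^{4k}}n_i.$$ Then for every $k$-admissible graph $F$, and for all $n\ge n_{e_F}$ and $p\ge C_{e_F}n^{-1/m_F}$, we have $$\mathbb P\left(G(n,p)\xrightarrow{a_{e_F}\mu_F}F\right)\ge 1-\exp\left(-b_{e_F}\,p\binom n2\right).$$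
   Context: For a graph $F$, $v_F$ and $e_F$ denote the numbers of vertices and edges, and $\Delta(F)$ its maximum degree. For $e_F\ge1$, set $d_F=\frac{e_F-1}{v_F-2}$ if $e_F>1$ and $d_F=\frac12$ if $e_F=1$, and $m_F=\max\{d_H: H\subseteq F,\ e_H\ge1\}$. A graph $F$ is $k$-admissible if $v_F=k$ and either $e_F=1$ or $\Delta(F)\ge 2$. $G(n,p)$ is the binomial random graph on $n$ vertices in which each of the $\binom n2$ possible edges is present independently with probability $p$. For a $k$-vertex graph $F$, $\mu_F=\binom nk\frac{k!}{\mathrm{aut}(F)}p^{e_F}$ is the expected number of copies of $F$ in $G(n,p)$, where $\mathrm{aut}(F)$ is the number of automorphisms of $F$. A copy of $F$ in $G$ is a subgraph of $G$ isomorphic to $F$. For a real $\lambda>0$, $G\xrightarrow{\lambda}F$ means that every 2-coloring of the edges of $G$ produces at least $\lambda$ monochromatic copies of $F$. *)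

(* Defs.v *)
From HB Require Import structures.
From mathcomp Require Import all_boot all_order all_fingroup all_algebra.
From mathcomp Require Import reals sequences exp.

Set Implicit Arguments.
Unset Strict Implicit.
Unset Printing Implicit Defensive.

Import Order.TTheory GRing.Theory Num.Theory.

(* Finite simple graphs, as pairs (vertex set, edge set) inside a finite ground
   type T.  The vertex set may be a proper subset of T, so that subgraphs of G
   (vertices may be dropped as well as edges) are again of type [sgraph T]. *)
Definition is_sgraph (T : finType) (G : {set T} * {set {set T}}) : bool :=
  [forall e in G.2, (e \subset G.1) && (#|e| == 2)].

Record sgraph (T : finType) := SGraph {
  sgraph_val : {set T} * {set {set T}};
  sgraphP : is_sgraph sgraph_val }.

HB.instance Definition _ (T : finType) := [isSub for @sgraph_val T].
HB.instance Definition _ (T : finType) := [Finite of sgraph T by <:].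

Section Graphs.
Variable T : finType.
Implicit Types (F G H : sgraph T).

Definition verts G : {set T} := (sgraph_val G).1.
Definition edges G : {set {set T}} := (sgraph_val G).2.

Definition nverts G : nat := #|verts G|.
Definition nedges G : nat := #|edges G|.

Definition subgraph H G : bool :=
  (verts H \subset verts G) && (edges H \subset edges G).

Definition degree G (x : T) : nat := #|[set e in edges G | x \in e]|.

Definition max_degree G : nat := \max_(x in verts G) degree G x.

Definition admissible (k : nat) F : bool :=
  (nverts F == k) && ((nedges F == 1) || (2 <= max_degree F)).

(* Permutations of the vertex set are encoded as permutations of T that fix
   every point outside it. *)
Definition aut F : nat :=
  #|[set s : {perm T} | perm_on (verts F) s &&
       ([set s @: (e : {set T}) | e in edges F] == edges F)]|.

End Graphs.

Definition isomorphic (T U : finType) (F : sgraph T) (H : sgraph U) : bool :=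
  [exists f : {ffun T -> U},
    [&& dinjectiveb f (verts F), f @: verts F == verts H &
        [set f @: (e : {set T}) | e in edges F] == edges H]].

Definition copies (T U : finType) (F : sgraph T) (G : sgraph U) :
    {set sgraph U} :=
  [set H : sgraph U | subgraph H G && isomorphic F H].

Definition monochromatic (U : finType) (c : {ffun {set U} -> bool})
    (H : sgraph U) : bool :=
  [exists b : bool, [forall e in edges H, c e == b]].

Local Open Scope ring_scope.

Section Densities.
Variables (R : realType) (T : finType).
Implicit Types (F H : sgraph T).

Definition dens H : R :=
  if (1 < nedges H)%N then ((nedges H)%:R - 1) / ((nverts H)%:R - 2) else 1 / 2.

(* The default value 0 is harmless: every [dens H] below is positive, and F is
   itself one of the H as soon as it has an edge. *)
Definition max_dens F : R :=
  \big[Num.max/0]_(H : sgraph T | subgraph H F && (1 <= nedges H)%N) dens H.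

Definition mu F (n : nat) (p : R) : R :=
  'C(n, nverts F)%:R * (((nverts F)`!)%:R / (aut F)%:R) * p ^+ nedges F.

(* G -->_lambda F.  The 2-colourings of the edges of G are the restrictions to
   [edges G] of the functions c; only the values of c on [edges G] matter, since
   copies of F in G have all their edges there. *)
Definition arrows (U : finType) (lambda : R) F (G : sgraph U) : bool :=
  [forall c : {ffun {set U} -> bool},
    lambda <= #|[set H in copies F G | monochromatic c H]|%:R].

End Densities.

(* P(G(n,p) satisfies A), where G(n,p) has vertex set [set: 'I_n]. *)
Definition Gnp_weight (R : realType) (n : nat) (p : R) (G : sgraph 'I_n) : R :=
  \prod_(e : {set 'I_n} | #|e| == 2%N) (if e \in edges G then p else 1 - p).

Definition Gnp_prob (R : realType) (n : nat) (p : R) (A : pred (sgraph 'I_n)) :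
    R :=
  \sum_(G : sgraph 'I_n | (verts G == [set: 'I_n]) && A G) Gnp_weight p G.

(* Main.v *)
(* Induction on the number of edges, exposing G(n,p) in two rounds G(n,p1) and
   G(n,p2).  Let F1 be F minus an edge.  By induction, applied in every large
   vertex set U, every colouring of G(n,p1) has many monochromatic copies of F1
   in U.  This survives the deletion of a few edges, and a suitable deletion
   bounds the second moment of the number of copies of F1 that a pair completes
   to F; hence a positive proportion of the pairs in U are rich: they complete
   many copies of F1 of one colour.  Since this holds in every large U, the
   recursion of Ramsey's theorem gives a colour and a positive proportion of
   k-sets all of whose pairs are rich in this colour.  By Janson's inequality
   the second round has many copies of F formed by such pairs, even after the
   deletion of a few edges, and the probability of failure beats the number of
   colourings of the first round.  Now colour the second round: either many rich
   pairs receive their own colour, and each of them completes many copies of F,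
   or only a few do, and F is found in the other colour. *)
Require Import Defs.
From mathcomp Require Import all_boot all_order all_fingroup all_algebra.
From mathcomp Require Import reals sequences exp.
From mathcomp Require Import ring lra zify.

Set Implicit Arguments.
Unset Strict Implicit.
Unset Printing Implicit Defensive.

Import Order.TTheory GRing.Theory Num.Theory.
Local Open Scope ring_scope.

(** * Product measures *)

Section RandomSubset.
Variables (R : realType) (I : finType).
Implicit Types (p q : I -> R) (S A D : {set I}) (X Y : {set I} -> R).

(** The proof turns on a balance of exponents. The first round offers on average at most exp(p1 n^2
    / 2) colour classes, so the second round must fail with probability exp(- kap p n^2), where kap
    is fixed before p1; hence p1 = alpha p with alpha far below kap. Janson's inequality reaches
    such an exponent because it is applied to a positive proportion of all k-sets. Pairs that are
    not rich act as a third colour in Ramsey's recursion. They are harmless only because every large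
    vertex set has a positive proportion of rich pairs, and asking this of all vertex sets costs a
    factor 2^n. Two adjacent edges of F force p n to exceed a large constant, so p n^2 dominates n
    and the factor is absorbed; this is where the maximum degree matters. The second moment is
    controlled only after deletion because upper tails of subgraph counts need not be exponentially
    small in p n^2. Copies are counted as injections of a fixed vertex type, so deleting edges keeps
    k unchanged and automorphisms enter only at the very end. *)

Definition unit_vec p := forall e, 0 <= p e <= 1.

Definition wt p S : R := \prod_e (if e \in S then p e else 1 - p e).
Definition Ex p X : R := \sum_S wt p S * X S.
Definition Pr p (Q : pred {set I}) : R := Ex p (fun S => (Q S)%:R).
Definition allp p A : R := \prod_(e in A) p e.

Lemma wt_ge0 p S : unit_vec p -> 0 <= wt p S.
Proof.
by move=> pP; apply: prodr_ge0 => e _; case: ifP => _; have /andP[] := pP e;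
  lra.
Qed.

Lemma eq_Ex p X Y : X =1 Y -> Ex p X = Ex p Y.
Proof. by move=> XY; apply: eq_bigr => S _; rewrite XY. Qed.

Lemma eq_Ex_vec p q X : p =1 q -> Ex p X = Ex q X.
Proof.
move=> pq; apply: eq_bigr => S _; congr (_ * _).
by apply: eq_bigr => e _; rewrite pq.
Qed.

Lemma le_Ex p X Y : unit_vec p -> (forall S, X S <= Y S) -> Ex p X <= Ex p Y.
Proof. by move=> pP XY; apply: ler_sum => S _; rewrite ler_wpM2l ?wt_ge0. Qed.

Lemma Ex_ge0 p X : unit_vec p -> (forall S, 0 <= X S) -> 0 <= Ex p X.
Proof. by move=> pP X0; apply: sumr_ge0 => S _; rewrite mulr_ge0 ?wt_ge0. Qed.

Lemma ExZ p c X : Ex p (fun S => c * X S) = c * Ex p X.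
Proof. by rewrite mulr_sumr; apply: eq_bigr => S _; rewrite mulrCA. Qed.

Lemma ExD p X Y : Ex p (fun S => X S + Y S) = Ex p X + Ex p Y.
Proof. by rewrite -big_split; apply: eq_bigr => S _; rewrite mulrDr. Qed.

Lemma Ex_sum p (J : Type) (r : seq J) (P : pred J) (F : J -> {set I} -> R) :
  Ex p (fun S => \sum_(j <- r | P j) F j S) = \sum_(j <- r | P j) Ex p (F j).
Proof.
by rewrite exchange_big; apply: eq_bigr => S _; rewrite mulr_sumr.
Qed.

Lemma Ex_prod p (phi : I -> bool -> R) :
  Ex p (fun S => \prod_e phi e (e \in S))
    = \prod_e (p e * phi e true + (1 - p e) * phi e false).
Proof.
rewrite bigA_distr; apply: eq_bigr => S _.
by rewrite -big_split; apply: eq_bigr => e _; case: (e \in S).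
Qed.

Lemma Ex_cst p c : Ex p (fun=> c) = c.
Proof.
rewrite -[in RHS](mulr1 c) -(eq_Ex _ (X := fun S => c * \prod_(e : I) 1)).
  rewrite ExZ (Ex_prod p (fun _ _ => 1)) big1 // => e _.
  by rewrite !mulr1 subrKC.
by move=> S; rewrite big1_eq mulr1.
Qed.

(* Every function is a combination of products of one-coordinate functions;
   this reduces the change-of-measure identities below to [Ex_prod]. *)
Lemma point_decomp X S :
  X S = \sum_A X A * \prod_e ((e \in S) == (e \in A))%:R.
Proof.
rewrite (bigD1 S) //= big1 => [|e _]; last by rewrite eqxx.
rewrite mulr1 big1 ?addr0 // => A neA.
case: (pickP (fun e => (e \in S) != (e \in A))) => [e ne|eqA].
  by rewrite (bigD1 e) //= (negPf ne) mul0r mulr0.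
by case/eqP: neA; apply/setP => e; have /negbFE/eqP := eqA e.
Qed.

(** Two-round exposure. Both sides are linear in X, and for the indicator of a single set they
    factor over the coordinates. *)
Lemma Ex_setU p q X :
  Ex (fun e => p e + q e - p e * q e) X
    = Ex p (fun A => Ex q (fun B => X (A :|: B))).
Proof.
rewrite (eq_Ex _ (point_decomp X)) Ex_sum.
under [RHS]eq_Ex => A do [rewrite (eq_Ex _ (fun B => point_decomp X (A :|: B)))
  Ex_sum].
rewrite Ex_sum; apply: eq_bigr => T _.
rewrite ExZ (Ex_prod _ (fun e b => (b == (e \in T))%:R)).
under [RHS]eq_Ex => A do rewrite ExZ.
rewrite ExZ; congr (_ * _).
pose psi e b := q e * ((b || true) == (e \in T))%:R
  + (1 - q e) * ((b || false) == (e \in T))%:R.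
transitivity (Ex p (fun A => \prod_e psi e (e \in A))).
  rewrite Ex_prod; apply: eq_bigr => e _; rewrite /psi.
  by case: (e \in T) => /=; ring.
apply: eq_Ex => A.
rewrite -(Ex_prod q (fun e b => (((e \in A) || b) == (e \in T))%:R)).
by apply: eq_Ex => B; apply: eq_bigr => e _; rewrite inE.
Qed.

(** Random thinning, the companion of [Ex_setU]; with q = 1/2 it is what makes properties robust
    under deletion. *)
Lemma Ex_setI p q X :
  Ex (fun e => p e * q e) X = Ex p (fun A => Ex q (fun B => X (A :&: B))).
Proof.
rewrite (eq_Ex _ (point_decomp X)) Ex_sum.
under [RHS]eq_Ex => A do [rewrite (eq_Ex _ (fun B => point_decomp X (A :&: B)))
  Ex_sum].
rewrite Ex_sum; apply: eq_bigr => T _.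
rewrite ExZ (Ex_prod _ (fun e b => (b == (e \in T))%:R)).
under [RHS]eq_Ex => A do rewrite ExZ.
rewrite ExZ; congr (_ * _).
pose psi e b := q e * ((b && true) == (e \in T))%:R
  + (1 - q e) * ((b && false) == (e \in T))%:R.
transitivity (Ex p (fun A => \prod_e psi e (e \in A))).
  rewrite Ex_prod; apply: eq_bigr => e _; rewrite /psi.
  by case: (e \in T) => /=; ring.
apply: eq_Ex => A.
rewrite -(Ex_prod q (fun e b => (((e \in A) && b) == (e \in T))%:R)).
by apply: eq_Ex => B; apply: eq_bigr => e _; rewrite inE.
Qed.

(** Conditionally on A being contained in S, the set S is distributed as the union of A and a fresh
    sample. This form avoids conditional probabilities, also when [allp p A] is 0. *)
Lemma Ex_sub p A X :
  Ex p (fun S => (A \subset S)%:R * X S)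
    = allp p A * Ex p (fun S => X (A :|: S)).
Proof.
have prodif (P : pred I) (c : I -> bool) :
    [forall e, P e ==> c e]%:R = \prod_(e | P e) (c e)%:R :> R.
  have [/forallP c1|/forallPn[e]] := boolP [forall e, P e ==> c e].
    by rewrite big1 // => e Pe; have /implyP/(_ Pe)-> := c1 e.
  by rewrite negb_imply => /andP[Pe ce]; rewrite (bigD1 e) //= (negPf ce) mul0r.
under eq_Ex => S do rewrite (point_decomp X S) mulr_sumr.
under [in RHS]eq_Ex => S do rewrite (point_decomp X (A :|: S)).
rewrite !Ex_sum mulr_sumr; apply: eq_bigr => T _.
under eq_Ex => S do rewrite mulrCA.
rewrite !ExZ mulrCA; congr (_ * _).
pose phi e b : R := (~~ (e \in A) || b)%:R * (b == (e \in T))%:R.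
transitivity (Ex p (fun S => \prod_e phi e (e \in S))).
  apply: eq_Ex => S; rewrite big_split /=; congr (_ * _).
  have -> : A \subset S = [forall e, (e \in A) ==> (e \in S)].
    by apply/subsetP/forallP => AS e; [apply/implyP|apply/implyP]; exact: AS.
  rewrite prodif big_mkcond; apply: eq_bigr => e _.
  by case: (e \in A).
rewrite Ex_prod.
pose psi e b : R := (((e \in A) || b) == (e \in T))%:R.
have -> : Ex p (fun S => \prod_e ((e \in A :|: S) == (e \in T))%:R)
    = Ex p (fun S => \prod_e psi e (e \in S)).
  by apply: eq_Ex => S; apply: eq_bigr => e _; rewrite inE.
rewrite Ex_prod /allp (big_mkcond (fun e => e \in A)) -big_split;
  apply: eq_bigr => e _.
by rewrite /phi /psi; case: (e \in A); case: (e \in T) => /=; ring.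
Qed.

Lemma allp_ge0 p A : unit_vec p -> 0 <= allp p A.
Proof. by move=> pP; apply: prodr_ge0 => e _; case/andP: (pP e). Qed.

Lemma le_Pr p (P Q : pred {set I}) : unit_vec p ->
  (forall S, P S -> Q S) -> Pr p P <= Pr p Q.
Proof.
move=> pP PQ; apply: le_Ex => // S; rewrite ler_nat.
by case: (boolP (P S)) => // /PQ ->.
Qed.

Lemma Pr_predC p (Q : pred {set I}) : Pr p (fun S => ~~ Q S) = 1 - Pr p Q.
Proof.
rewrite -(Ex_cst p 1) -[X in _ - X]mul1r -mulNr -ExZ -ExD; apply: eq_Ex => S.
by case: (Q S); rewrite /= ?mulr1 ?mulr0 ?addr0 ?addrN.
Qed.

Lemma markov p (Q : pred {set I}) X c : unit_vec p ->
  (forall S, 0 <= X S) -> (forall S, Q S -> c <= X S) -> c * Pr p Q <= Ex p X.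
Proof.
move=> pP X0 Qc; rewrite -ExZ; apply: le_Ex => // S.
by have [/Qc|_] := boolP (Q S); rewrite ?mulr1 ?mulr0.
Qed.

End RandomSubset.

(** * Janson's inequality and deletion *)

Lemma prod_subr1_itv (R : realDomainType) (J : Type) (r : seq J) (P : pred J)
    (x : J -> R) :
  (forall j, 0 <= x j <= 1) ->
  (0 <= \prod_(j <- r | P j) (1 - x j) <= 1) /\
  (1 - \sum_(j <- r | P j) x j <= \prod_(j <- r | P j) (1 - x j)).
Proof.
move=> x01; have xP j : 0 <= 1 - x j <= 1 by have := x01 j; lra.
elim: r => [|j r [/andP[g0 g1] IH]]; first by rewrite !big_nil; split; lra.
rewrite !big_cons; case: (P j); last by rewrite g0 g1.
have /andP[y0 y1] := xP j; have /andP[x0 x1] := x01 j.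
split; last by nra.
by rewrite mulr_ge0 //= mulr_ile1.
Qed.

Section Janson.
Variables (R : realType) (I : finType) (J : Type) (A : J -> {set I}).
Variables (p : I -> R).
Hypotheses (pP : unit_vec p) (A0 : forall j, A j != set0).
Implicit Types (S : {set I}) (r : seq J).

Let meets i j := ~~ [disjoint A i & A j].
Let mean r : R := \sum_(j <- r) allp p (A j).
(** The correlation sum of Janson's inequality over ordered pairs; the diagonal is included because
    each [A i] is nonempty. *)
Definition cluster r : R :=
  \sum_(i <- r) \sum_(j <- r | ~~ [disjoint A i & A j]) allp p (A i :|: A j).
(** This is (1 - q)^X for X the number of members inside S: the chance that none of them survives an
    independent selection with probability q. Its mean serves as a Laplace transform of X. *)
Let thin (q : R) r S : R := \prod_(j <- r) (1 - q * (A j \subset S)%:R).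

Let meetsC i j : meets i j = meets j i.
Proof. by rewrite /meets disjoint_sym. Qed.

Let cluster_cons m r :
  cluster (m :: r) = allp p (A m)
    + (\sum_(j <- r | meets m j) allp p (A m :|: A j)) *+ 2 + cluster r.
Proof.
rewrite /cluster big_cons big_cons.
have -> : ~~ [disjoint A m & A m] by rewrite -setI_eq0 setIid.
rewrite setUid mulr2n -!addrA; congr (_ + (_ + _)).
under eq_bigr => i _ do rewrite big_cons.
rewrite [X in _ = X + _](big_mkcond (meets m)) -big_split /=.
apply: eq_bigr => i _; rewrite -/(meets i m) meetsC.
by case: ifP; rewrite ?add0r // setUC.
Qed.

(* No correlation inequality is needed: by [Ex_sub], a decreasing h satisfies
   E[1(A <= S) h(S)] <= P(A <= S) E[h(S)], with equality when h ignores A. *)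
Lemma thin_step (q : R) m r : 0 <= q <= 1 ->
  Ex p (thin q (m :: r)) <=
  Ex p (thin q r) * expR (- (q * (allp p (A m)
     - q * \sum_(j <- r | meets m j) allp p (A m :|: A j)))).
Proof.
move=> /andP[q0 q1].
have x01 S j : 0 <= q * (A j \subset S)%:R <= 1.
  by case: (_ \subset _); rewrite ?mulr1 ?mulr0 ?q0 ?q1 ?lexx ?ler01.
pose h S : R := \prod_(j <- r | ~~ meets m j) (1 - q * (A j \subset S)%:R).
pose g S : R := \prod_(j <- r | meets m j) (1 - q * (A j \subset S)%:R).
have h01 S : 0 <= h S <= 1 by case:
  (prod_subr1_itv r (predC (meets m)) (x01 S)).
have [g01 gge] : (forall S, 0 <= g S <= 1) /\
    (forall S, 1 - \sum_(j <- r | meets m j) q * (A j \subset S)%:R <= g S).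
  by split=> S; case: (prod_subr1_itv r (meets m) (x01 S)).
have thinE S : thin q r S = g S * h S by rewrite /thin (bigID (meets m)).
set sig := \sum_(j <- r | _) _.
have Eh : Ex p (thin q r) <= Ex p h.
  apply: le_Ex => // S; rewrite thinE; have /andP[? ?] := g01 S.
  by have /andP[? ?] := h01 S; rewrite ler_piMl.
have Eh0 : 0 <= Ex p h by apply: Ex_ge0 => // S; case/andP: (h01 S).
have Ef0 : 0 <= Ex p (thin q r).
  apply: Ex_ge0 => // S; rewrite thinE; have /andP[? ?] := g01 S.
  by have /andP[? ?] := h01 S; rewrite mulr_ge0.
have Eh1 : Ex p (fun S => (A m \subset S)%:R * h S) = allp p (A m) * Ex p h.
  rewrite Ex_sub; congr (_ * _); apply: eq_Ex => S; apply: eq_bigr => j.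
  rewrite negbK -setI_eq0 setIC => /eqP dis; congr (1 - q * (nat_of_bool _)%:R).
  apply/subsetP/subsetP => sub e ej; last by rewrite inE sub ?orbT.
  have := sub e ej; rewrite inE => /orP[em|//].
  by have := in_set0 e; rewrite -dis inE ej em.
have Eh2 j : Ex p (fun S => (A m :|: A j \subset S)%:R * h S)
    <= allp p (A m :|: A j) * Ex p h.
  rewrite Ex_sub ler_wpM2l ?allp_ge0 //; apply: le_Ex => // S.
  have mono (r0 : seq J) (P : pred J) (U T : {set I}) : U \subset T ->
      \prod_(j <- r0 | P j) (1 - q * (A j \subset T)%:R) <=
      \prod_(j <- r0 | P j) (1 - q * (A j \subset U)%:R).
    move=> UT; apply: ler_prod => i _; have /andP[_ t1] := x01 T i.
    rewrite subr_ge0 t1 /= lerD2l lerN2 ler_wpM2l // ler_nat.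
    by case: (boolP (A i \subset U)) => // /subset_trans ->.
  by apply: mono; apply: subsetUr.
have low : (allp p (A m) - q * sig) * Ex p (thin q r) <=
    Ex p (fun S => (A m \subset S)%:R * thin q r S).
  have [t0|tneg] := lerP 0 (allp p (A m) - q * sig); last first.
    apply: (@le_trans _ _ 0); first by rewrite nmulr_rle0.
    apply: Ex_ge0 => // S; rewrite thinE; have /andP[? ?] := g01 S.
    by have /andP[? ?] := h01 S; rewrite !mulr_ge0.
  apply: le_trans (ler_wpM2l t0 Eh) _.
  apply: (@le_trans _ _ (Ex p (fun S => (A m \subset S)%:R * h S
      + - q * \sum_(j <- r | meets m j) (A m :|: A j \subset S)%:R * h S))).
    rewrite ExD ExZ Eh1 Ex_sum mulrBl mulNr lerD2l lerN2 -mulrA ler_wpM2l //.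
    by rewrite mulr_suml; apply: ler_sum => j _; apply: Eh2.
  apply: le_Ex => // S; rewrite thinE.
  have -> : \sum_(j <- r | meets m j) (A m :|: A j \subset S)%:R * h S
     = (A m \subset S)%:R * h S * \sum_(j <- r | meets m j) (A j \subset S)%:R.
    rewrite mulr_sumr; apply: eq_bigr => j _; rewrite subUset.
    by case: (_ \subset S); case: (_ \subset S); rewrite /=; ring.
  have := gge S; rewrite -mulr_sumr; set T := \sum_(j <- r | _) _ => gT.
  case: (A m \subset S); rewrite ?mul0r ?mulr0 ?addr0 // !mul1r.
  have /andP[hh _] := h01 S.
  by rewrite (_ : _ + _ = (1 - q * T) * h S) ?ler_wpM2r //; ring.
apply: (@le_trans _ _ (Ex p (thin q r) * (1 - q * (allp p (A m) - q * sig)))).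
  have -> : Ex p (thin q (m :: r)) = Ex p (thin q r)
      + - q * Ex p (fun S => (A m \subset S)%:R * thin q r S).
    rewrite -ExZ -ExD; apply: eq_Ex => S; rewrite /thin big_cons; ring.
  by nra.
by rewrite ler_wpM2l //; apply: expR_ge1Dx.
Qed.

(** Iterates [thin_step]. Off its diagonal [cluster] counts every meeting pair twice, whereas the
    iteration meets it once; hence the factor 1/2. *)
Lemma Ex_thin_le (q : R) r : 0 <= q <= 1 ->
  Ex p (thin q r) <= expR (- (q * mean r) + q ^+ 2 / 2 * (cluster r - mean r)).
Proof.
move=> q01; elim: r => [|m r IH].
  rewrite /mean /cluster !big_nil subrr !mulr0 oppr0 addr0 expR0.
  by rewrite /thin (eq_Ex _ (Y := fun=> 1)) ?Ex_cst // => S; rewrite big_nil.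
apply: (le_trans (thin_step _ _ q01)).
apply: le_trans (ler_wpM2r (expR_ge0 _) IH) _.
rewrite -expRD ler_expR cluster_cons /mean big_cons le_eqVlt; apply/orP; left.
by apply/eqP; field.
Qed.

Lemma janson r (D : R) : 0 < mean r -> cluster r <= D ->
  Pr p (fun S => \sum_(j <- r) (A j \subset S)%:R < mean r / 2)
    <= expR (- (mean r ^+ 2 / (16 * D))).
Proof.
set mu := mean r => mu0 DP.
have mu_cluster : mu <= cluster r.
  rewrite /mu; elim: (r) => [|j s IH]; first by rewrite /mean /cluster !big_nil.
  rewrite cluster_cons /mean big_cons addrAC -[leLHS]addr0.
  rewrite lerD ?lerD2l // mulrn_wge0 // sumr_ge0 // => i _.
  exact: allp_ge0.
have D0 : 0 < D by apply: lt_le_trans mu0 (le_trans mu_cluster DP).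
have muD : mu <= D by apply: le_trans DP.
(* This choice makes the quadratic loss q^2 D a quarter of the linear gain q mu. *)
pose q := mu / (4 * D).
have qE : q * D = mu / 4 by rewrite /q; field; rewrite gt_eqF.
have q14 : q <= 1 / 4 by rewrite /q ler_pdivrMr ?mulr_gt0 // ; lra.
have q0 : 0 < q by rewrite divr_gt0 ?mulr_gt0.
(* An upper bound for - ln (1 - q) when q <= 1/4, so that exp(- t X) <= (1 - q)^X. *)
pose t := q + 2 * q ^+ 2.
have thin_ge S : expR (- (t * \sum_(j <- r) (A j \subset S)%:R)) <= thin q r S.
  rewrite /thin; elim: (r) => [|j s IH];
    first by rewrite !big_nil mulr0 oppr0 expR0.
  rewrite !big_cons mulrDr opprD expRD ler_pM ?expR_ge0 //.
  case: (A j \subset S); last by rewrite !mulr0 oppr0 expR0 addr0.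
  rewrite !mulr1 expRN; have ge1 : 1 <= (1 - q) * expR t.
    have := expR_ge1Dx t; rewrite /t; nra.
  rewrite -[leLHS]mul1r ler_pdivrMr ?expR_gt0 //.
have Xm : expR (- (t * (mu / 2)))
    * Pr p (fun S => \sum_(j <- r) (A j \subset S)%:R < mu / 2)
      <= Ex p (thin q r).
  apply: markov => // S; first by apply: le_trans (thin_ge S); apply: expR_ge0.
  move=> /ltW XS; apply: le_trans (thin_ge S); rewrite ler_expR lerN2.
  by rewrite ler_wpM2l // /t; nra.
have q01 : 0 <= q <= 1 by lra.
have := le_trans Xm (Ex_thin_le r q01).
rewrite mulrC expRN -ler_pdivlMr ?invr_gt0 ?expR_gt0 // invrK -expRD =>
  /le_trans.
apply; rewrite ler_expR -/mu.
have -> : mu ^+ 2 / (16 * D) = q * mu / 4.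
  by rewrite /q; field; rewrite gt_eqF.
rewrite /t; have : q ^+ 2 * cluster r <= q * mu / 4.
  by rewrite -mulrA -qE mulrA -expr2 ler_wpM2l ?sqr_ge0.
have : q ^+ 2 * mu <= q ^+ 2 * D by rewrite ler_wpM2l ?sqr_ge0.
have -> : q ^+ 2 * D = q * mu / 4 by rewrite -mulrA -qE; ring.
lra.
Qed.

End Janson.

Section Deletion.
Variables (R : realType) (I : finType) (p : I -> R).
Hypothesis pP : unit_vec p.
Implicit Types (S D : {set I}).

(* Halving p deletes any given set D with probability 2^-|D|, independently of
   the rest. *)
Lemma robust (Q : pred {set I}) (h : R) :
  (forall S T : {set I}, S \subset T -> Q S -> Q T) ->
  Pr p (fun S => [exists D : {set I}, (#|D|%:R <= h) && ~~ Q (S :\: D)])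
    <= expR h * Pr (fun e => p e * (1 / 2)) (fun S => ~~ Q S).
Proof.
move=> Qmono; rewrite -ler_pdivrMl ?expR_gt0 // -expRN.
have half01 : unit_vec (fun _ : I => 1 / 2 : R) by move=> e; lra.
rewrite /Pr Ex_setI; apply: (markov pP) => S; first exact: Ex_ge0.
move=> /existsP[D /andP[Dh nQ]].
pose q := fun _ : I => 1 / 2 : R.
have -> : expR (- h) = expR (- h) * 1 by rewrite mulr1.
apply: (@le_trans _ _ (Pr q (fun B => [disjoint B & D]))); last first.
  apply: le_Pr => // B dis; apply: contra nQ => /Qmono; apply.
  apply/subsetP => e; rewrite !inE => /andP[-> eB]; rewrite andbT.
  by apply: contraTN dis => eD; apply/pred0Pn; exists e; rewrite /= eB.
rewrite mulr1 /Pr.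
have -> : Ex q (fun B => [disjoint B & D]%:R)
   = Ex q (fun B => \prod_e (~~ ((e \in D) && (e \in B)))%:R).
  apply: eq_Ex => B; have [dis|/pred0Pn[e /= /andP[eB eD]]] :=
    boolP [disjoint _ & _].
    rewrite big1 // => e _; case: (boolP (e \in D)) => //= eD.
    by rewrite (disjointFl dis eD).
  by rewrite (bigD1 e) //= eB eD mul0r.
rewrite (Ex_prod q (fun e b => (~~ ((e \in D) && b))%:R)).
have -> : \prod_e (q e * (~~ ((e \in D) && true))%:R
     + (1 - q e) * (~~ ((e \in D) && false))%:R) = \prod_(e in D) (1 / 2 : R).
  rewrite [RHS]big_mkcond; apply: eq_bigr => e _; rewrite /q.
  by case: (e \in D) => /=; lra.
rewrite prodr_const; apply: (@le_trans _ _ (expR (- #|D|%:R))).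
  by rewrite ler_expR lerN2.
rewrite -[#|D|%:R]mulr1 -mulrN expRM_natl lerXn2r ?nnegrE ?expR_ge0 //.
  lra.
rewrite expRN div1r lef_pV2 ?posrE ?expR_gt0 //.
by have := expR_ge1Dx (1 : R).
Qed.

Variables (J : finType) (B : {set J}) (A : J -> {set I}).
Let hits S : R := \sum_(j in B) (A j \subset S)%:R.

(** Ordered z-tuples of members with pairwise disjoint sets inside S. Removing [A j] at each level
    makes the greedy lower bound and the moment bound one-step inductions. *)
Fixpoint disjoint_tuples (z : nat) S : R :=
  if z is z'.+1 then
    \sum_(j in B) (A j \subset S)%:R * disjoint_tuples z' (S :\: A j)
  else 1.

Lemma disjoint_tuples_ge0 z S : 0 <= disjoint_tuples z S.
Proof. by elim: z S => [|z IH] S //=; apply: sumr_ge0 => j _;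
  rewrite mulr_ge0. Qed.

Lemma disjoint_tuples_mono z (S T : {set I}) :
  S \subset T -> disjoint_tuples z S <= disjoint_tuples z T.
Proof.
elim: z S T => [|z IH] S T ST //=; apply: ler_sum => j _.
rewrite ler_pM ?disjoint_tuples_ge0 ?IH ?setSD // ler_nat.
by case: (boolP (A j \subset S)) => // /subset_trans ->.
Qed.

(** Members with disjoint sets occur independently: once [A j] is forced into S, the rest of the
    tuple looks only outside [A j]. *)
Lemma Ex_disjoint_tuples z :
  Ex p (disjoint_tuples z) <= (\sum_(j in B) allp p (A j)) ^+ z.
Proof.
elim: z => [|z IH] /=; first by rewrite Ex_cst.
rewrite Ex_sum exprS mulr_suml; apply: ler_sum => j _.
rewrite (Ex_sub p (A j) (fun S => disjoint_tuples z (S :\: A j))).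
rewrite ler_wpM2l ?allp_ge0 //; apply: le_trans IH; apply: le_Ex => // S.
by apply: disjoint_tuples_mono; rewrite setDUl setDv set0U subsetDl.
Qed.

(* If every small deletion leaves 2 mu members, then a greedy choice produces
   (2 mu)^z tuples of disjoint members, while mu^z are expected. *)
Lemma upper_tail_deletion (s z : nat) (mu : R) :
  0 < mu -> (forall j, j \in B -> #|A j| <= s)%N -> \sum_(j in B) allp p (A j)
    <= mu ->
  Pr p (fun S => [forall D : {set I}, (#|D| <= z * s)%N ==>
     (2 * mu <= \sum_(j in B) (A j \subset S :\: D)%:R)]) <= (1 / 2) ^+ z.
Proof.
move=> mu0 As muP; set bad := (X in Pr p X).
have low S : bad S -> (2 * mu) ^+ z <= disjoint_tuples z S.
  rewrite /bad => /forallP; elim: (z) S => [|w IH] S badS //=.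
  have hS : 2 * mu <= hits S.
    by have := badS set0; rewrite cards0 setD0.
  rewrite exprS; apply: (@le_trans _ _ (hits S * (2 * mu) ^+ w)).
    by rewrite ler_wpM2r // exprn_ge0 // mulr_ge0 // ltW.
  rewrite mulr_suml; apply: ler_sum => j jB.
  case: (A j \subset S); last by rewrite !mul0r.
  rewrite !mul1r; apply: IH => D; apply/implyP => Dw.
  rewrite setDDl; have /implyP := badS (A j :|: D); apply.
  by rewrite (leq_trans (leq_card_setU _ _).1) // mulSn leq_add // As.
have := markov pP (disjoint_tuples_ge0 z) low.
move=> /le_trans/(_ (Ex_disjoint_tuples z)) le1.
have mu1 : (\sum_(j in B) allp p (A j)) ^+ z <= mu ^+ z.
  by rewrite lerXn2r ?nnegrE ?(ltW mu0) // sumr_ge0 // => j _; apply: allp_ge0.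
have {le1 mu1} := le_trans le1 mu1.
rewrite exprMn mulrAC -ler_pdivlMr ?exprn_gt0 // divff ?expf_neq0 ?gt_eqF //.
by rewrite mulrC -ler_pdivlMr ?exprn_gt0 // expr_div_n expr1n.
Qed.

End Deletion.

(** * Overlapping labelled copies *)

Section Embeddings.
Variables (R : realType) (V W : finType).
Implicit Types (U : {set W}) (E J : {set {set V}}) (f g : {ffun V -> W}).
Implicit Types (Z : {set {set W}}).

Definition emb U : {set {ffun V -> W}} :=
  [set f in ffun_on (mem U) | injectiveb f].
Definition im f E : {set {set W}} := [set f @: (e : {set V}) | e in E].
Definition graph_edges (T : finType) (E : {set {set T}}) :=
  forall e, e \in E -> #|e| = 2%N.
(* The weight vanishes off the 2-element sets, so a random subset with these
   weights is almost surely the edge set of a graph. *)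
Definition pv (p : R) (e : {set W}) : R := if #|e| == 2%N then p else 0.
(* A form of q >= m^(-1/m_F) free of real powers, to be read with E the edge
   set of F: |cover J| is the number of vertices met by J. *)
Definition spread E (m : nat) (q : R) :=
  forall J, J \subset E -> J != set0 ->
    1 <= q ^+ (#|J| - 1) * m%:R ^+ (#|cover J| - 2).

Lemma card_emb U : #|emb U| = (#|U| ^_ #|V|)%N.
Proof. exact: card_inj_ffuns_on. Qed.

Lemma ffact_leX (m n : nat) : (m ^_ n <= m ^ n)%N.
Proof.
elim: n => [|n IH]; first by rewrite ffactn0.
by rewrite ffactnSr expnSr leq_mul // leq_subr.
Qed.

Lemma embP U f : reflect ((forall x, f x \in U) /\ injective f) (f \in emb U).
Proof.
rewrite inE; apply: (iffP andP) => [[/ffun_onP fU /injectiveP fI]|[fU fI]] //.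
by split; [apply/ffun_onP | apply/injectiveP].
Qed.

Lemma pv01 p : 0 <= p <= 1 -> unit_vec (pv p).
Proof. by move=> pP e; rewrite /pv; case: ifP => // _; rewrite lexx ler01. Qed.

Lemma allp_pv p Z : graph_edges Z -> allp (pv p) Z = p ^+ #|Z|.
Proof.
move=> ZE; rewrite /allp -prodr_const; apply: eq_bigr => e eZ.
by rewrite /pv ZE.
Qed.

Lemma im_edges f E : injective f -> graph_edges E -> graph_edges (im f E).
Proof. by move=> fI EE _ /imsetP[e eE ->]; rewrite card_imset // EE. Qed.

Lemma card_im f E : injective f -> #|im f E| = #|E|.
Proof. by move=> fI; rewrite card_imset //; apply: imset_inj. Qed.

Lemma mem_im f E e : injective f -> (f @: (e : {set V}) \in im f E) = (e \in E).
Proof. by move=> fI; rewrite /im mem_imset //; apply: imset_inj. Qed.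

Lemma card_edges_le E : graph_edges E -> (#|E| <= 'C(#|V|, 2))%N.
Proof.
move=> EE; rewrite -(card_draws V 2); apply: subset_leq_card.
by apply/subsetP => e eE; rewrite inE EE.
Qed.

Definition shared f g E : {set {set V}} :=
  [set e in E | f @: (e : {set V}) \in im g E].

Lemma card_im_setU f g E : injective f -> injective g ->
  (#|im f E :|: im g E| + #|shared f g E| = 2 * #|E|)%N.
Proof.
move=> fI gI; rewrite mul2n -addnn -{1}(card_im E fI) -(card_im E gI).
rewrite -cardsUI; congr (_ + _)%N; rewrite -(card_im _ fI);
  congr #|pred_of_set _|.
apply/setP => e; rewrite inE; apply/imsetP/andP => [[x]|[/imsetP[x xE ->] xg]].
  by rewrite inE => /andP[xE xg] ->; rewrite mem_im.
by exists x; rewrite // inE xE.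
Qed.

Lemma shared_neq0 f g E : injective f ->
  ~~ [disjoint im f E & im g E] -> shared f g E != set0.
Proof.
move=> fI /pred0Pn[_ /andP[/imsetP[e eE ->] eg]].
by apply/set0Pn; exists e; rewrite inE eE.
Qed.

Lemma card_cover_ge2 E J : graph_edges E -> J \subset E -> J != set0 ->
  (1 < #|cover J|)%N.
Proof.
move=> EE JE /set0Pn[e eJ]; rewrite -(EE e) ?(subsetP JE) //.
by apply: subset_leq_card; apply: bigcup_sup.
Qed.

Lemma card_through U (A : {set V}) (B : {set W}) :
  (#|[set f in emb U | f @: A \subset B]|
    <= #|B| ^ #|A| * #|U| ^ (#|V| - #|A|))%N.
Proof.
pose F (x : V) : pred W := if x \in A then mem B else mem U.
apply: (@leq_trans #|family F|).
  apply: subset_leq_card; apply/subsetP => f;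
    rewrite inE => /andP[/embP[fU _] fA].
  apply/familyP => x; rewrite /F; case: ifP => xA //.
  by apply: (subsetP fA); apply: imset_f.
rewrite card_family foldrE big_map big_enum /= (bigID (mem A)) /=.
have -> : (\prod_(x in A) #|F x| = #|B| ^ #|A|)%N.
  by rewrite -prod_nat_const; apply: eq_bigr => x xA; rewrite /F xA.
rewrite -(cardsT V) -cardsDS ?subsetT // setTD leq_mul2l.
apply/orP; right.
rewrite leq_eqVlt; apply/orP; left; apply/eqP.
rewrite -prod_nat_const; apply: eq_big => x.
  by rewrite inE.
by move=> xA; rewrite /F (negPf xA).
Qed.

Lemma expn_self_le (k : nat) : (k ^ k <= 2 ^ (k ^ 2))%N.
Proof. case: k => [|k] //; rewrite -mulnn expnM leq_exp2r //.
by apply: ltnW; apply: ltn_expl. Qed.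

(** Fix g and classify f by the set J of edges that f shares with g. Then f sends the v vertices of
    J into the image of g, which leaves at most k^k m^(k-v) choices, each of weight p^(2|E| - |J|).
    By [spread] the worst J is a single edge, which gives m^(k-2) p^(2|E| - 1). The constant
    collects k^k and the number of sets J, each at most 2^(k^2). *)
Lemma overlap U E (p : R) : (2 <= #|V|)%N -> graph_edges E -> 0 < p <= 1 ->
  spread E #|U| p ->
  \sum_(f in emb U) \sum_(g in emb U | ~~ [disjoint im f E & im g E])
     p ^+ #|im f E :|: im g E|
  <= 2 ^+ (2 * #|V| ^ 2) * #|U|%:R ^+ (2 * #|V| - 2) * p ^+ (2 * #|E| - 1).
Proof.
move=> k2 EE /andP[p0 p1] sp; set k := #|V|; set m := #|U|.
under eq_bigr do rewrite big_mkcondr /=.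
rewrite exchange_big /=.
under eq_bigr do rewrite -big_mkcondr /=.
pose bound : R := 2 ^+ (2 * k ^ 2) * m%:R ^+ (k - 2) * p ^+ (2 * #|E| - 1).
apply: (@le_trans _ _ (\sum_(g in emb U) bound)); last first.
  rewrite sumr_const card_emb -[leLHS]mulr_natl /bound.
  rewrite (_ : (2 * k - 2)%N = (k + (k - 2))%N); last by lia.
  rewrite exprD [in leRHS]mulrCA -[leRHS]mulrA ler_wpM2r //.
    by rewrite !mulr_ge0 ?exprn_ge0 // ltW.
  by rewrite -natrX ler_nat ffact_leX.
apply: ler_sum => g /embP[gU gI].
apply: (@le_trans _ _ (\sum_(J in powerset E | J != set0)
   \sum_(f in [set f in emb U | f @: cover J \subset g @: setT])
     p ^+ (2 * #|E| - #|J|))).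
  rewrite (exchange_big_dep (mem (emb U))) /=; last first.
    by move=> J f _; rewrite inE => /andP[].
  rewrite big_mkcondr; apply: ler_sum => f fU.
  have /embP[_ fI] := fU; case: ifP => meets; last first.
    by apply: sumr_ge0 => J _; rewrite exprn_ge0 // ltW.
  rewrite (bigD1 (shared f g E)) /=; last first.
    rewrite powersetE shared_neq0 // andbT [X in _ && X]inE fU.
    apply/andP; split; apply/subsetP => e; first by rewrite inE => /andP[].
    case/imsetP => x /bigcupP[d]; rewrite inE =>
      /andP[dE /imsetP[d' _ fd]] xd ->.
    have : f x \in f @: d by apply: imset_f.
    by rewrite fd => /imsetP[y _ ->]; apply: imset_f.
  rewrite -(card_im_setU E fI gI) addnK lerDl sumr_ge0 // => J _.
  by rewrite exprn_ge0 // ltW.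
apply: (@le_trans _ _ (\sum_(J in powerset E) 2 ^+ (k ^ 2) * m%:R ^+ (k - 2)
  * p ^+ (2 * #|E| - 1))).
  rewrite big_mkcondr; apply: ler_sum => J; rewrite inE => JE; case: ifP => J0;
    last first.
    by rewrite !mulr_ge0 ?exprn_ge0 // ltW.
  rewrite sumr_const -[leLHS]mulr_natl.
  have vJ := card_cover_ge2 EE JE J0; set v := #|cover J| in vJ.
  have vk : (v <= k)%N by apply: max_card.
  have jE : (#|J| <= #|E|)%N by apply: subset_leq_card.
  have j0 : (0 < #|J|)%N by rewrite card_gt0.
  apply: (@le_trans _ _ ((k ^ k)%:R *
    (m%:R ^+ (k - v) * p ^+ (2 * #|E| - #|J|)))).
    rewrite mulrA ler_wpM2r ?exprn_ge0 ?(ltW p0) // -natrX -natrM ler_nat.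
    apply: leq_trans (card_through _ _ _) _.
    rewrite (card_imset _ gI) cardsT leq_mul2r leq_pexp2l ?orbT //.
    by apply: leq_trans k2.
  rewrite -!mulrA ler_pM ?mulr_ge0 ?exprn_ge0 ?(ltW p0) //.
    by rewrite -natrX ler_nat expn_self_le.
  have := sp J JE J0; rewrite -/m -/v => sJ.
  (* Multiplying by the quantity that [spread] bounds below by 1 turns the exponents of J into those
     of one edge. *)
  apply: (@le_trans _ _ (m%:R ^+ (k - v) * p ^+ (2 * #|E| - #|J|)
     * (p ^+ (#|J| - 1) * m%:R ^+ (v - 2)))).
    by rewrite ler_peMr // mulr_ge0 ?exprn_ge0 ?(ltW p0).
  rewrite [p ^+ (#|J| - 1) * _]mulrC mulrACA -!exprD.
  rewrite le_eqVlt; apply/orP; left; apply/eqP.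
  by congr (_ ^+ _ * _ ^+ _); lia.
rewrite sumr_const card_powerset -[leLHS]mulr_natl /bound !mulrA.
rewrite ler_wpM2r ?exprn_ge0 ?(ltW p0) // ler_wpM2r ?exprn_ge0 //.
rewrite natrX -exprD ler_eXn2l ?ltr1n // mul2n -addnn leq_add2r.
apply: leq_trans (card_edges_le EE) _; rewrite bin2.
by apply: leq_trans (half_leq (leq_mul (leqnn _) (leq_pred _))) _; lia.
Qed.

End Embeddings.

(** * Monochromatic cliques *)

Section MonochromaticCliques.
Variables (R : realType) (W : finType) (Gam : bool -> {set {set W}}).
Hypothesis GamE : forall b, graph_edges (Gam b).
Implicit Types (U : {set W}) (b : bool) (v w : W).

Definition adj b v w := [set v; w] \in Gam b.
Definition nbh b v : {set W} := [set w | adj b v w].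

Lemma adjxx b v : adj b v v = false.
Proof. by apply/negP => /GamE; rewrite setUid cards1. Qed.

Lemma adjC b v w : adj b v w = adj b w v.
Proof. by rewrite /adj setUC. Qed.

(** Ordered s-cliques of colour b, counted along the recursion of Ramsey's theorem; [cliques_tuple]
    compares the number with actual tuples. *)
Fixpoint cliques b (s : nat) U : nat :=
  if s is s'.+1 then \sum_(v in U) cliques b s' (U :&: nbh b v) else 1%N.

Lemma cliquesS b s U U' : U \subset U' -> (cliques b s U <= cliques b s U')%N.
Proof.
elim: s U U' => [|s IH] U U' UU' //=.
rewrite [leqLHS]big_mkcond [leqRHS]big_mkcond; apply: leq_sum => v _.
by case: ifP => // vU; rewrite (subsetP UU' v vU) IH // setSI.
Qed.

Section Ramsey.
Variables (eta r : R) (U0 : {set W}) (k : nat).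
Hypotheses (eta01 : 0 < eta <= 1).
Hypothesis dense : forall U, U \subset U0 -> r <= #|U|%:R ->
  4 * eta * #|U|%:R ^+ 2 <= #|[set e in Gam true :|:
    Gam false | e \subset U]|%:R.

Let high b U := [set v in U | eta * #|U|%:R <= #|U :&: nbh b v|%:R].

(** Averaging: the degrees in U sum to at least 4 eta u^2. Vertices that are high in neither colour
    contribute at most 2 eta u^2 in all, and any other vertex at most u, so at least 2 eta u
    vertices are high in some colour. *)
Lemma high_colour U : U \subset U0 -> r <= #|U|%:R ->
  exists b, eta * #|U|%:R <= #|high b U|%:R.
Proof.
move=> UU0 rU; have /andP[e0 e1] := eta01; set u : R := #|U|%:R.
pose deg v := #|U :&: nbh true v :|: U :&: nbh false v|.
have sum_deg : 4 * eta * u ^+ 2 <= (\sum_(v in U) deg v)%:R.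
  apply: le_trans (dense UU0 rU) _; rewrite ler_nat.
  pose P := [set x : W * W | (x.1 \in U) &&
    (x.2 \in U :&: nbh true x.1 :|: U :&: nbh false x.1)].
  have -> : (\sum_(v in U) deg v = #|P|)%N.
    rewrite -[RHS]sum1_card; under eq_bigr do rewrite /deg -sum1_card.
    by rewrite pair_big_dep; apply: eq_bigl => x; rewrite [RHS]inE.
  apply: leq_trans (leq_imset_card (fun x : W * W => [set x.1; x.2]) P).
  apply: subset_leq_card; apply/subsetP => e; rewrite !inE => /andP[eG eU].
  have e2 : #|e| == 2%N by case/orP: eG => /GamE ->.
  have [x [y [xy def_e]]] := cards2P _ e2.
  apply/imsetP; exists (x, y) => //; rewrite !inE /= /adj -def_e.
  have [-> ->] : x \in U /\ y \in U.
    by split; apply: (subsetP eU); rewrite def_e !inE eqxx ?orbT.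
  by [].
have [|lt0] := leP (eta * u) #|high true U|%:R; first by exists true.
exists false; have u0 : 0 <= u by [].
have degU v : (deg v <= #|U|)%N.
  by apply: subset_leq_card; rewrite -setIUr subsetIl.
have deg_le : ((\sum_(v in U) deg v)%:R : R)
    <= \sum_(v in U) 2 * eta * u + \sum_(v in high true U :|: high false U) u.
  have -> : \sum_(v in high true U :|: high false U) u =
      \sum_(v in U) (if v \in high true U :|: high false U then u else 0).
    rewrite [LHS]big_mkcond [RHS]big_mkcond; apply: eq_bigr => v _.
    by rewrite !inE; case: (v \in U).
  rewrite natr_sum -big_split; apply: ler_sum => v vU /=.
  case: ifP => [_|]; first by rewrite -[leLHS]add0r lerD // ?ler_nat //; nra.
  rewrite !inE vU /= => /norP[]; rewrite -!ltNge => dt df.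
  rewrite addr0; apply: le_trans (_ : #|U :&: nbh true v|%:R + #|U :&:
    nbh false v|%:R <= _).
    by rewrite -natrD ler_nat (leq_card_setU _ _).1.
  by rewrite -/u in dt df; lra.
have {deg_le sum_deg} := le_trans sum_deg deg_le.
rewrite !sumr_const -(mulr_natl _ #|U|) -(mulr_natl u) -/u => le1.
have le2 : #|high true U :|: high false U|%:R
  <= #|high true U|%:R + #|high false U|%:R :> R.
  by rewrite -natrD ler_nat (leq_card_setU _ _).1.
have [->|uN0] := eqVneq u 0; first by rewrite mulr0.
have u_gt0 : 0 < u by rewrite lt0r uN0.
have : 2 * eta * u <= #|high true U :|: high false U|%:R.
  by rewrite -(ler_pM2r u_gt0); lra.
lra.
Qed.

(** Here [s b] is the clique size still wanted in colour b. Each step passes to a neighbourhood of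
    size at least eta |U| and lowers one target. Replacing |U| by eta |U| costs at most eta^k in the
    count, so t steps cost eta^(k t). *)
Lemma ramsey_count t (s : bool -> nat) U :
  (s true + s false = t)%N -> (forall b, s b <= k)%N -> U \subset U0 ->
  r <= eta ^+ t * #|U|%:R ->
  exists b, eta ^+ (k * t) * #|U|%:R ^+ s b <= (cliques b (s b) U)%:R.
Proof.
have /andP[e0 e1] := eta01.
elim: t s U => [|t IH] s U st sk UU0 rU.
  exists true; have -> : s true = 0%N by lia.
  by rewrite muln0 expr0 mulr1.
have etaX n : 0 < eta ^+ n <= 1.
  by rewrite exprn_gt0 // exprn_ile1 // ltW.
have [[b sb0]|spos] : (exists b, s b = 0%N) \/ (forall b, 0 < s b)%N.
  case E : (s true) => [|m]; first by left; exists true.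
  case E' : (s false) => [|m']; first by left; exists false.
  by right; case; rewrite ?E ?E'.
  by exists b; rewrite sb0 expr0 mulr1 /=; case/andP: (etaX (k * t.+1)%N).
have rU' : r <= #|U|%:R.
  by apply: le_trans rU _; rewrite ler_piMl //; case/andP: (etaX t.+1).
have [b hb] := high_colour UU0 rU'.
pose s' c := if c == b then (s b).-1 else s c.
have s't : (s' true + s' false = t)%N.
  by have := spos b; rewrite /s'; case: (b) st => /=; lia.
have s'k c : (s' c <= k)%N.
  by rewrite /s'; case: eqP => // _; apply: leq_trans (leq_pred _) (sk b).
set u : R := #|U|%:R.
have next v : v \in high b U ->
    exists c, eta ^+ (k * t) * (eta * u) ^+ s' c
      <= (cliques c (s' c) (U :&: nbh b v))%:R.
  rewrite inE => /andP[vU hv].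
  have [||c hc] := IH s' (U :&: nbh b v) s't s'k.
  - by apply: subset_trans UU0; apply: subsetIl.
  - by apply: le_trans rU _; rewrite exprSr -mulrA ler_wpM2l //;
    case/andP: (etaX t); lra.
  exists c; apply: le_trans hc; rewrite ler_wpM2l //;
    first by case/andP: (etaX (k * t)%N); lra.
  by rewrite lerXn2r ?nnegrE ?mulr_ge0 ?(ltW e0).
(* The target of the other colour was not lowered, so a single v whose neighbourhood yields that
   colour finishes. Otherwise all high vertices yield b, and their counts are summed. *)
have [/existsP[v /andP[vh hv]]|] := boolP [exists v, (v \in high b U) &&
    (eta ^+ (k * t) * (eta * u) ^+ s (~~ b)
      <= (cliques (~~ b) (s (~~ b)) (U :&: nbh b v))%:R)].
  exists (~~ b); apply: le_trans (_ :
    (cliques (~~ b) (s (~~ b)) (U :&: nbh b v))%:R <= _); last first.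
    by rewrite ler_nat cliquesS // subsetIl.
  apply: le_trans hv; rewrite exprMn mulrA ler_wpM2r ?exprn_ge0 //.
  by rewrite -exprD ler_wiXn2l // ?(ltW e0) //; have := sk (~~ b); lia.
move=> /existsPn none; exists b.
have all_b v : v \in high b U ->
    eta ^+ (k * t) * (eta * u) ^+ (s b).-1
      <= (cliques b (s b).-1 (U :&: nbh b v))%:R.
  move=> vh; have [c] := next v vh; rewrite /s';
    case: (eqVneq c b) => [-> //|cb].
  have := none v; rewrite vh /=; have -> : ~~ b = c
    by case: (c) (b) cb => [] [].
  by move=> /negP.
have <- : (s b).-1.+1 = s b by rewrite prednK.
rewrite /= natr_sum.
apply: le_trans (_ : \sum_(v in high b U) eta ^+ (k * t) * (eta * u) ^+ (s b).-1
  <= _).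
  rewrite sumr_const -mulr_natl.
  apply: le_trans (_ : eta * u * (eta ^+ (k * t) * (eta * u) ^+ (s b).-1) <= _).
    rewrite mulrCA -exprS exprMn mulrA ler_wpM2r ?exprn_ge0 //.
    rewrite -exprD ler_wiXn2l // ?(ltW e0) //.
    by have := sk b; have := spos b; lia.
  by rewrite ler_wpM2r // mulr_ge0 ?exprn_ge0 ?mulr_ge0 ?(ltW e0).
apply: le_trans (ler_sum _ all_b) _.
rewrite [leLHS]big_mkcond [leRHS]big_mkcond; apply: ler_sum => v _.
by rewrite inE; case: (v \in U) => //=; case: ifP.
Qed.

End Ramsey.

Lemma cliques_tuple b s U :
  (cliques b s U <= #|[set t : s.-tuple W | all (mem U) t &&
    pairwise (adj b) t]|)%N.
Proof.
elim: s U => [|s IH] U /=.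
  by apply/card_gt0P; exists [tuple]; rewrite inE.
set A := [set t | _].
have -> : #|A| = (\sum_v #|[set t in A | thead t == v]|)%N.
  rewrite -sum1_card (partition_big (@thead _ _) xpredT) //=.
  by apply: eq_bigr => v _; rewrite -sum1_card; apply: eq_bigl => t;
    rewrite inE.
rewrite big_mkcond; apply: leq_sum => v _; case: ifP => // vU.
apply: leq_trans (IH _) _.
rewrite -(card_imset _ (f := fun t : s.-tuple W => [tuple of v :: t]));
  last first.
  by move=> t t' /(congr1 val)[] tt'; apply: val_inj.
apply: subset_leq_card; apply/subsetP => _ /imsetP[t + ->].
rewrite !inE theadE eqxx andbT => /andP[/allP tU tp] /=.
rewrite vU tp andbT /=; apply/andP; split.
  by apply/allP => w /tU /setIP[].
by apply/allP => w /tU /setIP[_]; rewrite inE.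
Qed.

Lemma cliques_emb (V : finType) b U :
  (cliques b #|V| U <= #|[set f in @emb V W U |
     [forall x, forall y, (x != y) ==> ([set f x; f y] \in Gam b)]]|)%N.
Proof.
apply: leq_trans (cliques_tuple _ _ _) _.
pose F (t : #|V|.-tuple W) := [ffun x : V => tnth t (enum_rank x)].
rewrite -(card_imset _ (f := F)); last first.
  move=> t t' /ffunP tt'; apply: eq_from_tnth => i.
  by have := tt' (enum_val i); rewrite !ffunE enum_valK.
apply: subset_leq_card; apply/subsetP => _ /imsetP[t + ->].
rewrite inE => /andP[/allP tU tp].
have adjF (i j : 'I_#|V|) : i != j -> adj b (tnth t i) (tnth t j).
  have key (i' j' : 'I_#|V|) : (i' < j')%N -> adj b (tnth t i') (tnth t j').
    move=> ij; pose w0 := tnth t i'; rewrite !(tnth_nth w0).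
    by move/(pairwiseP w0): tp; apply; rewrite ?inE ?size_tuple.
  by rewrite neq_ltn => /orP[] /key //; rewrite adjC.
rewrite inE; apply/andP; split.
  apply/embP; split=> [x|x y]; first by rewrite ffunE; apply: tU;
    apply: mem_tnth.
  rewrite !ffunE => xy; apply/eqP; apply: contraT => nxy.
  have : enum_rank x != enum_rank y by rewrite (inj_eq enum_rank_inj).
  by move=> /adjF; rewrite xy adjxx.
apply/'forall_forallP => x y; apply/implyP => nxy; rewrite !ffunE.
by apply: adjF; rewrite (inj_eq enum_rank_inj).
Qed.

(** Both targets are |V|, so the recursion has depth at most 2 |V|: this is the exponent in the size
    condition, and |V| times it is the exponent in the count. *)
Lemma mono_cliques (V : finType) (eta r : R) U0 :
  0 < eta <= 1 ->
  (forall U, U \subset U0 -> r <= #|U|%:R ->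
  4 * eta * #|U|%:R ^+ 2 <= #|[set e in Gam true :|:
    Gam false | e \subset U]|%:R) ->
  r <= eta ^+ (2 * #|V|) * #|U0|%:R ->
  exists b, eta ^+ (2 * #|V| ^ 2) * #|U0|%:R ^+ #|V| <=
    #|[set f in @emb V W U0 |
     [forall x, forall y, (x != y) ==> ([set f x; f y] \in Gam b)]]|%:R.
Proof.
move=> eta01 dense rU.
have sumk : (#|V| + #|V| = 2 * #|V|)%N by rewrite mul2n addnn.
have [b hb] := @ramsey_count eta r U0 #|V| eta01 dense (2 * #|V|) (fun=> #|V|)
  U0
  sumk (fun=> leqnn _) (subxx _) rU.
exists b; have := le_trans hb (_ : (cliques b #|V| U0)%:R <= _).
by rewrite mulnCA expnS expn1; apply; rewrite ler_nat cliques_emb.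
Qed.

End MonochromaticCliques.

(** * Arrowing and the case of one edge *)

(** Markov's inequality for (1/2)^X. Each coordinate contributes 1 - p/2 <= exp(- p/2), while 1/2 >=
    exp(- 3/4), so the exponent is (3/4 - 1) p N / 2 = - p N / 8. This is the origin of b_1 =
    1/8. *)
Lemma chernoff_half (R : realType) (I : finType) (p : R) (P : {set I})
  (pw : I -> R) :
  unit_vec pw -> (forall e, e \in P -> pw e = p) ->
  Pr pw (fun S => #|S :&: P|%:R < 1 / 2 * p * #|P|%:R)
    <= expR (- (1 / 8 * p * #|P|%:R)).
Proof.
move=> pwP pwE; set N := #|P|%:R.
pose X (S : {set I}) : R := \prod_(e in P) (if e \in S then 1 / 2 else 1).
have XE S : X S = (1 / 2) ^+ #|S :&: P|.
  rewrite /X -prodr_const [LHS]big_mkcond [RHS]big_mkcond;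
    apply: eq_bigr => e _.
  by rewrite inE; case: (e \in S); case: (e \in P).
have half : expR (- (3 / 4)) <= 1 / 2 :> R.
  rewrite expRN div1r lef_pV2 ?posrE ?expR_gt0 //.
  have -> : 3 / 4 = 6%:R * (1 / 8) :> R by field.
  rewrite expRM_natl; apply: (@le_trans _ _ ((1 + 1 / 8) ^+ 6)).
    by lra.
  by rewrite lerXn2r ?nnegrE ?expR_ge0 ?expR_ge1Dx //; lra.
have EX : Ex pw X <= expR (- (1 / 2 * p * N)).
  pose phi e b : R := if e \in P then (if b then 1 / 2 else 1) else 1.
  have -> : Ex pw X = Ex pw (fun S => \prod_e phi e (e \in S)).
    by apply: eq_Ex => S; rewrite /X big_mkcond.
  rewrite Ex_prod (bigID (mem P)) /= [X in _ * X]big1 => [|e eP]; last first.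
    by rewrite /phi (negPf eP); ring.
  rewrite mulr1 mulrC -mulrN expRM_natl -prodr_const; apply: ler_prod => e eP.
  rewrite /phi eP pwE //; have /andP[p0 p1] : 0 <= p <= 1 by rewrite -(pwE e).
  by apply/andP; split; [lra | apply: le_trans (expR_ge1Dx _); lra].
have mk : expR (- (3 / 4 * (1 / 2 * p * N)))
    * Pr pw (fun S => #|S :&: P|%:R < 1 / 2 * p * N) <= Ex pw X.
  apply: markov => // S; first by rewrite XE exprn_ge0 ?divr_ge0.
  move=> /ltW SP; rewrite XE.
  apply: (@le_trans _ _ (expR (- (3 / 4)) ^+ #|S :&: P|)); last first.
    by rewrite lerXn2r ?nnegrE ?expR_ge0 ?divr_ge0.
  by rewrite -expRM_natl ler_expR; lra.
move: (le_trans mk EX).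
rewrite mulrC expRN -ler_pdivlMr ?invr_gt0 ?expR_gt0 // invrK -expRD =>
  /le_trans.
by apply; rewrite ler_expR; lra.
Qed.

Section Counting.
Variables (R : realType) (V W : finType).
Implicit Types (U : {set W}) (E : {set {set V}}) (S Z C : {set {set W}}).
Implicit Types (e : {set W}) (d : {set V}).

Definition pairs U : {set {set W}} :=
  [set e : {set W} | e \subset U & #|e| == 2%N].
(* Labelled copies: injections of V into U.  In [arrow] the colour classes are C
   and its complement. *)
Definition cnt E U Z : nat := #|[set f in emb V U | im f E \subset Z]|.
Definition arrow E U (lam : R) S : bool :=
  [forall C : {set {set W}}, lam <= (cnt E U (S :&: C) + cnt E U (S :\: C))%:R].

Lemma card_pairs U : #|pairs U| = 'C(#|U|, 2).
Proof. exact: cards_draws. Qed.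

Lemma cntS E U Z Z' : Z \subset Z' -> (cnt E U Z <= cnt E U Z')%N.
Proof.
move=> ZZ'; apply: subset_leq_card; apply/subsetP => f; rewrite !inE.
by case/andP=> -> fZ; rewrite (subset_trans fZ).
Qed.

Lemma arrowS E U lam S S' : S \subset S' -> arrow E U lam S -> arrow E U lam S'.
Proof.
move=> SS' /forallP aS; apply/forallP => C; apply: le_trans (aS C) _.
by rewrite ler_nat leq_add // cntS ?setSI ?setSD.
Qed.

Lemma emb_pair U (f : {ffun V -> W}) d :
  f \in emb V U -> #|d| = 2%N -> f @: d \in pairs U.
Proof.
case/embP => fU fI d2; rewrite inE card_imset // d2 eqxx andbT.
by apply/subsetP => _ /imsetP[x _ ->].
Qed.

Definition fibre d U e := [set f in emb V U | f @: d == e].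

(** Permutations of U transport one fibre to another; hence all fibres have the same size, which
    never has to be computed. *)
Lemma perm_pairs U e e' : e \in pairs U -> e' \in pairs U ->
  exists2 s : {perm W}, perm_on U s & s @: e = e'.
Proof.
rewrite !inE => /andP[eU /cards2P[x [y [xy def_e]]]].
move=> /andP[eU' /cards2P[x' [y' [xy' def_e']]]].
have [xU yU] : x \in U /\ y \in U.
  by split; apply: (subsetP eU); rewrite def_e !inE eqxx ?orbT.
have [xU' yU'] : x' \in U /\ y' \in U.
  by split; apply: (subsetP eU'); rewrite def_e' !inE eqxx ?orbT.
have tU a b : a \in U -> b \in U -> perm_on U (tperm a b).
  move=> aU bU; apply/subsetP => z; rewrite inE.
  by case: tpermP => [-> //|-> //|_ _]; rewrite eqxx.
have t1U : tperm x x' y \in U by rewrite perm_closed // tU.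
exists (tperm x x' * tperm (tperm x x' y) y')%g.
  by apply: perm_onM; apply: tU.
rewrite def_e def_e' imsetU1 imset_set1 !permM tpermL tpermL.
congr [set _; _]; rewrite tpermD //; last by rewrite eq_sym.
by rewrite -{2}(tpermL x x') (inj_eq perm_inj) eq_sym.
Qed.

Lemma card_fibre_le d U e e' : e \in pairs U -> e' \in pairs U ->
  (#|fibre d U e| <= #|fibre d U e'|)%N.
Proof.
move=> eP eP'; have [s sU se] := perm_pairs eP eP'.
pose F (f : {ffun V -> W}) := [ffun x => s (f x)].
rewrite -(card_imset _ (f := F)); last first.
  move=> f g /ffunP fg; apply/ffunP => x; apply: (@perm_inj _ s).
  by have := fg x; rewrite !ffunE.
apply: subset_leq_card; apply/subsetP => _ /imsetP[f + ->].
move=> /setIdP[/embP[fU fI] /eqP fd]; apply/setIdP; split.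
  apply/embP; split=> [x|x y]; first by rewrite ffunE perm_closed.
  by rewrite !ffunE => /perm_inj/fI.
apply/eqP; rewrite -se -fd -imset_comp; apply: eq_imset => x.
by rewrite ffunE.
Qed.

Lemma emb_fibres d U (Q : pred {ffun V -> W}) : #|d| = 2%N ->
  #|[set f in emb V U | Q f]| = (\sum_(e in pairs U)
    #|[set f in fibre d U e | Q f]|)%N.
Proof.
move=> d2; rewrite -sum1_card.
rewrite (partition_big (fun f : {ffun V -> W} => f @: d) (mem (pairs U))) /=.
  apply: eq_bigr => e _; rewrite -sum1_card; apply: eq_bigl => f.
  by rewrite !inE andbAC.
by move=> f; rewrite inE => /andP[fU _]; apply: emb_pair.
Qed.

(** A copy with one edge is always monochromatic, so whatever C is the count equals the number of
    edges of S in U times the common fibre size. *)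
Lemma arrow_one_edge d U (p : R) : #|d| = 2%N -> 0 <= p <= 1 ->
  Pr (pv p) (fun S => ~~ arrow [set d] U (1 / 2 * (#|U| ^_ #|V|)%:R * p) S)
    <= expR (- (1 / 8 * p * 'C(#|U|, 2)%:R)).
Proof.
move=> d2 p01; rewrite -card_pairs.
apply: le_trans (chernoff_half (pv01 p01) (P := pairs U) (p := p) _);
  last first.
  by move=> e; rewrite inE /pv => /andP[_ ->].
apply: le_Pr; first exact: pv01.
move=> S; apply: contraR; rewrite -leNgt => SP; apply/forallP => C.
have cntE Z : cnt [set d] U Z = (\sum_(e in pairs U) (e \in Z)
  * #|fibre d U e|)%N.
  rewrite /cnt (emb_fibres _ _ d2); apply: eq_bigr => e _.
  case: (boolP (e \in Z)) => eZ; rewrite ?mul1n ?mul0n.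
    congr #|pred_of_set _|; apply/setP => f; rewrite !inE -andbA;
      congr (_ && _).
    by rewrite /im imset_set1 sub1set; case: eqP => // ->.
  apply: eq_card0 => f; rewrite !inE /im imset_set1 sub1set.
  by case: eqP => [->|]; rewrite ?(negPf eZ) ?andbF.
have -> : (cnt [set d] U (S :&: C) + cnt [set d] U (S :\: C)
    = \sum_(e in pairs U) (e \in S) * #|fibre d U e|)%N.
  rewrite !cntE -big_split; apply: eq_bigr => e _ /=; rewrite !inE -mulnDl.
  by case: (e \in S); case: (e \in C).
have [fb fbE] : exists fb, forall e, e \in pairs U -> #|fibre d U e| = fb.
  have [P0|[e0 e0P]] := set_0Vmem (pairs U).
    by exists 0%N => e; rewrite P0 inE.
  exists #|fibre d U e0| => e eP; apply/eqP.
  by rewrite eqn_leq !card_fibre_le.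
have -> : (#|U| ^_ #|V| = #|pairs U| * fb)%N.
  rewrite -card_emb -sum_nat_const.
  have -> : #|emb V U| = #|[set f in emb V U | xpredT f]|.
    by apply: eq_card => f; rewrite in_set andbT.
  rewrite (emb_fibres U xpredT d2); apply: eq_bigr => e eP; rewrite -(fbE e eP).
  by apply: eq_card => f; rewrite in_set andbT.
have -> : (\sum_(e in pairs U) (e \in S) * #|fibre d U e| = #|S :&:
  pairs U| * fb)%N.
  rewrite -sum_nat_const [LHS]big_mkcond [RHS]big_mkcond; apply: eq_bigr => e _.
  rewrite in_setI; case: (boolP (e \in pairs U)) => [/fbE->|_].
    by case: (e \in S); rewrite /= ?mul1n ?mul0n.
  by rewrite andbF.
rewrite !natrM; apply: le_trans (ler_wpM2r (ler0n _ fb) SP).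
by rewrite le_eqVlt; apply/orP; left; apply/eqP; ring.
Qed.

End Counting.

(** * First round *)

(** A Paley-Zygmund bound: many indices reach half of the average. Cauchy-Schwarz is replaced by its
    linear form Y <= t/2 + Y^2/(2t). *)
Lemma second_moment (R : realFieldType) (I : finType) (P : {set I}) (Y : I -> R)
    (L Q N : R) :
  0 < L -> 0 < Q -> 0 < N -> #|P|%:R <= N ->
  L <= \sum_(e in P) Y e -> \sum_(e in P) Y e ^+ 2 <= Q ->
  L ^+ 2 / (4 * Q) <= #|[set e in P | L / (2 * N) <= Y e]|%:R.
Proof.
move=> L0 Q0 N0 PN sumY sumY2; set A := [set e in P | _].
(* With this t the quadratic terms add up to at most L/4 and the small indices to at most L/2, so
   the large ones account for L/4. *)
pose t := 2 * Q / L; have t0 : 0 < t by rewrite divr_gt0 ?mulr_gt0.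
have sqY e : e \in P -> Y e <= t / 2 + Y e ^+ 2 / (2 * t).
  move=> _; rewrite -subr_ge0.
  have -> : t / 2 + Y e ^+ 2 / (2 * t) - Y e = (t - Y e) ^+ 2 / (2 * t).
    by field; rewrite gt_eqF.
  by rewrite divr_ge0 ?sqr_ge0 // mulr_ge0 // ltW.
have : L <= \sum_(e in P) (L / (2 * N)) + \sum_(e in P) (Y e ^+ 2 / (2 * t))
     + \sum_(e in A) (t / 2).
  apply: le_trans sumY _.
  have -> : \sum_(e in A) (t / 2) = \sum_(e in P)
    (if e \in A then t / 2 else 0).
    rewrite [LHS]big_mkcond [RHS]big_mkcond; apply: eq_bigr => e _.
    by rewrite inE; case: (e \in P).
  rewrite -!big_split; apply: ler_sum => e eP /=.
  have l0 : 0 <= L / (2 * N) by rewrite divr_ge0 ?mulr_ge0 // ltW.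
  have y0 : 0 <= Y e ^+ 2 / (2 * t) by rewrite divr_ge0 ?sqr_ge0 // mulr_ge0 //
    ltW.
  case: ifP => [_|]; first by have := sqY e eP; lra.
  by rewrite inE eP /= => /negbT; rewrite -ltNge; lra.
rewrite !sumr_const -mulr_suml -(mulr_natl _ #|P|) -(mulr_natl _ #|A|).
have : #|P|%:R * (L / (2 * N)) <= L / 2.
  have -> : L / 2 = N * (L / (2 * N)) by field; rewrite gt_eqF.
  by rewrite ler_wpM2r // divr_ge0 ?mulr_ge0 // ltW.
have : (\sum_(e in P) Y e ^+ 2) / (2 * t) <= L / 4.
  have -> : L / 4 = Q / (2 * t) by rewrite /t; field; rewrite !gt_eqF.
  by rewrite ler_wpM2r // invr_ge0 mulr_ge0 // ltW.
move=> h1 h2 h3; have h4 : L / 4 <= #|A|%:R * (t / 2) by lra.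
have -> : L ^+ 2 / (4 * Q) = L / 4 / (t / 2) by rewrite /t; field;
  rewrite !gt_eqF.
have t20 : 0 < t / 2 by lra.
by rewrite ler_pdivrMr // mulr1.
Qed.

Section OneSubset.
Variables (R : realType) (V W : finType).
Implicit Types (U : {set W}) (S Z C D : {set {set W}}) (e : {set W}).
Variables (E : {set {set V}}) (d : {set V}).
Hypotheses (EE : graph_edges E) (dE : d \in E) (E2 : (1 < #|E|)%N).
Let E1 := E :\ d.

Let d2 : #|d| = 2%N. Proof. exact: EE. Qed.
Let k2 : (2 <= #|V|)%N. Proof. by rewrite -d2 max_card. Qed.
Let E1E : graph_edges E1. Proof. by move=> x /setD1P[_ /EE]. Qed.
Let cardE1 : #|E| = #|E1|.+1. Proof. by rewrite (cardsD1 d E) dE. Qed.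
Let E1_neq0 : E1 != set0. Proof. by rewrite -card_gt0; move: E2;
  rewrite cardE1. Qed.

(* The labelled copies of E1 in Z that the pair e completes to a copy of E. *)
Definition based U e Z : {set {ffun V -> W}} :=
  [set f in fibre d U e | im f E1 \subset Z].

Definition rich_pairs U (th : R) S C : {set {set W}} :=
  [set e in pairs U | th <= (#|based U e (S :&: C)|
    + #|based U e (S :\: C)|)%:R].

(** Ordered pairs of embeddings resting on the same vertex pair; counted inside Z they give the
    second moment of the [based] numbers. *)
Definition twins U : {set {ffun V -> W} * {ffun V -> W}} :=
  [set x | [&& x.1 \in emb V U, x.2 \in emb V U & x.1 @: d == x.2 @: d]].
Definition twin_edges (x : {ffun V -> W} * {ffun V -> W}) : {set {set W}} :=
  im x.1 E1 :|: im x.2 E1.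

Lemma basedS U U' e Z Z' : U \subset U' -> Z \subset Z' ->
  based U e Z \subset based U' e Z'.
Proof.
move=> UU' ZZ'; apply/subsetP => f /setIdP[/setIdP[/embP[fU fI] fd] fZ].
apply/setIdP; split; last exact: subset_trans ZZ'.
by apply/setIdP; split=> //; apply/embP; split=> // x; apply: (subsetP UU').
Qed.

Lemma im_neq0 (f : {ffun V -> W}) : im f E1 != set0.
Proof.
have /set0Pn[x xE] := E1_neq0.
by apply/set0Pn; exists (f @: x); apply: imset_f.
Qed.

(** A copy of [E1] has an edge, so it cannot lie in both colour classes. *)
Lemma based_split U e Z C :
  (#|based U e (Z :&: C)| + #|based U e (Z :\: C)| <= #|based U e Z|)%N.
Proof.
rewrite -cardsUI [X in (_ + X)%N]eq_card0 ?addn0; last first.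
  move=> f; rewrite inE; apply/negP => /andP[].
  move=> /setIdP[_ f1] /setIdP[_ f2]; have /set0Pn[x xf] := im_neq0 f.
  have := subsetP f1 x xf; have := subsetP f2 x xf.
  by rewrite !inE => /andP[/negP nC _] /andP[_ /nC].
by apply: subset_leq_card; rewrite subUset !basedS ?subsetIl ?subsetDl.
Qed.

Lemma sum_based_sq U Z :
  \sum_(e in pairs U) (#|based U e Z|%:R ^+ 2 : R)
    = \sum_(x in twins U) (twin_edges x \subset Z)%:R.
Proof.
rewrite (partition_big (fun x : {ffun V -> W} * {ffun V -> W} => x.1 @: d)
  (mem (pairs U))) /=; last first.
  by move=> x; rewrite inE => /andP[x1 _]; apply: emb_pair.
apply: eq_bigr => e eP; rewrite -natrX -mulnn -cardsX -sum1_card natr_sum.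
rewrite big_mkcond [RHS]big_mkcond; apply: eq_bigr => -[f g] _ /=.
rewrite !in_set /= /twin_edges subUset /=.
case: (_ && injectiveb f); case: (_ && injectiveb g);
  case: (im f E1 \subset Z); case: (im g E1 \subset Z);
  rewrite /= ?andbF ?if_same //= ?andbT; (case: eqVneq => [->|_] /=;
  rewrite ?andbF ?if_same //; by rewrite ?(eq_sym e) andbT).
Qed.

(** Adding the common pair to a pair of twins gives two copies of E that share an edge, at the price
    of one factor p; so the bound is that of [overlap] divided by p. *)
Lemma sum_twins U (p : R) : 0 < p <= 1 -> spread E #|U| p ->
  \sum_(x in twins U) allp (pv p) (twin_edges x)
   <= 2 ^+ (2 * #|V| ^ 2) * #|U|%:R ^+ (2 * #|V| - 2) * p ^+ (2 * #|E1|).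
Proof.
move=> p01 sp; have /andP[p0 p1] := p01.
rewrite -(ler_pM2r p0) -[leRHS]mulrA -exprSr.
have -> : (2 * #|E1|).+1 = (2 * #|E| - 1)%N by rewrite cardE1; lia.
apply: le_trans (overlap k2 EE p01 sp).
rewrite pair_big_dep /= mulr_suml.
rewrite [leLHS]big_mkcond [leRHS]big_mkcond; apply: ler_sum => -[f g] _ /=.
rewrite inE /=; case: ifP => [/and3P[fU gU /eqP fg]|_]; last first.
  by case: ifP => // _; rewrite exprn_ge0 // ltW.
have /embP[_ fI] := fU; have /embP[_ gI] := gU.
have fd : f @: d \in im f E by rewrite mem_im.
have gd : f @: d \in im g E by rewrite fg mem_im.
have -> : ~~ [disjoint im f E & im g E].
  by apply/pred0Pn; exists (f @: d); rewrite /= fd gd.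
rewrite fU gU /= allp_pv; last first.
  by move=> x; rewrite inE => /orP[]; apply: im_edges.
have fgE : im f E :|: im g E = (f @: d) |: (im f E1 :|: im g E1).
  rewrite -(setD1K dE) /im !imsetU1 -fg -/E1.
  by apply/setP => x; rewrite !inE; case: eqP.
have notin : f @: d \notin im f E1 :|: im g E1.
  by rewrite inE {2}fg !mem_im // !inE eqxx.
by rewrite fgE cardsU1 notin -exprSr.
Qed.

Definition typical U (th K : R) S : bool :=
  [forall C : {set {set W}}, K <= #|rich_pairs U th S C|%:R].

(** The deletion of D only helps to find rich pairs: the copies counted outside D are still present
    in S, so the conclusion concerns S itself. *)
Lemma typical_of_deletion U (L Mu : R) S D : 0 < L -> 0 < Mu -> (2 <= #|U|)%N ->
  arrow E1 U L (S :\: D) ->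
  \sum_(x in twins U) (twin_edges x \subset S :\: D)%:R < 2 * Mu ->
  typical U (L / (2 * 'C(#|U|, 2)%:R)) (L ^+ 2 / (8 * Mu)) S.
Proof.
move=> L0 Mu0 U2 aS MS; apply/forallP => C; set Z := S :\: D in aS MS.
pose Y e : R := (#|based U e (Z :&: C)| + #|based U e (Z :\: C)|)%:R.
have N0 : (0 : R) < 'C(#|U|, 2)%:R by rewrite ltr0n bin_gt0.
have := @second_moment _ _ (pairs U) Y L (2 * Mu) _ L0 _ N0.
rewrite card_pairs lexx mulr_gt0 // => /(_ isT isT) sm.
rewrite (_ : 8 * Mu = 4 * (2 * Mu)); last by ring.
apply: le_trans (sm _ _) _.
- have /forallP/(_ C) := aS; rewrite /cnt !(emb_fibres _ _ d2) -big_split /=.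
  by rewrite natr_sum.
- apply: le_trans (ltW MS); rewrite -sum_based_sq; apply: ler_sum => e _.
  by rewrite lerXn2r ?nnegrE // ler_nat based_split.
rewrite ler_nat; apply: subset_leq_card; apply/subsetP => e.
rewrite !in_set => /andP[-> /le_trans]; apply; rewrite ler_nat.
by apply: leq_add; apply: subset_leq_card; apply: basedS;
  rewrite ?setSI ?setSD // subsetDl.
Qed.

(** One set D must serve both purposes. Controlling the second moment deletes at most z times 2|E1|
    edges, and arrowing tolerates the loss of y/2 edges; the last hypothesis makes the two
    compatible. *)
Lemma typical_prob U (p L y : R) (z : nat) :
  let Mu := 2 ^+ (2 * #|V| ^ 2) * #|U|%:R ^+ (2 * #|V| - 2)
    * p ^+ (2 * #|E1|) in
  0 < p <= 1 -> spread E #|U| p -> 0 < L -> (2 <= #|U|)%N ->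
  Pr (pv (p / 2)) (fun S => ~~ arrow E1 U L S) <= expR (- y) ->
  (z * (2 * #|E1|))%:R <= y / 2 ->
  Pr (pv p) (fun S => ~~ typical U (L / (2 * 'C(#|U|, 2)%:R))
    (L ^+ 2 / (8 * Mu)) S)
    <= expR (- (y / 2)) + (1 / 2) ^+ z.
Proof.
move=> Mu p01 sp L0 U2 aP zy; have /andP[p0 p1] := p01.
have pP : unit_vec (@pv R W p) by apply: pv01; rewrite ltW.
have Mu0 : 0 < Mu by rewrite !mulr_gt0 ?exprn_gt0 // ltr0n; lia.
pose bad1 S := [exists D : {set {set W}}, (#|D|%:R <= y / 2) &&
  ~~ arrow E1 U L (S :\: D)].
pose bad2 S := [forall D : {set {set W}}, (#|D| <= z * (2 * #|E1|))%N ==>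
     (2 * Mu <= \sum_(x in twins U) (twin_edges x \subset S :\: D)%:R)].
apply: (@le_trans _ _ (Pr (pv p) bad1 + Pr (pv p) bad2)).
  rewrite -ExD; apply: le_Ex => // S; rewrite -natrD ler_nat.
  case: (boolP (typical _ _ _ _)) => // nt; rewrite addn_gt0 !lt0b.
  apply: contraR nt; rewrite negb_or => /andP[/existsPn nb1 /forallPn[D]].
  rewrite negb_imply -ltNge => /andP[Dz MD].
  apply: (typical_of_deletion L0 Mu0 U2 (D := D)) => //.
  have := nb1 D; rewrite negb_and negbK => /orP[/negP[]|//].
  by apply: le_trans zy; rewrite ler_nat.
apply: lerD; last first.
  apply: upper_tail_deletion => //; last exact: sum_twins.
  move=> x; rewrite inE => /and3P[/embP[_ x1] /embP[_ x2] _].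
  apply: leq_trans (leq_card_setU _ _).1 _.
  by rewrite !card_im // mul2n addnn.
apply: le_trans (robust pP _ _) _; first by move=> S T; apply: arrowS.
have -> : expR (- (y / 2)) = expR (y / 2) * expR (- y) :> R.
  by rewrite -expRD; congr expR; field.
rewrite ler_wpM2l ?expR_ge0 //; apply: le_trans aP; rewrite le_eqVlt; apply/orP;
  left.
apply/eqP; apply: eq_Ex_vec => e; rewrite /pv; case: ifP => _;
  last by rewrite mul0r.
by rewrite div1r.
Qed.

End OneSubset.

(** * Two rounds *)

Section TwoRounds.
Variables (R : realType) (V W : finType).
Implicit Types (U : {set W}) (S Z C D : {set {set W}}) (e : {set W}).
Implicit Types (Phi : {set {ffun V -> W}}).
Variables (E : {set {set V}}) (d : {set V}).
Hypotheses (EE : graph_edges E) (dE : d \in E) (E2 : (1 < #|E|)%N).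
Let E1 := E :\ d.
Let d2 : #|d| = 2%N. Proof. exact: EE. Qed.
Let k2 : (2 <= #|V|)%N. Proof. by rewrite -d2 max_card. Qed.

(** Restricting to [Phi] lowers the mean by a constant factor only, while the correlation sum is
    still bounded by that of all embeddings; so the exponent keeps the order q |U|^2. *)
Lemma janson_embeddings U Phi (q c : R) :
  Phi \subset emb V U -> 0 < q <= 1 -> spread E #|U| q ->
  0 < c -> (0 < #|U|)%N -> c * #|U|%:R ^+ #|V| <= #|Phi|%:R ->
  Pr (pv q) (fun S => ~~ (c * #|U|%:R ^+ #|V| * q ^+ #|E| / 2
       <= #|[set f in Phi | im f E \subset S]|%:R))
    <= expR (- (c ^+ 2 / (16 * 2 ^+ (2 * #|V| ^ 2)) * #|U|%:R ^+ 2 * q)).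
Proof.
move=> PhiU q01 sp c0 U0 cPhi; have /andP[q0 q1] := q01.
have qP : unit_vec (@pv R W q) by apply: pv01; rewrite ltW.
have u0 : (0 : R) < #|U|%:R by rewrite ltr0n.
have E0 : E != set0 by rewrite -card_gt0 ltnW.
have imE0 (f : {ffun V -> W}) : im f E != set0.
  by have /set0Pn[x xE] := E0; apply/set0Pn; exists (f @: x); apply: imset_f.
pose A (f : {ffun V -> W}) := im f E.
have edgesA f : f \in emb V U -> graph_edges (A f).
  by case/embP => _ fI; apply: im_edges.
have meanE : \sum_(f <- enum Phi) allp (pv q) (A f) = #|Phi|%:R * q ^+ #|E|.
  rewrite big_enum mulr_natl -sumr_const;
    apply: eq_bigr => f /(subsetP PhiU) fU.
  have /embP[_ fI] := fU; rewrite allp_pv; last exact: edgesA.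
  by rewrite /A card_im.
pose Dl : R := 2 ^+ (2 * #|V| ^ 2) * #|U|%:R ^+ (2 * #|V| - 2)
  * q ^+ (2 * #|E| - 1).
have Dl0 : 0 < Dl by rewrite !mulr_gt0 ?exprn_gt0.
have clP : cluster A (pv q) (enum Phi) <= Dl.
  apply: le_trans (overlap k2 EE q01 sp); rewrite /cluster big_enum /=.
  under eq_bigr do rewrite big_enum_cond /=.
  rewrite [leLHS]big_mkcond [leRHS]big_mkcond; apply: ler_sum => f _.
  have [fP|_] := boolP (f \in Phi); last first.
    by case: ifP => // _; apply: sumr_ge0 => g _; rewrite exprn_ge0 // ltW.
  have fU := subsetP PhiU f fP; rewrite fU.
  rewrite [leLHS]big_mkcond [leRHS]big_mkcond; apply: ler_sum => g _ /=.
  have [gP|_] := boolP (g \in Phi); last first.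
    by case: ifP => // _; rewrite exprn_ge0 // ltW.
  have gU := subsetP PhiU g gP; rewrite gU /=; case: ifP => // _.
  by rewrite allp_pv // => x; rewrite inE => /orP[]; apply: edgesA.
set mu := c * #|U|%:R ^+ #|V| * q ^+ #|E|.
have mu0 : 0 < mu by rewrite !mulr_gt0 ?exprn_gt0.
have muP : mu <= #|Phi|%:R * q ^+ #|E| by rewrite ler_wpM2r // exprn_ge0 // ltW.
have := @janson _ _ _ A (pv q) qP imE0 (enum Phi) Dl.
rewrite meanE => /(_ (lt_le_trans mu0 muP) clP) jan.
apply: le_trans (_ : _ <= expR (- ((#|Phi|%:R * q ^+ #|E|) ^+ 2 / (16 * Dl))))
  _.
  apply: le_trans jan; apply: le_Pr => // S; rewrite -ltNge => SP.
  have -> : \sum_(f <- enum Phi) (A f \subset S)%:R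
      = #|[set f in Phi | im f E \subset S]|%:R :> R.
    rewrite big_enum -sum1_card natr_sum [LHS]big_mkcond [RHS]big_mkcond /=.
    apply: eq_bigr => f _; rewrite inE; case: (f \in Phi) => //=.
    by rewrite /A; case: (_ \subset _).
  by apply: lt_le_trans SP _; rewrite ler_wpM2r ?invr_ge0.
rewrite ler_expR lerN2.
have -> : c ^+ 2 / (16 * 2 ^+ (2 * #|V| ^ 2)) * #|U|%:R ^+ 2 * q
  = mu ^+ 2 / (16 * Dl).
  have -> : mu ^+ 2 = c ^+ 2 * #|U|%:R ^+ 2 * q
      * (#|U|%:R ^+ (2 * #|V| - 2) * q ^+ (2 * #|E| - 1)).
    rewrite /mu !exprMn -!exprM [RHS]mulrACA -exprS.
    rewrite -[c ^+ 2 * #|U|%:R ^+ 2 * _]mulrA -exprD.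
    have -> : (2 + (2 * #|V| - 2) = #|V| * 2)%N.
      by rewrite mulnC subnKC // leq_pmull // ltnW.
    have -> : (2 * #|E| - 1).+1 = (#|E| * 2)%N.
      by rewrite mulnC subn1 prednK // muln_gt0 ltnW.
    by [].
  have cancel (x y z t X Y : R) : t != 0 -> X != 0 -> Y != 0 ->
      x / (16 * t) * y * z = x * y * z * (X * Y) / (16 * (t * X * Y)).
    by move=> t0 X0 Y0; field; rewrite t0 X0 Y0.
  by apply: cancel; rewrite expf_neq0 // gt_eqF.
have D16 : 0 <= (16 * Dl)^-1 by rewrite invr_ge0 mulr_ge0 // ltW.
have mu2 := le_trans (ltW mu0) muP.
by apply: ler_wpM2r => //; rewrite lerXn2r // nnegrE // ltW.
Qed.

Variables (U : {set W}) (tau eta r h lam : R).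
Hypotheses (tau0 : 0 <= tau) (eta01 : 0 < eta <= 1).
Let n := #|U|.
Let k := #|V|.

Definition rich Z : {set {set W}} :=
  [set e in pairs U | tau <= #|based E d U e Z|%:R].

Definition rich_cliques Z : {set {ffun V -> W}} :=
  [set f in emb V U | [forall x, forall y, (x != y) ==>
    ([set f x; f y] \in rich Z)]].

(* Z is a colour class of the first round, S the outcome of the second one. *)
Definition fragile Z S : bool :=
  (eta ^+ (2 * k ^ 2) * n%:R ^+ k <= #|rich_cliques Z|%:R) &&
  [exists D : {set {set W}}, (#|D|%:R <= h) &&
     ~~ (lam <= #|[set f in rich_cliques Z | im f E \subset S :\: D]|%:R)].

(** The deterministic core. The threshold 2 tau bounds the copies of both colours together, so each
    such pair reaches tau in one of them. *)
Lemma arrow_of_rounds S1 S2 :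
  (forall U', U' \subset U -> r <= #|U'|%:R ->
     typical E d U' (2 * tau) (4 * eta * #|U'|%:R ^+ 2) S1) ->
  r <= eta ^+ (2 * k) * n%:R ->
  (forall Z, Z \subset S1 :&: pairs U -> ~~ fragile Z S2) ->
  lam <= h * tau ->
  arrow E U lam (S1 :|: S2).
Proof.
move=> typ rn rob lamh; apply/forallP => C.
pose P := pairs U; pose col (b : bool) := if b then C else ~: C.
pose Zc b := S1 :&: P :&: col b.
have colE b e : (e \in col b) = ((e \in C) == b).
  by rewrite /col; case: b; rewrite ?inE; case: (e \in C).
have richE b : graph_edges (rich (Zc b)).
  by move=> e; rewrite !inE => /andP[/andP[_ /eqP]].
have [b hb] : exists b,
    eta ^+ (2 * k ^ 2) * n%:R ^+ k <= #|rich_cliques (Zc b)|%:R.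
  apply: (mono_cliques richE eta01 _ rn) => U' U'U rU'.
  have /forallP/(_ C) := typ U' U'U rU'; move/le_trans; apply.
  rewrite ler_nat; apply: subset_leq_card; apply/subsetP => e.
  move=> /setIdP[eP]; have eU' : e \subset U' by move: eP;
    rewrite inE => /andP[].
  have eU : e \in P by move: eP; rewrite !inE => /andP[/subset_trans-> //].
  (* Copies found inside U' also lie in U. Richness can thus be measured in the whole of U, which
     makes the graph of rich pairs independent of U'. *)
  have bsub b : based E d U' e (S1 :&: col b) \subset based E d U e (Zc b).
    apply/subsetP => f /setIdP[ff fS].
    have /setIdP[/embP[fU' fI] fd] := ff.
    have fU : f \in emb V U by apply/embP; split=> // x; apply: (subsetP U'U).
    apply/setIdP; split; first by apply/setIdP.
    rewrite /Zc setIAC subsetI fS /=; apply/subsetP => _ /imsetP[x xE ->].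
    by apply: emb_pair => //; apply: EE; case/setD1P: xE.
  have leb b := subset_leq_card (bsub b).
  move=> h2; apply/setIdP; split=> //; rewrite in_setU.
  have : 2 * tau <= #|based E d U e (Zc true)|%:R
    + #|based E d U e (Zc false)|%:R.
    apply: le_trans h2 _; rewrite -natrD ler_nat setDE.
    exact: leq_add (leb true) (leb false).
  have [t1 _|t1 t2] := lerP tau #|based E d U e (Zc true)|%:R.
    by apply/orP; left; apply/setIdP.
  by apply/orP; right; apply/setIdP; split=> //; lra.
have Zsub : Zc b \subset S1 :&: pairs U by apply: subsetIl.
have := rob _ Zsub; rewrite /fragile hb /= => /existsPn robb.
have total Z : Z \subset col b \/ Z \subset col (~~ b) -> Z \subset S1 :|: S2 ->
    (cnt E U Z <= cnt E U ((S1 :|: S2) :&: C) + cnt E U ((S1 :|: S2) :\: C))%N.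
  move=> Zc' ZS; have : Z \subset C \/ Z \subset ~: C.
    by case: b Zc' {hb Zsub robb} => /= -[]; auto.
  case=> ZC.
    by apply: leq_trans (leq_addr _ _); apply: cntS; rewrite subsetI ZS.
  by apply: leq_trans (leq_addl _ _); apply: cntS; rewrite setDE subsetI ZS.
(* The rich second-round edges that receive their own colour b. A copy on a rich clique that avoids
   D has the other colour throughout; each edge of D completes tau copies of colour b. *)
pose D := [set e in S2 | (e \in rich (Zc b)) && (e \in col b)].
have [Dh|hD] := lerP #|D|%:R h.
  have := robb D; rewrite Dh /= negbK => /le_trans; apply; rewrite ler_nat.
  apply: leq_trans (total (S2 :&: col (~~ b)) _ _); last 2 first.
  - by right; apply: subsetIr.
  - by apply: subset_trans (subsetIl _ _) (subsetUr _ _).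
  apply: subset_leq_card; apply/subsetP =>
    f /setIdP[/setIdP[fU /'forall_forallP fQ] fD].
  apply/setIdP; split=> //; apply/subsetP => e ef.
  have /setDP[eS2 eD] := subsetP fD e ef; rewrite inE eS2 /=.
  have : e \in rich (Zc b).
    have /imsetP[x xE ->] := ef; have /eqP/cards2P[u [v [uv ->]]] := EE xE.
    by rewrite imsetU1 imset_set1; have /implyP := fQ u v; apply.
  move: eD; rewrite inE eS2 /= => + er; rewrite er /= !colE.
  by case: (e \in C); case: (b).
apply: le_trans lamh _; apply: le_trans
  (_ : (cnt E U ((S1 :|: S2) :&: col b))%:R <= _); last first.
  by rewrite ler_nat; apply: total; [left; apply: subsetIr | apply: subsetIl].
rewrite /cnt (emb_fibres _ _ d2).
apply: le_trans (_ : (\sum_(e in D) #|based E d U e (Zc b)|)%:R <= _);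
  last first.
  rewrite ler_nat [leqLHS]big_mkcond [leqRHS]big_mkcond; apply: leq_sum => e _.
  have [/setIdP[eS2 /andP[er ec]]|//] := boolP (e \in D).
  have /setIdP[-> _] := er.
  apply: subset_leq_card; apply/subsetP => f /setIdP[ff fZ]; apply/setIdP;
    split=> //.
  have /setIdP[_ /eqP fd] := ff.
  rewrite -(setD1K dE) /im imsetU1 subUset sub1set fd !inE eS2 orbT ec /=.
  apply: subset_trans fZ _; rewrite /Zc setSI //.
  by apply: subset_trans (subsetIl _ _) (subsetUl _ _).
apply: le_trans (_ : #|D|%:R * tau <= _); first by rewrite ler_wpM2r // ltW.
rewrite mulr_natl -sumr_const natr_sum; apply: ler_sum => e.
by rewrite inE => /and3P[_ /setIdP[_ ->]].
Qed.

(** The expected number of candidate colour classes of the first round, that is, the size of the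
    union bound over Z. *)
Lemma Ex_pow2 U' (p : R) :
  Ex (pv p) (fun S => 2 ^+ #|S :&: pairs U'|) = (1 + p) ^+ 'C(#|U'|, 2).
Proof.
pose phi (e : {set W}) (b : bool) : R := if (e \in pairs U') && b then 2 else 1.
have -> : Ex (pv p) (fun S => 2 ^+ #|S :&: pairs U'|)
    = Ex (pv p) (fun S => \prod_e phi e (e \in S)).
  apply: eq_Ex => S; rewrite -prodr_const big_mkcond; apply: eq_bigr => e _.
  by rewrite in_setI andbC.
rewrite Ex_prod -card_pairs -prodr_const [RHS]big_mkcond; apply: eq_bigr => e _.
rewrite /phi; case: (boolP (e \in pairs U')) => /= [|_]; last by ring.
by rewrite inE /pv => /andP[_ ->]; ring.
Qed.

(** The second round is independent of the first, so [eps2] applies to each fixed Z inside S1. The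
    union bound over Z is taken first and averaged over S1 afterwards; the one over vertex sets
    costs 2^n. *)
Lemma two_rounds (p1 p2 eps1 eps2 : R) :
  0 <= p1 <= 1 -> 0 <= p2 <= 1 -> 0 <= eps1 -> 0 <= eps2 ->
  r <= eta ^+ (2 * k) * n%:R -> lam <= h * tau ->
  (forall U', U' \subset U -> r <= #|U'|%:R ->
    Pr (pv p1) (fun S => ~~ typical E d U' (2 * tau) (4 * eta * #|U'|%:R ^+ 2)
      S)
      <= eps1) ->
  (forall Z, Pr (pv p2) (fragile Z) <= eps2) ->
  Pr (pv (p1 + p2 - p1 * p2)) (fun S => ~~ arrow E U lam S)
    <= 2 ^+ n * eps1 + (1 + p1) ^+ 'C(n, 2) * eps2.
Proof.
move=> p1P p2P e10 e20 rn lamh typ frag.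
have p1v : unit_vec (@pv R W p1) by apply: pv01.
have p2v : unit_vec (@pv R W p2) by apply: pv01.
rewrite /Pr (eq_Ex_vec (q := fun e => pv p1 e + pv p2 e - pv p1 e * pv p2 e));
  last first.
  by move=> e; rewrite /pv; case: ifP => // _; ring.
rewrite Ex_setU.
pose T U' S1 : R := (~~ typical E d U' (2 * tau) (4 * eta * #|U'|%:R ^+ 2)
  S1)%:R.
apply: le_trans (_ : Ex (pv p1) (fun S1 =>
   \sum_(U' in powerset U | r <= #|U'|%:R) T U' S1
     + eps2 * 2 ^+ #|S1 :&: pairs U|) <= _).
  apply: le_Ex => // S1.
  apply: le_trans (_ : Ex (pv p2) (fun S2 =>
   \sum_(U' in powerset U | r <= #|U'|%:R) T U' S1
    + \sum_(Z in powerset (S1 :&: pairs U)) (fragile Z S2)%:R) <= _).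
    apply: le_Ex => // S2; rewrite /T -!natr_sum -natrD ler_nat.
    case: (boolP (arrow _ _ _ _)) => //; apply: contraR;
      rewrite -leqNgt leqn0 addn_eq0.
    rewrite !sum_nat_eq0 => /andP[/forallP t0 /forallP f0].
    apply: arrow_of_rounds => // [U' U'U rU'|Z ZS].
      by have := t0 U'; rewrite powersetE U'U rU' /= eqb0 negbK.
    by have := f0 Z; rewrite powersetE ZS /= eqb0.
  rewrite ExD Ex_cst lerD2l Ex_sum.
  apply: le_trans (ler_sum _ (fun Z _ => frag Z)) _.
  by rewrite sumr_const card_powerset -[leLHS]mulr_natr natrX.
rewrite ExD ExZ Ex_pow2 Ex_sum [eps2 * _]mulrC lerD2r.
apply: le_trans (_ : \sum_(U' in powerset U) eps1 <= _); last first.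
  by rewrite sumr_const card_powerset -[leLHS]mulr_natl natrX.
rewrite big_mkcondr; apply: ler_sum => U'; rewrite powersetE => U'U.
by case: ifP => // rU'; apply: typ.
Qed.

End TwoRounds.

(** * Failure probabilities *)

Lemma expX_le_ffact (m k : nat) : (2 * k <= m)%N -> (m ^ k <= 2 ^ k * m ^_ k)%N.
Proof.
elim: k => [|k IH] km //; rewrite ffactnSr !expnSr mulnACA leq_mul //.
  by apply: IH; lia.
lia.
Qed.

Lemma bin2_bounds (R : realFieldType) (m : nat) : (2 <= m)%N ->
  m%:R ^+ 2 / 4 <= ('C(m, 2)%:R : R) <= m%:R ^+ 2 / 2.
Proof.
move=> m2; have := bin_ffact m 2; rewrite ffactnS ffactn1 (_ : 2`! = 2)%N //.
move=> /(congr1 (fun t : nat => t%:R : R));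
  rewrite !natrM -subn1 natrB 1?ltnW //.
have : (2 : R) <= m%:R by rewrite ler_nat.
nra.
Qed.

Lemma half_le_expR (R : realType) : 1 / 2 <= expR (- (1 / 2)) :> R.
Proof. by apply: le_trans (expR_ge1Dx _); lra. Qed.

Lemma half_gt0_le1 (R : realFieldType) (p : R) : 0 < p <= 1 -> 0 < p / 2 <= 1.
Proof. lra. Qed.

Section Spread.
Variables (R : realType) (V : finType).
Implicit Types (E J : {set {set V}}).

Lemma card_cover_le E J : graph_edges E -> J \subset E ->
  (#|cover J| <= 2 * #|J|)%N.
Proof.
move=> EE JE; apply: leq_trans (leq_card_cover J) _.
rewrite mulnC -sum_nat_const; apply: leq_sum => e eJ.
by rewrite (EE e) // (subsetP JE).
Qed.

Lemma spreadS E E' m (q : R) : E' \subset E -> spread E m q -> spread E' m q.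
Proof. by move=> E'E sp J JE; apply: sp; apply: subset_trans E'E. Qed.

(** As J covers at most 2|J| vertices, |cover J| - 2 <= 2 (|J| - 1). Shrinking the vertex set by rho
    therefore costs at most rho^2 for each factor q. *)
Lemma spread_scale E (m n : nat) (q q' rho : R) : graph_edges E ->
  0 <= q -> 0 <= q' -> 0 <= rho <= 1 ->
  rho * n%:R <= m%:R -> q <= q' * rho ^+ 2 -> spread E n q -> spread E m q'.
Proof.
move=> EE q0 q'0 /andP[r0 r1] rn qq sp J JE J0; apply: le_trans (sp J JE J0) _.
set j := (#|J| - 1)%N; set v := (#|cover J| - 2)%N.
have vj : (v <= 2 * j)%N.
  have := card_cover_le EE JE; have : (0 < #|J|)%N by rewrite card_gt0.
  by rewrite /v /j; lia.
apply: le_trans (_ : q' ^+ j * (rho * n%:R) ^+ v <= _); last first.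
  by rewrite ler_wpM2l ?exprn_ge0 // lerXn2r ?nnegrE ?mulr_ge0.
rewrite exprMn mulrA ler_wpM2r ?exprn_ge0 //.
apply: le_trans (_ : (q' * rho ^+ 2) ^+ j <= _).
  by rewrite lerXn2r ?nnegrE ?mulr_ge0 ?exprn_ge0.
by rewrite exprMn ler_wpM2l ?exprn_ge0 // -exprM ler_wiXn2l.
Qed.

End Spread.

Section Step.
Variables (R : realType) (V W : finType).
Implicit Types (U : {set W}) (S Z C D : {set {set W}}) (e : {set W}).
Variables (E : {set {set V}}) (d : {set V}).
Hypotheses (EE : graph_edges E) (dE : d \in E) (E2 : (1 < #|E|)%N).
Let E1 := E :\ d.
Let k := #|V|.
Let i := #|E1|.

Lemma typicalS U (th th' K K' : R) S : th' <= th -> K' <= K ->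
  typical E d U th K S -> typical E d U th' K' S.
Proof.
move=> th'P K'P /forallP typ; apply/forallP => C; apply: le_trans K'P _.
apply: le_trans (typ C) _; rewrite ler_nat; apply: subset_leq_card.
by apply/subsetP => e /setIdP[eP /(le_trans th'P) eth]; apply/setIdP.
Qed.

Lemma atypical_le U (p x B th K : R) : (2 * k <= #|U|)%N ->
  0 < p <= 1 -> spread E #|U| p -> 0 < x -> 0 < B ->
  let L := x * (#|U| ^_ k)%:R * (p / 2) ^+ i in
  let Mu := 2 ^+ (2 * k ^ 2) * #|U|%:R ^+ (2 * k - 2) * p ^+ (2 * i) in
  th <= L / (2 * 'C(#|U|, 2)%:R) -> K <= L ^+ 2 / (8 * Mu) ->
  Pr (pv (p / 2)) (fun S => ~~ arrow E1 U L S)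
    <= expR (- (B * (p / 2) * 'C(#|U|, 2)%:R)) ->
  Pr (pv p) (fun S => ~~ typical E d U th K S)
    <= 3 * expR (- (B * (p / 2) * 'C(#|U|, 2)%:R / (8 * i%:R))).
Proof.
move=> Uk p01 sp x0 B0 L Mu thL KL aP; have /andP[p0 p1] := p01.
set y := B * _ * _ in aP *.
have k2 : (2 <= k)%N by rewrite -(EE dE) max_card.
have k22 : (2 <= 2 * k)%N by lia.
have i0 : (0 < i)%N.
  by move: E2; rewrite (cardsD1 d E) dE add1n ltnS.
have ir0 : (0 : R) < i%:R by rewrite ltr0n.
have y0 : 0 <= y by rewrite !mulr_ge0 ?invr_ge0 // ltW.
have L0 : 0 < L.
  by rewrite !mulr_gt0 ?exprn_gt0 ?divr_gt0 // ltr0n ffact_gt0; lia.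
have yi0 : 0 <= y / (4 * i%:R) by rewrite divr_ge0 // mulr_ge0.
(* The largest integer z with 2 i z <= y/2, the deletion budget of [typical_prob]. *)
have /andP[zle zlt] := truncn_itv yi0; set z := Num.truncn _ in zle zlt.
clearbody z y.
have pP : unit_vec (@pv R W p) by apply: pv01; rewrite ltW.
apply: le_trans (_ : Pr (pv p) (fun S => ~~ typical E d U
   (L / (2 * 'C(#|U|, 2)%:R)) (L ^+ 2 / (8 * Mu)) S) <= _).
  by apply: le_Pr => // S; apply: contra; apply: typicalS.
apply: le_trans (typical_prob EE dE E2 p01 sp L0 _ aP (z := z) _) _.
- exact: leq_trans k22 Uk.
- rewrite natrM natrM -/E1 -/i; move: zle; rewrite ler_pdivlMr ?mulr_gt0 //;
  lra.
have -> : 3 * expR (- (y / (8 * i%:R)))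
    = expR (- (y / (8 * i%:R))) + 2 * expR (- (y / (8 * i%:R))) by ring.
have y8 : y / (8 * i%:R) = y / (4 * i%:R) / 2 by field; rewrite gt_eqF.
apply: lerD.
  rewrite ler_expR lerN2 ler_wpM2l // lef_pV2 ?posrE ?mulr_gt0 //.
  have : (1 : R) <= i%:R by rewrite ler1n.
  lra.
apply: le_trans (_ : expR (- (1 / 2)) ^+ z <= _).
  by rewrite lerXn2r ?nnegrE ?expR_ge0 ?divr_ge0 ?half_le_expR.
rewrite -expRM_natl y8.
(* Rounding z down costs a factor exp(1/2) <= 2; with the other term this makes the constant 3. *)
apply: le_trans (_ : expR (1 / 2) * expR (- (y / (4 * i%:R) / 2)) <= _).
  rewrite -expRD ler_expR; move: zlt; rewrite -natr1; lra.
rewrite ler_wpM2r ?expR_ge0 //; have := half_le_expR R.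
rewrite expRN div1r lef_pV2 ?posrE ?expR_gt0 //.
Qed.

(** Either Z has too few rich cliques and is never fragile, or Janson's inequality applies at p/2,
    the halving and the factor exp(h) being the price of robustness. *)
Lemma fragile_le U (p eta tau h lam : R) Z : 0 < p <= 1 -> 0 < eta ->
  (0 < #|U|)%N -> spread E #|U| (p / 2) ->
  let c := eta ^+ (2 * k ^ 2) in
  lam <= c * #|U|%:R ^+ k * (p / 2) ^+ #|E| / 2 ->
  Pr (pv p) (fragile E d U tau eta h lam Z)
    <= expR (h - c ^+ 2 / (16 * 2 ^+ (2 * k ^ 2)) * #|U|%:R ^+ 2 * (p / 2)).
Proof.
move=> p01 eta0 U0 sp c lamP; have /andP[p0 p1] := p01.
have pP : unit_vec (@pv R W p) by apply: pv01; rewrite ltW.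
have [big|small] := lerP (c * #|U|%:R ^+ k) #|rich_cliques E d U tau Z|%:R;
  last first.
  apply: le_trans (expR_ge0 _); rewrite /Pr.
  rewrite (eq_Ex _ (Y := fun=> 0)) ?Ex_cst // => S.
  by rewrite /fragile -/c leNgt small.
pose Q S := lam <= #|[set f in rich_cliques E d U tau Z | im f E \subset S]|%:R.
apply: le_trans (_ : expR h * Pr (fun e => pv p e * (1 / 2)) (fun S => ~~ Q S)
  <= _).
  apply: le_trans (robust pP _ _); last first.
    move=> S T ST; rewrite /Q => /le_trans; apply; rewrite ler_nat.
    apply: subset_leq_card; apply/subsetP => f /setIdP[fP fS]; apply/setIdP;
      split=> //.
    exact: subset_trans ST.
  by apply: le_Pr => // S /andP[_].
rewrite expRD ler_wpM2l ?expR_ge0 //.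
have q01 := half_gt0_le1 p01.
have sub : rich_cliques E d U tau Z \subset emb V U.
  by apply/subsetP => f /setIdP[].
have := janson_embeddings EE dE E2 sub q01 sp (exprn_gt0 _ eta0) U0 big.
apply: le_trans.
have -> : Pr (fun e => pv p e * (1 / 2)) (fun S => ~~ Q S)
  = Pr (pv (p / 2)) (fun S => ~~ Q S).
  by apply: eq_Ex_vec => e; rewrite /pv; case: ifP => _;
    rewrite ?mul0r // div1r.
apply: le_Pr; first by apply: pv01; case/andP: q01 => /ltW -> ->.
by move=> S; apply: contra; apply: le_trans.
Qed.

End Step.

(** In the second-moment bound all powers of p1 cancel and m^2 remains: a positive proportion of the
    pairs. The hypothesis on eta absorbs the constants. *)
Lemma rich_count_le (R : realFieldType) (x m F p1 eta : R) (k i : nat) :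
  0 < x -> 0 < m -> 0 < p1 -> 0 < F -> 0 < eta -> (2 <= k)%N ->
  m ^+ k <= 2 ^+ k * F ->
  32 * 2 ^+ (2 * k ^ 2) * (2 ^+ k * 2 ^+ i) ^+ 2 * eta <= x ^+ 2 ->
  4 * eta * m ^+ 2 <= (x * F * (p1 / 2) ^+ i) ^+ 2
     / (8 * (2 ^+ (2 * k ^ 2) * m ^+ (2 * k - 2) * p1 ^+ (2 * i))).
Proof.
move=> x0 m0 p0 F0 eta0 k2 mF etax.
have -> : p1 ^+ (2 * i) = (p1 ^+ i) ^+ 2 by rewrite -exprM mulnC.
have mE : m ^+ 2 * m ^+ (2 * k - 2) = (m ^+ k) ^+ 2.
  by rewrite -exprD -exprM; congr (_ ^+ _); lia.
have m20 : 0 < m ^+ (2 * k - 2) by rewrite exprn_gt0.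
have M0 : 0 < m ^+ k by rewrite exprn_gt0.
have P0 : 0 < p1 ^+ i by rewrite exprn_gt0.
have ti0 : (0 : R) < 2 ^+ i by rewrite exprn_gt0.
have tk0 : (0 : R) < 2 ^+ k by rewrite exprn_gt0.
have t0 : (0 : R) < 2 ^+ (2 * k ^ 2) by rewrite exprn_gt0.
rewrite expr_div_n; move: etax mF mE m20 M0 P0 ti0 tk0 t0.
move: (m ^+ (2 * k - 2)) (m ^+ k) (p1 ^+ i) (2 ^+ i) (2 ^+ k)
  (2 ^+ (2 * k ^ 2)).
move=> mm M P ti tk t etax MF mE mm0 M0 P0 ti0 tk0 t0 {k2 p0}.
rewrite ler_pdivlMr ?mulr_gt0 ?exprn_gt0 //.
have -> : 4 * eta * m ^+ 2 * (8 * (t * mm * P ^+ 2))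
    = 32 * t * (ti ^+ 2) * eta * P ^+ 2 / ti ^+ 2 * (m ^+ 2 * mm).
  by field; rewrite gt_eqF.
rewrite mE.
have M2 : M ^+ 2 <= (tk * F) ^+ 2.
  by rewrite lerXn2r // nnegrE ?mulr_ge0 // ltW.
have -> : (x * F * (P / ti)) ^+ 2 = x ^+ 2 * (P ^+ 2 / ti ^+ 2 * F ^+ 2).
  by field; rewrite gt_eqF.
apply: le_trans (_ : 32 * t * (tk * ti) ^+ 2 * eta * (P ^+ 2 / ti ^+ 2 * F ^+ 2)
  <= _); last first.
  by rewrite ler_wpM2r // mulr_ge0 ?sqr_ge0 // divr_ge0 ?sqr_ge0.
have -> : 32 * t * (tk * ti) ^+ 2 * eta * (P ^+ 2 / ti ^+ 2 * F ^+ 2)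
    = 32 * t * (ti ^+ 2) * eta * P ^+ 2 / ti ^+ 2 * (tk * F) ^+ 2 by ring.
apply: ler_wpM2l M2.
by rewrite !mulr_ge0 ?invr_ge0 ?sqr_ge0 // ltW.
Qed.

Lemma threshold_le (R : realFieldType) (x m m0 F q C2 : R) (k i : nat) :
  0 < x -> 0 < m0 -> m0 <= m -> 0 <= q -> 0 < C2 -> C2 <= m ^+ 2 / 2 ->
  (2 <= k)%N -> m ^+ k <= 2 ^+ k * F ->
  2 * (x * m0 ^+ (k - 2) / 2 ^+ k.+1 * q ^+ i) <= x * F * q ^+ i / (2 * C2).
Proof.
move=> x0 m00 mm q0 C0 C2m k2 mF; have m_gt0 := lt_le_trans m00 mm.
have mE : m ^+ k = m ^+ 2 * m ^+ (k - 2) by rewrite -exprD subnKC.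
have le0 : m0 ^+ (k - 2) <= m ^+ (k - 2) by rewrite lerXn2r // nnegrE ltW.
have Q0 : 0 <= q ^+ i by rewrite exprn_ge0.
have t0 : (0 : R) < 2 ^+ k by rewrite exprn_gt0.
have M0 : 0 < m ^+ (k - 2) by rewrite exprn_gt0.
rewrite exprS ler_pdivlMr ?mulr_gt0 //; rewrite mE in mF.
move: mF le0 Q0 t0 M0; move: (q ^+ i) (m0 ^+ _) (m ^+ (k - 2)) (2 ^+ k).
move=> Q M' M t mF le0 Q0 t0 M0.
have -> : 2 * (x * M' / (2 * t) * Q) * (2 * C2) = x * Q * (M' / t * (2 * C2)).
  by field; rewrite gt_eqF.
rewrite (_ : x * F * Q = x * Q * F); last by ring.
rewrite ler_wpM2l ?mulr_ge0 ?(ltW x0) // mulrAC ler_pdivrMr //.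
rewrite [F * t]mulrC; apply: le_trans mF.
rewrite [leRHS]mulrC; apply: le_trans (_ : M * (2 * C2) <= _).
  by rewrite ler_wpM2r // mulr_ge0 // ltW.
by rewrite ler_wpM2l ?(ltW M0) //; lra.
Qed.

Lemma split_prob (R : realFieldType) (p alpha : R) :
  let p1 := alpha * p in let p2 := (p - p1) / (1 - p1) in
  0 < p <= 1 -> 0 < alpha <= 1 / 2 ->
  [/\ 0 < p1 <= 1, 0 < p2 <= 1, p / 2 <= p2 & p1 + p2 - p1 * p2 = p].
Proof.
move=> p1 p2 /andP[p0 ple1] /andP[a0 a1].
have p10 : 0 < p1 by rewrite mulr_gt0.
have p1p : p1 <= p / 2 by rewrite /p1; nra.
have p11 : 0 < 1 - p1 by lra.
have p2lo : p / 2 <= p2 by rewrite /p2 ler_pdivlMr //; nra.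
split=> //; first by rewrite p10; lra.
- apply/andP; split; first by apply: lt_le_trans p2lo; rewrite divr_gt0.
  by rewrite /p2 ler_pdivrMr //; lra.
- by rewrite /p2; field; rewrite gt_eqF.
Qed.

Lemma two_edges_le (T : finType) (E : {set {set T}}) i :
  graph_edges E -> #|E| = i.+1 -> (2 * i <= #|T| ^ 2)%N.
Proof.
move=> /card_edges_le + cE; rewrite cE bin2; move: #|T| => t it.
have := odd_double_half (t * t.-1); rewrite -muln2.
rewrite -mulnn; have : (t * t.-1 <= t * t)%N by rewrite leq_mul2l leq_pred orbT.
lia.
Qed.

Lemma exponent_le (R : realFieldType) (B alpha p rho n m C2 : R) (k i : nat) :
  0 < B -> 0 < alpha -> 0 < p -> 0 <= rho * n -> rho * n <= m ->
  m ^+ 2 / 4 <= C2 -> (0 < i)%N -> (0 < k)%N -> (2 * i <= k ^ 2)%N ->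
  B * alpha * rho ^+ 2 / (32 * k%:R ^+ 2) * p * n ^+ 2
    <= B * (alpha * p / 2) * C2 / (8 * i%:R).
Proof.
move=> B0 a0 p0 r0 rm C2m i0 k0; rewrite -(ler_nat R) natrM natrX => ik.
have C2r : (rho * n) ^+ 2 / 4 <= C2.
  have : (rho * n) ^+ 2 <= m ^+ 2 by rewrite lerXn2r // nnegrE // (le_trans r0).
  lra.
have ir : (0 : R) < i%:R by rewrite ltr0n.
have kr : (0 : R) < k%:R ^+ 2 by rewrite exprn_gt0 // ltr0n.
have Ba : 0 <= B * alpha * p by rewrite !mulr_ge0 // ltW.
have -> : B * alpha * rho ^+ 2 / (32 * k%:R ^+ 2) * p * n ^+ 2
    = B * alpha * p * ((rho * n) ^+ 2 / 4 * (k%:R ^+ 2 * 8)^-1).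
  by field; rewrite gt_eqF // ltr0n.
have -> : B * (alpha * p / 2) * C2 / (8 * i%:R)
  = B * alpha * p * (C2 * (16 * i%:R)^-1).
  by field; rewrite gt_eqF.
rewrite ler_wpM2l //; apply: ler_pM => //.
- by rewrite divr_ge0 ?sqr_ge0.
- by rewrite invr_ge0 mulr_ge0 // ltW.
rewrite lef_pV2 ?posrE; last 2 first; first by apply: mulr_gt0.
  by apply: mulr_gt0.
by move: (i%:R) (k%:R ^+ 2) ik => u v; lra.
Qed.

(** The deletion budget is at most half of Janson's exponent at p2/2, so at least the same amount is
    left; this explains the 7 in 2^(t+7). *)
Lemma fragile_exponent_le (R : realFieldType) (p p2 n c : R) (t : nat) :
  p / 2 <= p2 ->
  c ^+ 2 / 2 ^+ (t + 7) * p * n ^+ 2 - c ^+ 2 / (16 * 2 ^+ t) * n ^+ 2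
    * (p2 / 2)
    <= - (c ^+ 2 / 2 ^+ (t + 7) * p * n ^+ 2).
Proof.
move=> pp2; have t0 : (0 : R) < 2 ^+ t by rewrite exprn_gt0.
rewrite exprD; move: (2 ^+ t) t0 => T T0.
have -> : c ^+ 2 / (16 * T) * n ^+ 2 * (p2 / 2)
  = c ^+ 2 / T * n ^+ 2 * (p2 / 32).
  by field; rewrite gt_eqF.
have -> : c ^+ 2 / (T * 2 ^+ 7) * p * n ^+ 2 = c ^+ 2 / T * n ^+ 2 * (p / 128).
  by field; rewrite gt_eqF.
have : c ^+ 2 / T * n ^+ 2 * (p / 64) <= c ^+ 2 / T * n ^+ 2 * (p2 / 32).
  rewrite ler_wpM2l //; last lra.
  by rewrite mulr_ge0 ?divr_ge0 ?sqr_ge0 // ltW.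
lra.
Qed.

Section Step.
Variables (R : realType) (V W : finType).
Implicit Types (U : {set W}) (S Z C D : {set {set W}}) (e : {set W}).
Variables (E : {set {set V}}) (d : {set V}).
Hypotheses (EE : graph_edges E) (dE : d \in E) (E2 : (1 < #|E|)%N).
Let E1 := E :\ d.
Let k := #|V|.
Let i := #|E1|.

(** The two bounds on [lam] match the two outcomes of [arrow_of_rounds]: more than kap p n^2 edges
    completing tau copies each, or half of the mean number of copies on rich cliques at p2/2. *)
Lemma step_failure U (p x B eta rho alpha lam : R) :
  let n := #|U|%:R : R in
  let p1 := alpha * p in
  let p2 := (p - p1) / (1 - p1) in
  let c := eta ^+ (2 * k ^ 2) in
  let kap := c ^+ 2 / 2 ^+ (2 * k ^ 2 + 7) in
  let tau := x * (rho * n) ^+ (k - 2) / 2 ^+ k.+1 * (p1 / 2) ^+ i in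
  0 < p <= 1 -> 0 < x -> 0 < B -> 0 < eta <= 1 -> 0 < alpha <= 1 / 2 ->
  rho = eta ^+ (2 * k) -> (2 * k)%:R <= rho * n ->
  32 * 2 ^+ (2 * k ^ 2) * (2 ^+ k * 2 ^+ i) ^+ 2 * eta <= x ^+ 2 ->
  (forall m, rho * n <= m%:R -> spread E m p1) -> spread E #|U| (p2 / 2) ->
  (forall U', rho * n <= #|U'|%:R ->
     Pr (@pv R W (p1 / 2)) (fun S => ~~ arrow E1 U'
       (x * (#|U'| ^_ k)%:R * (p1 / 2) ^+ i) S)
       <= expR (- (B * (p1 / 2) * 'C(#|U'|, 2)%:R))) ->
  lam <= kap * p * n ^+ 2 * tau ->
  lam <= c * n ^+ k * (p2 / 2) ^+ #|E| / 2 ->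
  Pr (pv p) (fun S => ~~ arrow E U lam S)
    <= 2 ^+ #|U| * (3 * expR (- (B * alpha * rho ^+ 2 / (32 * k%:R ^+ 2) * p
      * n ^+ 2)))
       + expR (p1 * (n ^+ 2 / 2)) * expR (- (kap * p * n ^+ 2)).
Proof.
move=> n p1 p2 c kap tau p01 x0 B0 eta01 a01 rhoE kn etax sp1 sp2 IH lam1 lam2.
have /andP[p0 ple1] := p01; have /andP[e0 e1] := eta01;
  have /andP[a0 a1] := a01.
have k2 : (2 <= k)%N by rewrite -(EE dE) max_card.
have cardE : #|E| = i.+1 by rewrite (cardsD1 d E) dE.
have i0 : (0 < i)%N by move: E2; rewrite cardE.
have ik := two_edges_le EE cardE.
have [p101 p201 p2lo pE] := split_prob p01 a01;
  rewrite -/p1 -/p2 in p101 p201 p2lo pE.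
have /andP[p10 p1le] := p101; have /andP[p20 p2le] := p201.
have rho0 : 0 < rho by rewrite rhoE exprn_gt0.
have rho1 : rho <= 1 by rewrite rhoE exprn_ile1 // ltW.
have c0 : 0 < c by rewrite exprn_gt0.
have kap0 : 0 < kap by rewrite divr_gt0 ?exprn_gt0.
have n0 : 0 < n.
  have : (0 : R) < (2 * k)%:R by rewrite ltr0n muln_gt0 (ltnW k2).
  by move=> /lt_le_trans/(_ kn); rewrite pmulr_rgt0.
have U0 : (0 < #|U|)%N by rewrite -(ltr0n R).
have rn0 : 0 < rho * n by rewrite mulr_gt0.
have q0 : 0 < p1 / 2 by rewrite divr_gt0.
have tau0 : 0 <= tau.
  by rewrite !mulr_ge0 ?invr_ge0 ?exprn_ge0 ?(ltW x0) ?(ltW rn0) ?(ltW q0).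
set eps1 : R := 3 * expR _; set eps2 : R := expR (- (kap * p * n ^+ 2)).
have typ U' : U' \subset U -> rho * n <= #|U'|%:R ->
    Pr (pv p1) (fun S => ~~ typical E d U' (2 * tau) (4 * eta * #|U'|%:R ^+ 2)
      S)
      <= eps1.
  move=> _ rU'; have Uk : (2 * k <= #|U'|)%N
    by rewrite -(ler_nat R) (le_trans kn).
  have U2 : (2 <= #|U'|)%N by apply: leq_trans Uk; rewrite leq_pmulr // ltnW.
  have u0 : (0 : R) < #|U'|%:R by rewrite ltr0n ltnW.
  have kU : (k <= #|U'|)%N by apply: leq_trans Uk; rewrite leq_pmull.
  have F0 : (0 : R) < (#|U'| ^_ k)%:R by rewrite ltr0n ffact_gt0.
  have FX : (#|U'|%:R : R) ^+ k <= 2 ^+ k * (#|U'| ^_ k)%:R.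
    by rewrite -!natrX -natrM ler_nat expX_le_ffact.
  have /andP[C2lo C2hi] := bin2_bounds R U2.
  have C20 : (0 : R) < 'C(#|U'|, 2)%:R by rewrite ltr0n bin_gt0.
  apply: le_trans (atypical_le EE dE E2 Uk p101 (sp1 _ rU') x0 B0 _ _
    (IH _ rU')) _.
  - by apply: (threshold_le (m := #|U'|%:R)) => //; apply: ltW.
  - exact: rich_count_le.
  rewrite /eps1 ler_wpM2l // ler_expR lerN2.
  rewrite /p1 -/i; apply: (exponent_le (m := #|U'|%:R)) => //;
    [exact: ltW | exact: ltnW].
have frag Z : Pr (pv p2) (fragile E d U tau eta (kap * p * n ^+ 2) lam Z)
  <= eps2.
  apply: le_trans (fragile_le EE dE E2 _ _ Z p201 e0 U0 sp2 lam2) _.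
  rewrite ler_expR -/c -/n; exact: fragile_exponent_le.
have e1ge0 : 0 <= eps1 by rewrite mulr_ge0 ?expR_ge0.
have e2ge0 : 0 <= eps2 by apply: expR_ge0.
have p1P : 0 <= p1 <= 1 by rewrite p1le ltW.
have p2P : 0 <= p2 <= 1 by rewrite p2le ltW.
have rn : rho * n <= eta ^+ (2 * k) * n by rewrite rhoE.
have := two_rounds EE dE tau0 eta01 p1P p2P e1ge0 e2ge0 rn lam1 typ frag.
rewrite pE => /le_trans; apply; rewrite lerD2l ler_wpM2r //.
apply: le_trans (_ : expR p1 ^+ 'C(#|U|, 2) <= _).
  rewrite lerXn2r ?nnegrE ?expR_ge0 ?expR_ge1Dx //.
  by rewrite addr_ge0 // ltW.
rewrite -expRM_natl ler_expR mulrC ler_wpM2l ?(ltW p10) //.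
have U2 : (2 <= #|U|)%N.
  rewrite -(ler_nat R); apply: le_trans (_ : rho * n <= _).
    by apply: le_trans kn; rewrite ler_nat leq_pmulr // ltnW.
  by rewrite ler_piMl // ltW.
by have /andP[] := bin2_bounds R U2.
Qed.

End Step.

(** * Constants *)

Section Gauge.
Variables (R : realFieldType) (x : R).
Hypothesis x01 : 0 < x <= 1.

(* All constants of the induction are compared in this form, with x = a_i. *)
Definition gauge (a b : nat) : R := x ^+ a / 2 ^+ b.

Lemma gauge_gt0 a b : 0 < gauge a b.
Proof. by case/andP: x01 => x0 _; rewrite divr_gt0 ?exprn_gt0. Qed.

Lemma gaugeM a b a' b' : gauge a b * gauge a' b' = gauge (a + a') (b + b').
Proof. by rewrite /gauge !exprD invfM mulrACA. Qed.

Lemma gaugeX a b n : gauge a b ^+ n = gauge (a * n) (b * n).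
Proof. by rewrite /gauge expr_div_n -!exprM. Qed.

Lemma gauge_half a b n : gauge a b / 2 ^+ n = gauge a (b + n).
Proof. by rewrite /gauge exprD invfM mulrA. Qed.

Lemma gauge_le a b a' b' : (a' <= a)%N -> (b' <= b)%N -> gauge a b
  <= gauge a' b'.
Proof.
case/andP: x01 => x0 x1 aa bb; rewrite /gauge ler_pM ?invr_ge0 ?exprn_ge0
  ?(ltW x0) //.
  by rewrite ler_wiXn2l // ltW.
by rewrite lef_pV2 ?posrE ?exprn_gt0 // ler_weXn2l // ler1n.
Qed.

Lemma gauge_le1 a b : gauge a b <= 1.
Proof. by have := @gauge_le a b 0 0 isT isT; rewrite /gauge !expr0 divr1. Qed.

End Gauge.

(** Since 2^N <= exp(N) and 8 N <= theta Z, the union over vertex sets uses only part of the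
    exponent. Giving up half of it makes each summand at most half of the right-hand side. *)
Lemma expR_sum_le (R : realType) (N : nat) (theta Z y : R) :
  (0 < N)%N -> 8 * N%:R <= theta * Z -> y <= - (2 * (theta * Z)) ->
  2 ^+ N * (3 * expR (- (theta * Z))) + expR y <= expR (- (theta * Z / 2)).
Proof.
rewrite -(ler_nat R) => N1 tZ yZ; set T := theta * Z in tZ yZ *.
have e2 : 2 <= expR 1 :> R by have := expR_ge1Dx (1 : R).
have e1 : expR (- 1) <= 1 / 2 :> R.
  by rewrite expRN div1r lef_pV2 ?posrE ?expR_gt0.
have e3 : 3 <= expR 2 :> R by have := expR_ge1Dx (2 : R).
have eN : 2 ^+ N <= expR N%:R :> R.
  by rewrite -[N%:R]mulr1 expRM_natl lerXn2r ?nnegrE ?expR_ge0.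
have half : expR (- (T / 2)) = expR (- (T / 2)) / 2 + expR (- (T / 2)) / 2
  by field.
have h1 : expR (- (T / 2) - 1) <= expR (- (T / 2)) / 2.
  by rewrite expRD ler_wpM2l ?expR_ge0 // -div1r.
rewrite half; apply: lerD; apply: le_trans h1; last by rewrite ler_expR; lra.
apply: le_trans (_ : expR N%:R * (expR 2 * expR (- T)) <= _).
  by rewrite ler_pM ?mulr_ge0 ?exprn_ge0 ?expR_ge0 // ler_wpM2r ?expR_ge0.
by rewrite -!expRD ler_expR; lra.
Qed.

(** Two adjacent edges cover at most three vertices, so [spread] gives q n >= 1. For q = p/C' this
    reads p n >= C', which lets p n^2 outweigh the factor 2^n. *)
Lemma spread_meeting (R : realType) (V : finType) (E : {set {set V}}) e e' n
  (q : R) :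
  graph_edges E -> e \in E -> e' \in E -> e != e' -> ~~ [disjoint e & e'] ->
  (0 < n)%N -> 0 <= q -> spread E n q -> 1 <= q * n%:R.
Proof.
move=> EE eE e'E ee' meet n0 q0 sp; pose J := [set e; e'].
have JE : J \subset E by apply/subsetP => u; rewrite !inE => /orP[] /eqP->.
have J0 : J != set0 by apply/set0Pn; exists e; rewrite !inE eqxx.
have := sp J JE J0; rewrite cards2 ee' /= expr1 => /le_trans; apply.
rewrite ler_wpM2l //; set v := (_ - 2)%N.
have v1 : (v <= 1)%N.
  rewrite leq_subLR /cover bigcup_setU !big_set1 cardsU (EE e eE) (EE e' e'E).
  by have : (0 < #|e :&: e'|)%N; [rewrite card_gt0 setI_eq0 | lia].
case: v v1 => [|[|//]] _; rewrite ?expr1 // expr0 ler1n //.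
Qed.

(** With these, the comparisons of exponents below become linear in the powers of k taken as
    atoms. *)
Lemma pow_facts k : (3 <= k)%N ->
  [/\ 3 * k <= k ^ 2, 3 * k ^ 2 <= k ^ 3, 3 * k ^ 3 <= k ^ 4 & 9 * k ^ 4
    <= k ^ 6]%N.
Proof.
move=> k3; have step j : (3 * k ^ j <= k ^ j.+1)%N
  by rewrite expnS leq_mul2r k3 orbT.
split; rewrite ?step //; first by have := step 1%N; rewrite expn1.
apply: leq_trans (step 5); apply: (@leq_trans (3 * (3 * k ^ 4))).
  by rewrite mulnA.
by rewrite leq_mul2l step.
Qed.

Lemma rho_exp k : (2 * (2 * k) = 4 * k)%N /\
  (5 * k ^ 2 * (2 * k) = 10 * k ^ 3)%N.
Proof. by split; rewrite ?(expnS k 2); lia. Qed.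

Lemma c_exp k : (2 * (2 * k ^ 2) = 4 * k ^ 2)%N /\
  (5 * k ^ 2 * (2 * k ^ 2) = 10 * k ^ 4)%N.
Proof. by split; rewrite ?(expnD k 2 2); lia. Qed.

Lemma density_exp k i : (3 <= k)%N -> (2 * i <= k ^ 2)%N ->
  (5 + 2 * k ^ 2 + (k + i) * 2 <= 5 * k ^ 2)%N.
Proof. by move=> k3; have [h1 _ _ _] := pow_facts k3; move: (k ^ 2)%N h1;
  lia. Qed.

Lemma linear_le_pow k : (3 <= k)%N -> (2 * k <= 2 ^ (4 * k ^ 3))%N.
Proof.
move=> k3; have [h1 h2 _ _] := pow_facts k3.
apply: leq_trans (ltnW (ltn_expl _ (isT : 1 < 2)%N)).
by move: (k ^ 2)%N (k ^ 3)%N h1 h2; lia.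
Qed.

Lemma sparse_exp k : (3 <= k)%N ->
  (8 * k ^ 2 + 4 * k * 2 <= 37 * k ^ 2)%N /\
  (21 * k ^ 4 + 10 * k ^ 3 * 2 + 1 <= 122 * k ^ 4)%N.
Proof.
move=> k3; have [h1 h2 h3 _] := pow_facts k3.
by move: (k ^ 2)%N (k ^ 3)%N (k ^ 4)%N h1 h2 h3; lia.
Qed.

Lemma kap_exp k : (3 <= k)%N -> (10 * k ^ 4 * 2 + (2 * k ^ 2 + 7) + 2
  <= 21 * k ^ 4)%N.
Proof.
move=> k3; have [h1 h2 h3 _] := pow_facts k3.
by move: (k ^ 2)%N (k ^ 3)%N (k ^ 4)%N h1 h2 h3; lia.
Qed.

Lemma lam1_exp k i : (3 <= k)%N -> (2 * i <= k ^ 2)%N ->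
  (4 * k ^ 2 * 2 + (1 + 4 * k * (k - 2) + 8 * k ^ 2 * i) <= 19 * k ^ 4)%N /\
  (10 * k ^ 4 * 2 + (2 * k ^ 2 + 7) +
    (0 + 10 * k ^ 3 * (k - 2) + 21 * k ^ 4 * i)
     + (k.+1 + i) <= 55 * k ^ 6)%N.
Proof.
move=> k3 ik; have [h1 h2 h3 h6] := pow_facts k3.
have m1 : (4 * k * (k - 2) <= 4 * k ^ 2)%N.
  by rewrite -mulnn -mulnA leq_mul2l leq_mul2l leq_subr orbT.
have m2 : (8 * k ^ 2 * i <= 4 * k ^ 4)%N.
  by have := leq_mul (leqnn (4 * k ^ 2)) ik; rewrite (expnD k 2 2); lia.
have m3 : (10 * k ^ 3 * (k - 2) <= 10 * k ^ 4)%N.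
  by rewrite (expnSr k 3) -mulnA leq_mul2l leq_mul2l leq_subr orbT.
have m4 : (21 * k ^ 4 * i <= 21 * k ^ 6)%N.
  have := leq_mul (leqnn (21 * k ^ 4)) ik; rewrite (expnD k 4 2); lia.
move: m1 m2 m3 m4; move: (4 * k * (k - 2))%N (8 * k ^ 2 * i)%N => a b.
move: (10 * k ^ 3 * (k - 2))%N (21 * k ^ 4 * i)%N => c e.
by move: (k ^ 2)%N (k ^ 3)%N (k ^ 4)%N (k ^ 6)%N ik h1 h2 h3 h6 => *; split;
  lia.
Qed.

Lemma lam2_exp k i : (3 <= k)%N -> (2 * i <= k ^ 2)%N ->
  (4 * k ^ 2 <= 19 * k ^ 4)%N /\ (10 * k ^ 4 + (2 * i.+1 + 1) <= 55 * k ^ 6)%N.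
Proof.
move=> k3 ik; have [h1 h2 h3 h6] := pow_facts k3.
by move: (k ^ 2)%N (k ^ 3)%N (k ^ 4)%N (k ^ 6)%N ik h1 h2 h3 h6 => *; split;
  lia.
Qed.

Lemma theta_exp k : (3 <= k)%N ->
  (8 * k ^ 2 + 4 * k * 2 <= 37 * k ^ 2)%N /\
  (21 * k ^ 4 + 10 * k ^ 3 * 2 + (5 + k * 2) <= 118 * k ^ 4)%N /\
  (21 * k ^ 4 + 10 * k ^ 3 * 2 + (5 + k * 2) + 3 <= 122 * k ^ 4)%N.
Proof.
move=> k3; have [h1 h2 h3 _] := pow_facts k3.
by move: (k ^ 2)%N (k ^ 3)%N (k ^ 4)%N h1 h2 h3 => *; do !split; lia.
Qed.

Section Constants.
Variables (R : realType) (x B Ci Ni : R) (k i : nat).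
Hypotheses (k3 : (3 <= k)%N) (ik : (2 * i <= k ^ 2)%N).
Hypotheses (x01 : 0 < x <= 1) (B01 : 0 < B <= 1) (Ci1 : 1 <= Ci)
  (Ni1 : 1 <= Ni).

(** The square of x comes from the second-moment bound; 2^(5k^2) dominates the constants in
    [density_le]. *)
Definition eta_of : R := gauge x 2 (5 * k ^ 2).
(** The power eta^(2k): the relative size of the smallest vertex set met by the Ramsey recursion. *)
Definition rho_of : R := gauge x (4 * k) (10 * k ^ 3).
(** The square of c is x^(8k^2) / 2^(20k^4); the further 2^(k^4) brings alpha below kap/4. *)
Definition alpha_of : R := gauge x (8 * k ^ 2) (21 * k ^ 4).
(** The failure rate of the first round, from B (alpha p / 2) C(m,2) / (8i) with m >= rho n, C(m,2)
    >= m^2/4 and 2i <= k^2. *)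
Definition theta_of : R := B * alpha_of * rho_of ^+ 2 / (32 * k%:R ^+ 2).
Let c : R := eta_of ^+ (2 * k ^ 2).
Let kap : R := c ^+ 2 / 2 ^+ (2 * k ^ 2 + 7).
Let C' : R := 2 ^+ (122 * k ^ 4) / (B ^+ 4 * x ^+ (37 * k ^ 2)) * Ci.
Let b' : R := x ^+ (37 * k ^ 2) / 2 ^+ (118 * k ^ 4) * B ^+ 4.
Let a' : R := x ^+ (19 * k ^ 4) / 2 ^+ (55 * k ^ 6).

Let x0 : 0 < x. Proof. by case/andP: x01. Qed.
Let B0 : 0 < B. Proof. by case/andP: B01. Qed.
Let B1 : B <= 1. Proof. by case/andP: B01. Qed.
Let Ci0 : 0 < Ci. Proof. exact: lt_le_trans Ci1. Qed.

Lemma rho_ofE : rho_of = eta_of ^+ (2 * k).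
Proof. by rewrite /eta_of gaugeX; have [-> ->] := rho_exp k. Qed.

Let cE : c = gauge x (4 * k ^ 2) (10 * k ^ 4).
Proof. by rewrite /c /eta_of gaugeX; have [-> ->] := c_exp k. Qed.

Let rho2E : alpha_of * rho_of ^+ 2
  = gauge x (8 * k ^ 2 + 4 * k * 2) (21 * k ^ 4 + 10 * k ^ 3 * 2).
Proof. by rewrite gaugeX gaugeM. Qed.

Let B4le : B ^+ 4 <= B.
Proof. by rewrite -[leRHS]expr1 ler_wiXn2l // ltW. Qed.

Lemma density_le : 32 * 2 ^+ (2 * k ^ 2) * (2 ^+ k * 2 ^+ i) ^+ 2 * eta_of
  <= x ^+ 2.
Proof.
have -> : 32 * 2 ^+ (2 * k ^ 2) * (2 ^+ k * 2 ^+ i) ^+ 2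
    = 2 ^+ (5 + 2 * k ^ 2 + (k + i) * 2) :> R.
  by rewrite !exprD exprM exprD; congr (_ * _ * _); ring.
rewrite /eta_of /gauge mulrCA ler_piMr ?exprn_ge0 ?(ltW x0) //.
rewrite ler_pdivrMr ?exprn_gt0 // mul1r ler_weXn2l ?ler1n //.
exact: density_exp.
Qed.

(** Of the exponent 14k^3, a part 10k^3 cancels the denominator of rho; the remaining 2^(4k^3)
    exceeds 2k. *)
Lemma size_le (n : R) : 2 ^+ (14 * k ^ 3) / x ^+ (4 * k) * Ni <= n ->
  (2 * k)%:R <= rho_of * n /\ Ni <= rho_of * n.
Proof.
move=> hn; have r0 : 0 < rho_of by apply: gauge_gt0.
have low : 2 ^+ (4 * k ^ 3) * Ni <= rho_of * n.
  apply: le_trans (_ : rho_of * (2 ^+ (14 * k ^ 3) / x ^+ (4 * k) * Ni) <= _).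
    rewrite le_eqVlt; apply/orP; left; apply/eqP; rewrite /rho_of /gauge.
    have -> : (14 * k ^ 3 = 4 * k ^ 3 + 10 * k ^ 3)%N by rewrite -(mulnDl 4 10).
    rewrite exprD; have xk : x ^+ (4 * k) != 0 by rewrite expf_neq0 // gt_eqF.
    have tk : 2 ^+ (10 * k ^ 3) != 0 :> R by rewrite expf_neq0 ?pnatr_eq0.
    move: (x ^+ _) (2 ^+ (4 * _)) (2 ^+ (10 * _)) xk tk => X t t' X0 t0.
    by field; rewrite X0 t0.
  by rewrite ler_wpM2l // ltW.
have t1 : 1 <= 2 ^+ (4 * k ^ 3) :> R by rewrite exprn_ege1 // ler1n.
split; apply: le_trans low.
  apply: le_trans (_ : 2 ^+ (4 * k ^ 3) <= _).
    by rewrite -natrX ler_nat linear_le_pow.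
  by rewrite ler_peMr // exprn_ge0.
by rewrite ler_peMl // (le_trans ler01).
Qed.

Let CE : C' = Ci / (B ^+ 4 * gauge x (37 * k ^ 2) (122 * k ^ 4)).
Proof.
rewrite /C' /gauge; have xk : x ^+ (37 * k ^ 2) != 0
  by rewrite expf_neq0 // gt_eqF.
have tk : 2 ^+ (122 * k ^ 4) != 0 :> R by rewrite expf_neq0 ?pnatr_eq0.
have bk : B != 0 by rewrite gt_eqF.
move: (x ^+ _) (2 ^+ (122 * _)) xk tk => X t X0 t0.
by field; rewrite X0 t0 bk.
Qed.

Let C'_gt0 : 0 < C'.
Proof. by rewrite CE divr_gt0 // mulr_gt0 ?exprn_gt0 ?gauge_gt0. Qed.

(** C' must pay for calling the induction hypothesis at probability alpha p / 2 on vertex sets of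
    size rho n, a loss of alpha rho^2 / 2 by [spread_scale]. *)
Lemma sparse_le (p : R) : 0 < p -> p / C'
  <= alpha_of * p / 2 / Ci * rho_of ^+ 2.
Proof.
move=> p0; rewrite CE invfM invrK.
have -> : alpha_of * p / 2 / Ci * rho_of ^+ 2
   = p * (Ci^-1 * (alpha_of * rho_of ^+ 2 / 2 ^+ 1)) by rewrite expr1; ring.
rewrite ler_wpM2l ?(ltW p0) // ler_wpM2l ?invr_ge0 ?(ltW Ci0) //.
rewrite rho2E gauge_half; have [h1 h2] := sparse_exp k3.
apply: le_trans (_ : gauge x (37 * k ^ 2) (122 * k ^ 4) <= _);
  last exact: gauge_le.
have g0 := gauge_gt0 x01 (37 * k ^ 2) (122 * k ^ 4).
by rewrite ler_piMl ?(ltW g0) // (le_trans B4le).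
Qed.

Lemma alpha_kap : 4 * alpha_of <= kap.
Proof.
rewrite /kap cE gaugeX gauge_half.
have -> : 4 * alpha_of = alpha_of * 2 ^+ 2 by ring.
rewrite -ler_pdivlMr ?exprn_gt0 // gauge_half; apply: gauge_le => //.
  by rewrite mulnAC; apply: leqnn.
exact: kap_exp.
Qed.

Lemma alpha_le_quarter : 0 < alpha_of <= 1 / 4.
Proof.
rewrite gauge_gt0 //=; have -> : 1 / 4 = gauge x 0 2 by rewrite /gauge expr0;
  field.
apply: gauge_le => //; apply: (@leq_trans 21) => //.
by rewrite leq_pmulr // expn_gt0; case: (k) k3.
Qed.

(** The case of many edges in their own colour. The dominant loss is alpha^i with 2i <= k^2, which
    is why a' carries exponents of order k^4 and k^6. *)
Lemma lam1_le (n p lam : R) : 0 < p -> 0 <= n -> lam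
  <= a' * n ^+ k * p ^+ i.+1 ->
  lam <= kap * p * n ^+ 2
    * (x * (rho_of * n) ^+ (k - 2) / 2 ^+ k.+1 * (alpha_of * p / 2) ^+ i).
Proof.
move=> p0 n0 /le_trans; apply.
have -> : kap * p * n ^+ 2 * (x * (rho_of * n) ^+ (k - 2) / 2 ^+ k.+1
  * (alpha_of * p / 2) ^+ i)
   = kap * (x * rho_of ^+ (k - 2) * alpha_of ^+ i) / 2 ^+ (k.+1 + i) * n ^+ k
     * p ^+ i.+1.
  have -> : n ^+ k = n ^+ 2 * n ^+ (k - 2) by rewrite -exprD subnKC // ltnW.
  move: rho_of alpha_of kap => r al ka.
  rewrite !exprMn exprVn exprD (exprS p) invfM;
    move: (2 ^+ k.+1) (2 ^+ i) => t t'.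
  by move: (r ^+ _) (al ^+ _) (n ^+ (k - 2)) => r' al' n'; ring.
rewrite ler_wpM2r ?exprn_ge0 ?(ltW p0) // ler_wpM2r ?exprn_ge0 //.
have -> : x * rho_of ^+ (k - 2) * alpha_of ^+ i
   = gauge x 1 0 * rho_of ^+ (k - 2) * alpha_of ^+ i
     by rewrite /gauge expr0 divr1 expr1.
rewrite /kap cE !gaugeX gauge_half !gaugeM gauge_half.
have [h1 h2] := lam1_exp k3 ik.
exact: gauge_le.
Qed.

Lemma lam2_le (n p p2 lam : R) : 0 < p -> 0 <= n -> p / 2 <= p2 ->
  lam <= a' * n ^+ k * p ^+ i.+1 ->
  lam <= c * n ^+ k * (p2 / 2) ^+ i.+1 / 2.
Proof.
move=> p0 n0 pp2 /le_trans; apply.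
have P2 : (p / 2 ^+ 2) ^+ i.+1 <= (p2 / 2) ^+ i.+1.
  have pq : p / 2 ^+ 2 <= p2 / 2 by lra.
  by rewrite lerXn2r // nnegrE; [|apply: le_trans pq];
    rewrite divr_ge0 ?exprn_ge0 // ltW.
apply: le_trans (_ : c * n ^+ k * (p / 2 ^+ 2) ^+ i.+1 / 2 <= _); last first.
  have c0 : 0 <= c by rewrite cE ltW // gauge_gt0.
  apply: ler_wpM2r; first by rewrite invr_ge0.
  by apply: ler_wpM2l => //; apply: mulr_ge0 => //; apply: exprn_ge0.
have -> : c * n ^+ k * (p / 2 ^+ 2) ^+ i.+1 / 2
    = c / 2 ^+ (2 * i.+1 + 1) * n ^+ k * p ^+ i.+1.
  rewrite expr_div_n -exprM [2 ^+ (_ + 1)]exprD expr1 invfM.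
  by move: (2 ^+ (2 * i.+1)) (n ^+ k) (p ^+ i.+1) c => t N P cc; ring.
rewrite ler_wpM2r ?exprn_ge0 ?(ltW p0) // ler_wpM2r ?exprn_ge0 //.
by rewrite cE gauge_half; have [h1 h2] := lam2_exp k3 ik; apply: gauge_le.
Qed.

Let theta_ge : B * gauge x (8 * k ^ 2 + 4 * k * 2)
    (21 * k ^ 4 + 10 * k ^ 3 * 2 + (5 + k * 2)) <= theta_of.
Proof.
rewrite /theta_of -(mulrA B) rho2E -mulrA ler_wpM2l ?(ltW B0) //.
rewrite -gauge_half ler_wpM2l ?(ltW (gauge_gt0 _ _ _)) //.
have k0 : (0 : R) < k%:R by rewrite ltr0n; case: (k) k3.
have kk0 : 0 < 32 * k%:R ^+ 2 :> R by apply: mulr_gt0 => //; apply: exprn_gt0.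
have kpow : 32 * k%:R ^+ 2 <= 2 ^+ (5 + k * 2) :> R.
  rewrite exprD exprM; apply: ler_pM; rewrite ?exprn_ge0 //.
    by rewrite -natrX ler_nat.
  by rewrite -!natrX ler_nat leq_exp2r // ltnW // ltn_expl.
by rewrite lef_pV2 // posrE; apply: exprn_gt0.
Qed.

Lemma theta_le_alpha : theta_of <= alpha_of.
Proof.
have k1 : (1 : R) <= k%:R by rewrite ler1n; case: (k) k3.
have al0 : 0 < alpha_of by apply: gauge_gt0.
have rho1 : 0 <= rho_of ^+ 2 <= 1.
  by rewrite sqr_ge0 exprn_ile1 ?gauge_le1 // ltW // gauge_gt0.
have k21 : 1 <= 32 * k%:R ^+ 2 :> R.
  by have : (1 : R) <= k%:R ^+ 2; [rewrite exprn_ege1 | lra].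
have /andP[r0 r1] := rho1.
rewrite /theta_of ler_pdivrMr ?(lt_le_trans ltr01 k21) //.
apply: le_trans (_ : alpha_of * 1 <= _); last by rewrite ler_wpM2l // ltW.
rewrite mulr1 -mulrA mulrCA ler_piMr ?(ltW al0) //.
by rewrite mulr_ile1 // ltW.
Qed.

Lemma b_le_theta : b' <= theta_of.
Proof.
apply: le_trans theta_ge; rewrite /b' mulrC; have [h1 [h2 _]] := theta_exp k3.
apply: ler_pM => //.
- by rewrite exprn_ge0 // ltW.
- by apply: ltW; apply: gauge_gt0.
exact: gauge_le.
Qed.

(** Together with C' <= p n this yields 8 n <= theta p n^2, the condition of [expR_sum_le]. *)
Lemma theta_C : 8 <= theta_of * C'.
Proof.
have D0 : 0 < B ^+ 4 * gauge x (37 * k ^ 2) (122 * k ^ 4).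
  by apply: mulr_gt0; [apply: exprn_gt0 | apply: gauge_gt0].
rewrite CE mulrA ler_pdivlMr //.
apply: le_trans (_ : theta_of * 1 <= _); last first.
  rewrite ler_wpM2l //; apply: le_trans theta_ge.
  by rewrite mulr_ge0 // ltW // gauge_gt0.
rewrite mulr1; apply: le_trans theta_ge; have [h1 [_ h2]] := theta_exp k3.
have -> : 8 * (B ^+ 4 * gauge x (37 * k ^ 2) (122 * k ^ 4))
   = B ^+ 4 * (gauge x (37 * k ^ 2) (122 * k ^ 4) * 2 ^+ 3) by ring.
have g0 := gauge_gt0 x01 (37 * k ^ 2) (122 * k ^ 4).
apply: ler_pM => //.
- by rewrite exprn_ge0 // ltW.
- by apply: mulr_ge0; [apply: ltW | apply: exprn_ge0].
by rewrite -ler_pdivlMr ?exprn_gt0 // gauge_half; apply: gauge_le.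
Qed.

End Constants.

(** The scaling needed by the induction hypothesis implies the other two: the second moment at p1 on
    sets of size rho n, and Janson at p2/2 on the full vertex set, where nothing shrinks and rho is
    replaced by 1. *)
Lemma step_scales (R : realFieldType) (q alpha p p2 rho Ci : R) :
  0 < p -> 0 < alpha <= 1 / 4 -> 0 < rho <= 1 -> 1 <= Ci -> p / 2 <= p2 ->
  q <= alpha * p / 2 / Ci * rho ^+ 2 ->
  q <= alpha * p * rho ^+ 2 /\ q <= p2 / 2 * 1 ^+ 2.
Proof.
move=> p0 /andP[a0 a1] /andP[r0 r1] C1 pp2 qP.
have ap0 : 0 < alpha * p by rewrite mulr_gt0.
have r20 : 0 <= rho ^+ 2 <= 1 by rewrite sqr_ge0 exprn_ile1 // ltW.
have qa : q <= alpha * p * rho ^+ 2.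
  apply: le_trans qP _; have /andP[r2 _] := r20.
  apply: ler_wpM2r => //; have C0 : 0 < Ci by apply: lt_le_trans C1.
  rewrite ler_pdivrMr //; nra.
split=> //; apply: le_trans qa _; have /andP[r2 r21] := r20.
have : alpha * p <= p / 4 by nra.
have : alpha * p * rho ^+ 2 <= alpha * p by rewrite ler_piMr // ltW.
by rewrite expr1n mulr1; lra.
Qed.

(** The colour classes of the first round cost alpha/2, against a gain kap >= 4 alpha; what remains
    exceeds 2 theta. *)
Lemma step_exponent_le (R : realFieldType) (theta alpha kap p n : R) :
  theta <= alpha -> 4 * alpha <= kap -> 0 <= p -> 0 < alpha ->
  alpha * p * (n ^+ 2 / 2) + - (kap * p * n ^+ 2)
    <= - (2 * (theta * (p * n ^+ 2))).
Proof.
move=> ta ak p0 a0; have Z0 : 0 <= p * n ^+ 2 by rewrite mulr_ge0 ?sqr_ge0.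
have -> : alpha * p * (n ^+ 2 / 2) = alpha / 2 * (p * n ^+ 2) by field.
rewrite -(mulrA kap); move: (p * n ^+ 2) Z0 => Z Z0; nra.
Qed.

(** * The induction step *)

Section Step.
Variables (R : realType) (V W : finType).
Implicit Types (U : {set W}).
Variables (E : {set {set V}}) (d e e' : {set V}).
Hypotheses (EE : graph_edges E) (dE : d \in E) (E2 : (1 < #|E|)%N).
Hypotheses (eE : e \in E) (e'E : e' \in E) (ee' : e != e').
Hypothesis meeting : ~~ [disjoint e & e'].
Hypothesis k3 : (3 <= #|V|)%N.
Let E1 := E :\ d.
Let k := #|V|.
Let i := #|E1|.

(** The induction hypothesis is used at alpha p / 2 on every vertex set with at least rho n
    elements; hence it quantifies over both the set and the probability. *)
Lemma ramsey_step U (p x B Ci Ni : R) :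
  let C' := 2 ^+ (122 * k ^ 4) / (B ^+ 4 * x ^+ (37 * k ^ 2)) * Ci in
  let b' := x ^+ (37 * k ^ 2) / 2 ^+ (118 * k ^ 4) * B ^+ 4 in
  let a' := x ^+ (19 * k ^ 4) / 2 ^+ (55 * k ^ 6) in
  0 < p <= 1 -> 0 < x <= 1 -> 0 < B <= 1 -> 1 <= Ci -> 1 <= Ni ->
  2 ^+ (14 * k ^ 3) / x ^+ (4 * k) * Ni <= #|U|%:R ->
  spread E #|U| (p / C') ->
  (forall U' (q : R), 0 < q <= 1 -> Ni <= #|U'|%:R ->
    spread E1 #|U'| (q / Ci) ->
     Pr (@pv R W q) (fun S => ~~ arrow E1 U' (x * (#|U'| ^_ k)%:R * q ^+ i) S)
       <= expR (- (B * q * 'C(#|U'|, 2)%:R))) ->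
  Pr (pv p) (fun S => ~~ arrow E U (a' * (#|U| ^_ k)%:R * p ^+ #|E|) S)
    <= expR (- (b' * p * 'C(#|U|, 2)%:R)).
Proof.
move=> C' b' a' p01 x01 B01 Ci1 Ni1 hn sp IH.
have /andP[p0 p1] := p01; have /andP[x0 x1] := x01; have /andP[B0 B1] := B01.
have k0 : (0 < k)%N by apply: leq_trans k3.
have cardE : #|E| = i.+1 by rewrite (cardsD1 d E) dE.
have ik : (2 * i <= k ^ 2)%N := two_edges_le EE cardE.
pose rho := rho_of x k; pose alpha := alpha_of x k; pose eta := eta_of x k.
pose theta := theta_of x B k.
have rho01 : 0 < rho <= 1 by rewrite gauge_gt0 // gauge_le1.
have eta01 : 0 < eta <= 1 by rewrite gauge_gt0 // gauge_le1.
have al4 : 0 < alpha <= 1 / 4 := alpha_le_quarter k3 x01.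
have al2 : 0 < alpha <= 1 / 2.
  by have /andP[-> /le_trans] := al4; apply;
    rewrite ler_wpM2l // lef_pV2 ?posrE // ler_nat.
have /andP[al0 _] := al2.
have [_ _ p2lo _] := split_prob p01 al2.
have [kn Nn] := size_le k3 x01 Ni1 hn.
have C'0 : 0 < C'.
  apply: mulr_gt0; last exact: lt_le_trans ltr01 Ci1.
  apply: divr_gt0; first exact: exprn_gt0.
  by apply: mulr_gt0; apply: exprn_gt0.
have q0 : 0 <= p / C' by rewrite divr_ge0 // ltW.
have qP := sparse_le k3 x01 B01 Ci1 p0; rewrite -/k -/C' -/alpha -/rho in qP.
have [q1P q2P] := step_scales p0 al4 rho01 Ci1 p2lo qP.
have /andP[r0 r1] := rho01; have rho01' : 0 <= rho <= 1 by rewrite r1 ltW.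
have n0 : (0 : R) < #|U|%:R.
  have : (0 : R) < rho * #|U|%:R by apply: lt_le_trans kn;
    rewrite ltr0n muln_gt0 k0.
  by rewrite pmulr_rgt0.
have U0 : (0 < #|U|)%N by rewrite -(ltr0n R).
have ap0 : 0 < alpha * p by rewrite mulr_gt0.
have sp1 m : rho * #|U|%:R <= m%:R -> spread E m (alpha * p).
  by move=> rm; apply: spread_scale q0 (ltW ap0) rho01' rm q1P sp.
have p2_0 : 0 <= (p - alpha * p) / (1 - alpha * p) / 2.
  apply: divr_ge0 => //; apply: le_trans p2lo; apply: divr_ge0 => //.
  exact: ltW.
have sp2 : spread E #|U| ((p - alpha * p) / (1 - alpha * p) / 2).
  apply: (spread_scale (rho := 1) EE q0 p2_0 _ _ q2P sp); last by rewrite mul1r.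
  by rewrite ler01 lexx.
have [ap01 _ _ _] := split_prob p01 al2.
have IH' U' : rho * #|U|%:R <= #|U'|%:R ->
    Pr (@pv R W (alpha * p / 2)) (fun S =>
      ~~ arrow E1 U' (x * (#|U'| ^_ k)%:R * (alpha * p / 2) ^+ i) S)
       <= expR (- (B * (alpha * p / 2) * 'C(#|U'|, 2)%:R)).
  move=> rU'; apply: IH; first exact: half_gt0_le1.
    exact: le_trans rU'.
  apply: (spreadS (E := E)); first exact: subD1set.
  apply: spread_scale q0 _ rho01' rU' qP sp => //.
  by rewrite !divr_ge0 ?(ltW ap0) // (le_trans ler01).
set lam := a' * _ * _.
have lamP : lam <= a' * #|U|%:R ^+ k * p ^+ i.+1.
  rewrite /lam cardE ler_wpM2r ?exprn_ge0 ?(ltW p0) // ler_wpM2l //.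
    by rewrite /a' divr_ge0 ?exprn_ge0 // ltW.
  by rewrite -natrX ler_nat ffact_leX.
have lam1 := lam1_le k3 ik x01 p0 (ltW n0) lamP.
have lam2 := lam2_le k3 ik x01 p0 (ltW n0) p2lo lamP.
have fail := step_failure EE dE E2 p01 x0 B0 eta01 al2 (rho_ofE x k) kn
  (density_le k3 ik x01) sp1 sp2 IH' lam1.
rewrite cardE in fail; have {}fail := fail lam2.
apply: le_trans fail _; rewrite -expRD -/k -/i.
rewrite -[B * alpha * rho ^+ 2 / (32 * k%:R ^+ 2)]/theta -(mulrA theta p).
have pnC : C' <= p * #|U|%:R.
  have := spread_meeting EE eE e'E ee' meeting U0 q0 sp.
  by rewrite mulrAC ler_pdivlMr // mul1r.
have theta0 : 0 < theta.
  by apply: lt_le_trans (b_le_theta k3 x01 B01);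
    rewrite mulr_gt0 ?divr_gt0 ?exprn_gt0.
have CZ : 8 * #|U|%:R <= theta * (p * #|U|%:R ^+ 2).
  rewrite expr2 !mulrA ler_wpM2r ?(ltW n0) // -mulrA.
  by apply: le_trans (theta_C k3 x01 B01 Ci1) _; apply: ler_wpM2l => //;
    apply: ltW.
have sums := @expR_sum_le R #|U| theta (p * #|U|%:R ^+ 2) _ U0 CZ
  (step_exponent_le _ (theta_le_alpha k3 x01 B01) (alpha_kap k3 x01) (ltW p0)
    al0).
apply: le_trans sums _.
rewrite ler_expR lerN2.
have C2 : 'C(#|U|, 2)%:R <= #|U|%:R ^+ 2 / 2 :> R.
  have U2 : (2 <= #|U|)%N.
    rewrite -(ler_nat R); apply: le_trans (_ : rho * #|U|%:R <= _).
      by apply: le_trans kn; rewrite ler_nat leq_pmulr // k0.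
    by rewrite ler_piMl // ltW.
  by have /andP[] := bin2_bounds R U2.
have b0 : 0 <= b' * p.
  apply: mulr_ge0; last exact: ltW.
  apply: mulr_ge0; last by apply: exprn_ge0; apply: ltW.
  by apply: divr_ge0; apply: exprn_ge0 => //; apply: ltW.
apply: le_trans (ler_wpM2l b0 C2) _.
have bt := b_le_theta k3 x01 B01; rewrite -/b' -/theta in bt.
move: b' theta bt {theta0 CZ b0} => b'' th bt.
have -> : b'' * p * (#|U|%:R ^+ 2 / 2) = b'' * (p * #|U|%:R ^+ 2 / 2) by ring.
rewrite -(mulrA th) ler_wpM2r // divr_ge0 // mulr_ge0 ?sqr_ge0 //.
exact: ltW.
Qed.

End Step.

(** * Induction on the number of edges *)

Section Induction.
Variables (R : realType) (k : nat) (a b C N : nat -> R).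
Hypothesis k3 : (3 <= k)%N.
Hypotheses (ha1 : a 1%N = 1 / 2) (hb1 : b 1%N = 1 / 8).
Hypotheses (hC1 : C 1%N = 1) (hN1 : N 1%N = 1).
Hypothesis ha : forall i : nat, (1 <= i <= 'C(k, 2) - 1)%N ->
  a i.+1 = a i ^+ (19 * k ^ 4) / 2 ^+ (55 * k ^ 6).
Hypothesis hb : forall i : nat, (1 <= i <= 'C(k, 2) - 1)%N ->
  b i.+1 = a i ^+ (37 * k ^ 2) / 2 ^+ (118 * k ^ 4) * b i ^+ 4.
Hypothesis hC : forall i : nat, (1 <= i <= 'C(k, 2) - 1)%N ->
  C i.+1 = 2 ^+ (122 * k ^ 4) / (b i ^+ 4 * a i ^+ (37 * k ^ 2)) * C i.
Hypothesis hN : forall i : nat, (1 <= i <= 'C(k, 2) - 1)%N ->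
  N i.+1 = 2 ^+ (14 * k ^ 3) / a i ^+ (4 * k) * N i.

Lemma constants_bounds i : (1 <= i <= 'C(k, 2))%N ->
  [/\ 0 < a i <= 1, 0 < b i <= 1, 1 <= C i & 1 <= N i].
Proof.
elim: i => [//|[_ _|i IH /andP[_ iK]]].
  by rewrite ha1 hb1 hC1 hN1; split=> //; lra.
have i1 : (1 <= i.+1 <= 'C(k, 2) - 1)%N
  by rewrite /= subn1 -ltnS prednK // (leq_trans _ iK).
have [|a01 b01 C1 N1] := IH; first by rewrite /= ltnW.
have [/andP[a0 a1] /andP[b0 b1]] := (a01, b01).
rewrite ha // hb // hC // hN //.
have g01 u v : 0 < a i.+1 ^+ u / 2 ^+ v <= 1.
  by rewrite (gauge_gt0 a01 u v); apply: (gauge_le1 a01 u v).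
have g1 u v : 1 <= 2 ^+ v / a i.+1 ^+ u.
  rewrite ler_pdivlMr ?exprn_gt0 // mul1r.
  by apply: (@le_trans _ _ 1); rewrite ?exprn_ile1 ?exprn_ege1 ?ler1n ?(ltW a0).
split=> //.
- have /andP[g0 gle] := g01 (37 * k ^ 2)%N (118 * k ^ 4)%N.
  apply/andP; split; first by apply: mulr_gt0 => //; apply: exprn_gt0.
  by apply: mulr_ile1; rewrite ?(ltW g0) ?exprn_ge0 ?exprn_ile1 ?(ltW b0).
- have b40 : 0 < b i.+1 ^+ 4 by apply: exprn_gt0.
  have b41 : b i.+1 ^+ 4 <= 1 by rewrite exprn_ile1 // ltW.
  have au0 : 0 < a i.+1 ^+ (37 * k ^ 2) by apply: exprn_gt0.
  have au1 : a i.+1 ^+ (37 * k ^ 2) <= 1 by rewrite exprn_ile1 // ltW.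
  have C0 := le_trans ler01 C1; apply: le_trans C1 _; rewrite ler_peMl //.
  rewrite ler_pdivlMr ?mulr_gt0 // mul1r.
  by apply: (@le_trans _ _ 1); [rewrite mulr_ile1 // ltW
    | rewrite exprn_ege1 ?ler1n].
- by have N0 := le_trans ler01 N1; apply: le_trans N1 _; rewrite ler_peMl.
Qed.

Variables (V W : finType).
Hypothesis Vk : #|V| = k.
Implicit Types (E : {set {set V}}) (U : {set W}).

Definition has_meeting_edges E :=
  exists e e', [/\ e \in E, e' \in E, e != e' & ~~ [disjoint e & e']].

(** Admissibility survives the induction: remove an edge other than e and e' if there is one;
    otherwise E consists of these two, and a single edge is left. *)
Lemma removable_edge E : (1 < #|E|)%N -> has_meeting_edges E ->
  exists2 d, d \in E & #|E :\ d| = 1%N \/ has_meeting_edges (E :\ d).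
Proof.
move=> E2 [e [e' [eE e'E ee' meet]]].
have [/existsP[d /and3P[dE de de']]|/existsPn all2] :=
  boolP [exists d, [&& d \in E, e != d & e' != d]].
  exists d => //; right; exists e, e'; split=> //;
    by rewrite !inE ?eE ?e'E ?de ?de'.
exists e => //; left; suff -> : E :\ e = [set e'] by rewrite cards1.
apply/setP => d; rewrite !inE; have := all2 d.
rewrite !negb_and !negbK; have [->|de] := eqVneq d e;
  first by rewrite (negPf ee').
have [->|de'] := eqVneq d e'; first by rewrite e'E.
by rewrite /= ?orbF; case: (d \in E).
Qed.

Lemma quantitative_ramsey i E U (p : R) : (1 <= i <= 'C(k, 2))%N ->
  graph_edges E -> #|E| = i -> #|E| = 1%N \/ has_meeting_edges E ->
  0 < p <= 1 -> N i <= #|U|%:R -> spread E #|U| (p / C i) ->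
  Pr (pv p) (fun S => ~~ arrow E U (a i * (#|U| ^_ k)%:R * p ^+ i) S)
    <= expR (- (b i * p * 'C(#|U|, 2)%:R)).
Proof.
elim: i E U p => [//|[_|i IH]] E U p iK EE cE adm p01 NU sp.
  have /cards1P[d Ed] : #|E| == 1%N by apply/eqP.
  have d2 : #|d| = 2%N by apply: EE; rewrite Ed inE.
  have := @arrow_one_edge R V W d U p d2.
  by rewrite Ed ha1 hb1 expr1 Vk; apply; case/andP: p01 => /ltW-> ->.
have [E1|meet] := adm; first by rewrite E1 in cE.
have E2 : (1 < #|E|)%N by rewrite cE.
have [d dE adm1] := removable_edge E2 meet.
have [e [e' [eE e'E ee' dis]]] := meet.
have iK' : (1 <= i.+1 <= 'C(k, 2))%N by case/andP: iK => _ /ltnW.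
have i1 : (1 <= i.+1 <= 'C(k, 2) - 1)%N.
  by case/andP: iK => _ iK; rewrite /= subn1 -ltnS prednK // (leq_trans _ iK).
have [a01 b01 C1 N1] := constants_bounds iK'.
have cE1 : #|E :\ d| = i.+1.
  by move: cE; rewrite (cardsD1 d E) dE add1n => -[].
have V3 : (3 <= #|V|)%N by rewrite Vk.
rewrite hN // in NU; rewrite hC // in sp; rewrite ha // hb // -cE -Vk.
rewrite -Vk in NU sp.
apply: (ramsey_step EE dE E2 eE e'E ee' dis V3 p01 a01 b01 C1 N1 NU sp).
move=> U' q q01 NU' sp'; rewrite cE1 Vk; apply: IH => //.
by move=> x /setD1P[_ /EE].
Qed.

End Induction.

(** * From labelled copies to copies *)

Section Binomial.
Variables (R : realType) (n : nat).
Implicit Types (S : {set {set 'I_n}}) (G : sgraph 'I_n).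

Lemma graph_of_subproof S : is_sgraph ([set: 'I_n], S :&: pairs setT).
Proof.
by apply/forallP => e; apply/implyP; rewrite !inE subsetT => /and3P[_ _ ->].
Qed.

Definition graph_of S : sgraph 'I_n := SGraph (graph_of_subproof S).

Lemma Gnp_probE (p : R) (A : pred (sgraph 'I_n)) :
  Gnp_prob p A = Pr (pv p) (fun S => A (graph_of S)).
Proof.
rewrite /Gnp_prob (reindex_onto graph_of (@edges _)) /=; last first.
  move=> G /andP[/eqP vG _]; apply: val_inj; rewrite /= -vG.
  case: G vG => -[vG eG] GP /= vGT; rewrite /edges /verts /=; congr (_, _).
  apply/setIidPl/subsetP => e eG'; have /forallP/(_ e)/implyP/(_ eG') := GP.
  by rewrite /= inE.
rewrite big_mkcond; apply: eq_bigr => S _; rewrite /verts /edges /= eqxx /=.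
(* A set S containing anything but pairs has weight 0, so these S, which are not edge sets of
   graphs, do not affect the sum. *)
have [SP|SP] := boolP (S :&: pairs setT == S); last first.
  rewrite andbF; have /subsetPn[e eS eP] : ~~ (S \subset pairs setT).
    by apply: contra SP => /setIidPl ->.
  rewrite /wt (bigD1 e) //= eS /pv; move: eP;
    rewrite inE subsetT /= => /negPf->.
  by rewrite !mul0r.
rewrite andbT; case: (A _); rewrite ?mulr0 ?mulr1 //.
rewrite /wt (bigID (fun e : {set 'I_n} => #|e| == 2%N)) /= [X in _ * X]big1
  ?mulr1.
  by apply: eq_bigr => e e2; rewrite /pv e2 /edges /= (eqP SP).
move=> e e2; have eS : e \notin S.
  by rewrite -(eqP SP) !inE (negPf e2) !andbF.
by rewrite (negPf eS) /pv (negPf e2) subr0.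
Qed.

End Binomial.

Section Labelled.
Variables (T W : finType) (F : sgraph T).

(** Embeddings are defined on a whole type V, while [verts F] may be a proper subset of T; labelling
    by this subtype makes |V| equal to k. *)
Definition vertex := {x : T | x \in verts F}.
Definition ledge (e : {set T}) : {set vertex} := [set v | val v \in e].
Definition ledges : {set {set vertex}} := [set ledge e | e in edges F].

Lemma edgesP (e : {set T}) : e \in edges F -> e \subset verts F /\ #|e| = 2%N.
Proof.
move=> eF; have /forallP/(_ e)/implyP/(_ eF)/andP[eV /eqP e2] := sgraphP F.
by split.
Qed.

Lemma card_vertex : #|{: vertex}| = nverts F.
Proof. by rewrite card_sig; apply: eq_card => x. Qed.

Lemma val_ledge (e : {set T}) : e \subset verts F -> val @: ledge e = e.
Proof.
move=> eV; apply/setP => x; apply/imsetP/idP => [[v + ->]|xe];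
  first by rewrite inE.
by exists (Sub x (subsetP eV x xe)); rewrite ?inE SubK.
Qed.

Lemma ledge_val (e : {set vertex}) : ledge (val @: e) = e.
Proof. by apply/setP => v; rewrite inE mem_imset //; apply: val_inj. Qed.

Lemma graph_ledges : graph_edges ledges.
Proof.
move=> _ /imsetP[e /edgesP[eV e2] ->].
by rewrite -e2 -{2}(val_ledge eV) card_imset //; apply: val_inj.
Qed.

Lemma card_ledges : #|ledges| = nedges F.
Proof.
rewrite card_in_imset // => e e' /edgesP[eV _] /edgesP[eV' _] ee'.
by rewrite -(val_ledge eV) -(val_ledge eV') ee'.
Qed.

Lemma ledgesP (e : {set vertex}) : (e \in ledges) = (val @: e \in edges F).
Proof.
apply/imsetP/idP => [[d dF ->]|eF].
  by rewrite val_ledge //; case: (edgesP dF).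
by exists (val @: e); rewrite ?ledge_val.
Qed.

Lemma no_graph_subproof : is_sgraph (set0 : {set W}, set0 : {set {set W}}).
Proof. by apply/forallP => e; rewrite inE. Qed.

(* The default value is never reached for injective labellings. *)
Definition copy_of (f : {ffun vertex -> W}) : sgraph W :=
  insubd (SGraph no_graph_subproof) (f @: setT, im f ledges).

Lemma copy_ofE (f : {ffun vertex -> W}) : injective f ->
  verts (copy_of f) = f @: setT /\ edges (copy_of f) = im f ledges.
Proof.
move=> fI; rewrite /verts /edges /copy_of insubdK //.
apply/forallP => e; apply/implyP => /= eF.
rewrite (im_edges fI graph_ledges eF) andbT; case/imsetP: eF => d _ ->.
exact: imsetS (subsetT _).
Qed.

Lemma isomorphic_copy (f : {ffun vertex -> W}) : injective f ->
  (0 < nverts F)%N -> isomorphic F (copy_of f).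
Proof.
move=> fI; rewrite -card_vertex => /card_gt0P[v0 _].
(* An isomorphism is encoded as a function on all of T; the default [v0] is used only off
   [verts F]. *)
pose g := [ffun x : T => f (insubd v0 x)].
have gE v : g (val v) = f v by rewrite ffunE valKd.
apply/existsP; exists g; have [-> ->] := copy_ofE fI; apply/and3P; split.
- apply/dinjectiveP => x y xF yF.
  by rewrite !ffunE => /fI/(congr1 val); rewrite !insubdK.
- rewrite eqEsubset; apply/andP; split; apply/subsetP => w /imsetP[x xF ->].
    by rewrite ffunE; apply: imset_f.
  by rewrite -gE imset_f //; apply: valP.
have gim (e : {set vertex}) : g @: (val @: e) = f @: e.
  by rewrite -imset_comp; apply: eq_imset => v /=; rewrite gE.
apply/eqP; rewrite /im /ledges -imset_comp; apply: eq_in_imset => e eF /=.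
by rewrite -gim val_ledge //; case: (edgesP eF).
Qed.

Lemma aut_gt0 : (0 < Defs.aut F)%N.
Proof.
apply/card_gt0P; exists 1%g; rewrite inE perm_on1 /=; apply/eqP.
rewrite -[RHS]imset_id; apply: eq_imset => e.
by rewrite -[RHS]imset_id; apply: eq_imset => x; rewrite perm1.
Qed.

(* Two labellings of the same copy differ by an automorphism of F. *)
Lemma labelling_automorphism (f0 f : {ffun vertex -> W}) :
  injective f0 -> injective f -> copy_of f = copy_of f0 ->
  exists2 s : {perm T},
    perm_on (verts F) s && ([set s @: (e : {set T}) | e in edges F] == edges F)
    & forall v u : vertex, val u = s (val v) -> f0 u = f v.
Proof.
move=> f0I fI ff0; have [v0E e0E] := copy_ofE f0I; have [vE eE] := copy_ofE fI.
(* This is f0^-1 after f; the choice always succeeds, as both labellings have the same image. *)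
pose t (v : vertex) : vertex := odflt v [pick u | f0 u == f v].
have tP v : f0 (t v) = f v.
  rewrite /t; case: pickP => [u /eqP //|none].
  have : f v \in f @: setT by apply: imset_f.
  by rewrite -vE ff0 v0E => /imsetP[u _ fu]; have := none u; rewrite fu eqxx.
have tI : injective t by move=> u v tuv; apply: fI; rewrite -!tP tuv.
(* Extended by the identity off [verts F], as the encoding of automorphisms requires. *)
pose st x := if insub x is Some v then val (t v) else x.
have stV v : st (val v) = val (t v) by rewrite /st valK.
have stN x : x \notin verts F -> st x = x by move=> xN; rewrite /st insubN.
have stI : injective st.
  move=> x y; have [xF|xN] := boolP (x \in verts F);
    have [yF|yN] := boolP (y \in verts F).
  - rewrite -[x](SubK vertex xF) -[y](SubK vertex yF) !stV.
    by move=> /val_inj/tI ->.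
  - rewrite -[x](SubK vertex xF) stV (stN y) // => ty.
    by move: yN; rewrite -ty (valP (t _)).
  - rewrite -[y](SubK vertex yF) stV (stN x) // => ty.
    by move: xN; rewrite ty (valP (t _)).
  - by rewrite !stN.
exists (perm stI); last first.
  by move=> v u; rewrite permE stV => /val_inj ->.
apply/andP; split.
  by apply/subsetP => x; rewrite inE permE; apply: contraR => /stN->.
rewrite eqEcard card_imset ?leqnn ?andbT; last exact/imset_inj/perm_inj.
apply/subsetP => _ /imsetP[e eF ->]; have [eV _] := edgesP eF.
have -> : perm stI @: e = val @: (t @: ledge e).
  rewrite -{1}(val_ledge eV) -!imset_comp; apply: eq_imset => v /=.
  by rewrite permE stV.
rewrite -ledgesP -(mem_im _ _ f0I) -e0E -ff0 eE.
have -> : f0 @: (t @: ledge e) = f @: ledge e.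
  by rewrite -imset_comp; apply: eq_imset => v /=; rewrite tP.
by rewrite mem_im //; apply: imset_f.
Qed.

(** Fix one labelling of a copy: every other labelling of it is determined by the automorphism
    relating the two, so a copy has at most [aut F] labellings. *)
Lemma card_labellings_le (X : {set {ffun vertex -> W}}) (M : {set sgraph W}) :
  (forall f, f \in X -> injective f /\ copy_of f \in M) ->
    (#|X| <= #|M| * Defs.aut F)%N.
Proof.
move=> XP.
have -> : #|X| = (\sum_(H in M) #|[set f in X | copy_of f == H]|)%N.
  rewrite -sum1_card (partition_big copy_of (mem M)) /=; last by move=> f /XP[].
  by apply: eq_bigr => H _; rewrite -sum1_card; apply: eq_bigl => f;
    rewrite inE.
rewrite -sum_nat_const; apply: leq_sum => H _.
have [->|[f0 f0H]] := set_0Vmem [set f in X | copy_of f == H];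
  first by rewrite cards0.
have /setIdP[f0X /eqP f0E] := f0H; have [f0I _] := XP f0 f0X.
pose rep (f : {ffun vertex -> W}) (s : {perm T}) :=
  perm_on (verts F) s && ([set s @: (e : {set T}) | e in edges F] == edges F)
  && [forall v : vertex, forall u : vertex, (val u == s (val v)) ==>
    (f0 u == f v)].
pose phi f := odflt 1%g [pick s | rep f s].
have phiP f : f \in [set f in X | copy_of f == H] -> rep f (phi f).
  move=> /setIdP[fX /eqP fE]; have [fI _] := XP f fX; rewrite /phi.
  case: pickP => [s //|none]; have [|s sA sf] := labelling_automorphism f0I fI.
    by rewrite fE f0E.
  have := none s; rewrite /rep sA /= => /negP[]; apply/forallP => v.
  by apply/forallP => u; apply/implyP => /eqP uv; apply/eqP/sf.
rewrite -(card_in_imset (f := phi)); last first.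
  move=> f g /phiP/andP[/andP[fV _] /'forall_forallP fP]
    /phiP/andP[_ /'forall_forallP gP] fg.
  apply/ffunP => v; have sv : phi f (val v) \in verts F.
    by rewrite perm_closed //; apply: valP.
  pose u : vertex := Sub (phi f (val v)) sv.
  have uE : val u = phi f (val v) by rewrite SubK.
  have := fP v u; rewrite uE eqxx => /eqP <-.
  by have := gP v u; rewrite uE fg eqxx => /eqP <-.
apply: subset_leq_card; apply/subsetP => _ /imsetP[f /phiP/andP[fA _] ->].
by rewrite inE.
Qed.

End Labelled.

Lemma arrows_of_arrow (R : realType) (T U : finType) (F : sgraph T)
  (G : sgraph U)
    (L lam : R) :
  (0 < nverts F)%N -> (0 < nedges F)%N -> verts G = setT ->
  lam * (Defs.aut F)%:R <= L -> arrow (ledges F) setT L (edges G) ->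
    arrows lam F G.
Proof.
move=> v0 e0 GT lamL /forallP aG; apply/forallP => c.
pose C := [set e | c e].
set M := [set H in copies F G | monochromatic c H].
have aF : (0 : R) < (Defs.aut F)%:R by rewrite ltr0n aut_gt0.
rewrite -(ler_pM2r aF); apply: le_trans lamL (le_trans (aG C) _).
rewrite -natrM ler_nat.
pose X (Z : {set {set U}}) := [set f in emb (vertex F) setT
  | im f (ledges F) \subset Z].
have E0 : ledges F != set0 by rewrite -card_gt0 card_ledges.
rewrite /cnt -/(X (edges G :&: C)) -/(X (edges G :\: C)) -cardsUI.
rewrite [X in (_ + X)%N]eq_card0 ?addn0; last first.
  move=> f; rewrite inE; apply/negP => /andP[/setIdP[_ f1] /setIdP[_ f2]].
  have /set0Pn[e eF] := E0; have ef : f @: e \in im f (ledges F)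
    by apply: imset_f.
  have := subsetP f1 _ ef; have := subsetP f2 _ ef.
  by rewrite !in_setD !in_setI => /andP[/negP nC _] /andP[_ /nC].
apply: card_labellings_le => f fX.
have fI : injective f by case/setUP: fX => /setIdP[/embP[]].
have fG : im f (ledges F) \subset edges G.
  by case/setUP: fX => /setIdP[_ /subset_trans]; apply;
    rewrite ?subsetIl ?subsetDl.
split=> //; have [vE eE] := copy_ofE fI.
rewrite !inE /subgraph vE eE fG GT subsetT isomorphic_copy //=.
apply/existsP; case/setUP: fX => /setIdP[_ fS]; [exists true | exists false];
  apply/forallP => e; apply/implyP; rewrite eE => ef.
  by have := subsetP fS e ef; rewrite !inE => /andP[_ ->].
by have := subsetP fS e ef; rewrite !inE => /andP[/negPf->].
Qed.

(** * From the density m_F to the spread condition *)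

Section Density.
Variables (R : realType) (T : finType) (F : sgraph T).

Lemma dens_cover_le (J : {set {set vertex F}}) :
  J \subset ledges F -> (1 < #|J|)%N ->
  (#|J|%:R - 1) / (#|cover J|%:R - 2) <= max_dens R F.
Proof.
move=> JE J1; pose J' := [set val @: (e : {set vertex F}) | e in J].
have J'F : J' \subset edges F.
  by apply/subsetP => _ /imsetP[e eJ ->]; rewrite -ledgesP (subsetP JE).
have HP : is_sgraph (val @: cover J, J').
  apply/forallP => e; apply/implyP => /= eJ'.
  have [_ ->] := edgesP (subsetP J'F e eJ'); rewrite eqxx andbT.
  by case/imsetP: eJ' => d dJ ->; apply: imsetS; apply: bigcup_sup.
pose H := SGraph HP.
have cJ' : #|J'| = #|J|.
  by apply: card_imset; apply: imset_inj; apply: val_inj.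
have HF : subgraph H F && (1 <= nedges H)%N.
  rewrite /subgraph /nedges /verts /edges /= J'F cJ' ltnW // !andbT.
  by apply/subsetP => _ /imsetP[v _ ->]; apply: valP.
have := @le_bigmax_cond _ _ _ 0 H (fun H => subgraph H F && (1 <= nedges H)%N)
  (@dens R T) HF.
apply: le_trans.
rewrite /dens /nedges /nverts /verts /edges /= cJ' J1 card_imset //.
exact: val_inj.
Qed.

(** For |J| = 1 both exponents vanish. Otherwise the density of the subgraph spanned by J gives |J|
    - 1 <= m_F (|cover J| - 2), so the resulting exponent of n is nonnegative. *)
Lemma spread_of_max_dens (n : nat) (q : R) : (0 < n)%N -> 0 <= q ->
  n%:R `^ (- (1 / max_dens R F)) <= q -> spread (ledges F) n q.
Proof.
move=> n0 q0 nq J JE J0; set m := max_dens R F in nq.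
have JE2 e : e \in J -> #|e| = 2%N by move/(subsetP JE)/(@graph_ledges T F).
have [J1|] := leqP #|J| 1.
  have /cards1P[e Je] : #|J| == 1%N by rewrite eqn_leq J1 card_gt0.
  have e2 : #|e| = 2%N by apply: JE2; rewrite Je inE.
  by rewrite Je cards1 /cover big_set1 e2 !expr0 mulr1.
move=> J1.
(* Two distinct edges do not fit on two vertices, so the density of J has a positive denominator. *)
have v3 : (2 < #|cover J|)%N.
  rewrite ltnNge; apply: contraL J1 => c2; rewrite -leqNgt.
  have /set0Pn[e eJ] := J0; suff -> : J = [set cover J] by rewrite cards1.
  have cover_edge d : d \in J -> d = cover J.
    move=> dJ; apply/eqP; rewrite eqEcard (JE2 d dJ) c2 andbT.
    exact: bigcup_sup.
  apply/setP => d; rewrite inE; apply/idP/eqP => [/cover_edge //|->].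
  by rewrite -(cover_edge e eJ).
set j := (#|J| - 1)%N; set v := (#|cover J| - 2)%N.
have v0 : (0 : R) < v%:R by rewrite ltr0n subn_gt0.
have jm : j%:R <= m * v%:R.
  have vE : #|cover J|%:R - 2 = v%:R :> R by rewrite natrB // ltnW.
  have jE : #|J|%:R - 1 = j%:R :> R by rewrite natrB // ltnW.
  by have := dens_cover_le JE J1; rewrite -/m jE vE ler_pdivrMr.
have m0 : 0 < m.
  by rewrite -(pmulr_lgt0 _ v0); apply: lt_le_trans jm; rewrite ltr0n subn_gt0.
have nr : (0 : R) < n%:R by rewrite ltr0n.
apply: le_trans (_ : (n%:R `^ (- (1 / m))) ^+ j * n%:R ^+ v <= _); last first.
  by rewrite ler_wpM2r ?exprn_ge0 // lerXn2r ?nnegrE ?powR_ge0.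
rewrite -powR_mulrn ?powR_ge0 // -powRrM -(powR_mulrn v (ltW nr)) -powRD;
  last first.
  by rewrite (gt_eqF nr) implybT.
rewrite -[leLHS](powRr0 n%:R); apply: ler_powR; first by rewrite ler1n.
rewrite mulNr addrC subr_ge0 mulrAC ler_pdivrMr // mul1r.
by rewrite [v%:R * m]mulrC.
Qed.

Lemma meeting_ledges : (2 <= max_degree F)%N -> has_meeting_edges (ledges F).
Proof.
move=> deg; have [x xF dx] : exists2 x, x \in verts F & (2 <= degree F x)%N.
  apply/exists_inP; apply: contraLR deg;
    rewrite negb_exists_in => /forall_inP none.
  rewrite -ltnNge ltnS; apply/bigmax_leqP => x xF.
  by have := none x xF; rewrite -ltnNge.
have /card_gt1P[e [e' [/setIdP[eF xe] /setIdP[eF' xe'] ee']]] := dx.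
exists (ledge F e), (ledge F e'); split.
- exact: imset_f.
- exact: imset_f.
- apply: contraNneq ee' => le; have [eV _] := edgesP eF;
  have [eV' _] := edgesP eF'.
  by rewrite -(val_ledge eV) -(val_ledge eV') le.
apply/pred0Pn; exists (Sub x xF : vertex F).
by rewrite /= !inE SubK xe xe'.
Qed.

End Density.

Lemma arrow_pairs (R : realType) (V W : finType) (E : {set {set V}})
  (U : {set W})
    (lam : R) S :
  graph_edges E -> arrow E U lam S -> arrow E U lam (S :&: pairs U).
Proof.
move=> EE /forallP aS; apply/forallP => D; apply: le_trans (aS D) _.
have cntP Z : (cnt E U Z <= cnt E U (Z :&: pairs U))%N.
  apply: subset_leq_card; apply/subsetP => f /setIdP[fU fZ]; apply/setIdP;
    split=> //.
  rewrite subsetI fZ; apply/subsetP => _ /imsetP[e eE ->].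
  by apply: emb_pair => //; apply: EE.
rewrite ler_nat; apply: leq_trans (leq_add (cntP _) (cntP _)) _.
by rewrite setIAC setIDAC.
Qed.

Theorem theorem1p2 (R : realType) (k : nat) (hk : (3 <= k)%N)
  (a b C N : nat -> R)
  (ha1 : a 1%N = 1 / 2) (hb1 : b 1%N = 1 / 8) (hC1 : C 1%N = 1) (hN1 : N 1%N = 1)
  (ha : forall i : nat, (1 <= i <= 'C(k, 2) - 1)%N ->
    a i.+1 = a i ^+ (19 * k ^ 4) / 2 ^+ (55 * k ^ 6))
  (hb : forall i : nat, (1 <= i <= 'C(k, 2) - 1)%N ->
    b i.+1 = a i ^+ (37 * k ^ 2) / 2 ^+ (118 * k ^ 4) * b i ^+ 4)
  (hC : forall i : nat, (1 <= i <= 'C(k, 2) - 1)%N ->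
    C i.+1 = 2 ^+ (122 * k ^ 4) / (b i ^+ 4 * a i ^+ (37 * k ^ 2)) * C i)
  (hN : forall i : nat, (1 <= i <= 'C(k, 2) - 1)%N ->
    N i.+1 = 2 ^+ (14 * k ^ 3) / a i ^+ (4 * k) * N i)
  (T : finType) (F : sgraph T) (hF : admissible k F)
  (n : nat) (p : R)
  (hn : N (nedges F) <= n%:R)
  (hp01 : 0 <= p <= 1)
  (hp : C (nedges F) * n%:R `^ (- (1 / max_dens R F)) <= p) :
  1 - expR (- (b (nedges F) * p * 'C(n, 2)%:R))
    <= Gnp_prob p (fun G : sgraph 'I_n =>
                     arrows (a (nedges F) * mu F n p) F G).
Proof.
have /andP[/eqP vF adm] := hF.
have cV : #|{: vertex F}| = k by rewrite card_vertex.
have EE := @graph_ledges T F.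
have cE : #|ledges F| = nedges F := card_ledges F.
have admE : #|ledges F| = 1%N \/ has_meeting_edges (ledges F).
  by case/orP: adm => [/eqP|/meeting_ledges]; rewrite ?cE; [left | right].
have e0 : (0 < nedges F)%N.
  case: admE => [|[e [_ [eE _ _ _]]]]; rewrite -cE; first by move->.
  by apply/card_gt0P; exists e.
have eK : (1 <= nedges F <= 'C(k, 2))%N.
  by rewrite e0 -cE -cV card_edges_le.
have [a01 b01 C1 N1] := constants_bounds ha1 hb1 hC1 hN1 ha hb hC hN eK.
have n0 : (0 < n)%N by rewrite -(ltr0n R) (lt_le_trans ltr01) // (le_trans N1).
have C0 : 0 < C (nedges F) by apply: lt_le_trans C1.
have p0 : 0 < p.
  by apply: lt_le_trans hp; rewrite mulr_gt0 // powR_gt0 // ltr0n.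
have p01 : 0 < p <= 1 by rewrite p0; case/andP: hp01.
have sp : spread (ledges F) #|[set: 'I_n]| (p / C (nedges F)).
  rewrite cardsT card_ord; apply: spread_of_max_dens => //.
    by rewrite divr_ge0 ?ltW.
  by rewrite ler_pdivlMr // mulrC.
have NU : N (nedges F) <= #|[set: 'I_n]|%:R by rewrite cardsT card_ord.
have := quantitative_ramsey hk ha1 hb1 hC1 hN1 ha hb hC hN cV eK EE cE admE p01
  NU sp.
rewrite Pr_predC cardsT card_ord lerBlDl -lerBlDr => /le_trans; apply.
rewrite Gnp_probE; apply: le_Pr; first exact: pv01.
move=> S aS.
have v0 : (0 < nverts F)%N by rewrite vF (leq_trans _ hk).
have aS' : arrow (ledges F) setT (a (nedges F) * (n ^_ k)%:R * p ^+ nedges F)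
    (edges (graph_of S)) by exact: arrow_pairs aS.
apply: (arrows_of_arrow v0 e0 _ _ aS') => //.
have aut0 : (Defs.aut F)%:R != 0 :> R by rewrite pnatr_eq0 -lt0n aut_gt0.
(* Multiplying mu by the number of automorphisms leaves C(n,k) k! p^e, the expected number of
   labelled copies. *)
rewrite /mu vF -bin_ffact natrM le_eqVlt; apply/orP; left; apply/eqP.
move: (a _) (p ^+ _) ('C(n, k)%:R) (k`!%:R) aut0 => a' P c f;
  move: (_%:R) => t t0.
by field.
Qed.
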